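(* Let $\chi_0:\mathbb{R}^d\to\mathbb{C}^d$ be a measurable function and let $\psi_0=|\chi_0|/2$. With the processes $\mathbf{X},\bar{\mathbf{X}}$ (initial data $\chi_0$) and $\mathbf{Y},\bar{\mathbf{Y}}$ (initial data $\psi_0$) described in the context: (a) The function $\psi(\xi,t)=\mathbb{E}_\xi[\mathbf{Y}\mathbbm{1}_{\zeta>t}]\in[0,\infty]$ satisfies (nFMS)$_{\psi_0}$ (with the convention $0\cdot\infty=0$). Moreover, $\psi=\bar\psi:=\mathbb{E}_\xi\bar{\mathbf{Y}}$, and $\psi$ is the pointwise limit of the Picard iteration $\psi^{(0)}=0$, $\psi^{(n+1)}=U(\psi_0)+\widetilde{\mathfrak{B}}(\psi^{(n)},\psi^{(n)})$. (b) For each $\xi\ne0$, $e^{t|\xi|^2}\psi(\xi,t)$ is a nondecreasing function of $t$. (c) (Majorizing principle) Suppose that for some $T\in(0,\infty]$, $\psi<\infty$ a.e. on $\mathbb{R}^d\times(0,T)$. Then there exists a subset $D\subset\mathbb{R}^d$ with full measure such that both $\mathbb{E}_\xi|\bar{\mathbf{X}}|$ and $\mathbb{E}_\xi[|\mathbf{X}|\mathbbm{1}_{\zeta>t}]$ are finite on $D_T=D\times[0,T)$. Moreover, the cascade solutions $\mathbb{E}_\xi[\mathbf{X}\mathbbm{1}_{\zeta>t}]$ and $\mathbb{E}_\xi\bar{\mathbf{X}}$ to (nFNS)$_{\chi_0}$ are well-defined on $D_T$, equal to each other (denoted by $\chi$), given by the pointwise limit of the Picard iteration $\chi^{(0)}=0$,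 $\chi^{(n+1)}=U(\chi_0)+\mathfrak{B}(\chi^{(n)},\chi^{(n)})$, and satisfy $|\chi|\le2\psi$ on $D_T$. (d) (Comparison principle) Let $\phi_0,\gamma_0:\mathbb{R}^d\to[0,\infty]$ be measurable functions, and let $\phi$ and $\gamma$ be the minimal cascade solutions to (nFMS)$_{\phi_0}$ and (nFMS)$_{\gamma_0}$, respectively. If $\phi_0\le\gamma_0$ on $\mathbb{R}^d$ then $\phi\le\gamma$ on $\mathbb{R}^d\times(0,\infty)$.
   Context: Product: for $\xi\in\mathbb{R}^d\setminus\{0\}$, $e_\xi=\xi/|\xi|$, $\pi_{\xi^\perp}a=a-(e_\xi\cdot a)e_\xi$ and $a\odot_\xi b=\frac{-i}{2}\big((e_\xi\cdot b)\pi_{\xi^\perp}a+(e_\xi\cdot a)\pi_{\xi^\perp}b\big)$ for $a,b\in\mathbb{C}^d$ (with $e_\xi\cdot a=\sum_j(e_\xi)_ja_j$). Kernel: $d\ge3$, and $h:\mathbb{R}^d\setminus\{0\}\to(0,\infty)$ is a fixed standard majorizing kernel, i.e. a measurable function with $(h*h)(\xi)=|\xi|h(\xi)$ for all $\xi\ne0$. $H(\eta|\xi)=\frac{h(\eta)h(\xi-\eta)}{|\xi|h(\xi)}$, a probability density in $\eta\in\mathbb{R}^d$. Cascade: $\mathbb{T}=\{0\}\cup\bigcup_{n\ge1}\{1,2\}^n$ is the binary tree with root $0$; $|v|$ is the generation of $v$ ($|0|=0$), $v|j$ is the truncation of $v$ to generation $j$ ($v|0=0$), and $v1,v2$ are the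 children of $v$ (the children of the root being $1,2$). For each $\xi\ne0$, on a probability space with measure $\mathbb{P}_\xi$ (expectation $\mathbb{E}_\xi$) there are families $\{W_v\}_{v\in\mathbb{T}}$, $\{T_v\}_{v\in\mathbb{T}}$ such that: (i) $W_0=\xi$; (ii) given $W_v$, $T_v$ is exponentially distributed with mean $|W_v|^{-2}$, $W_{v1}$ is independent of $T_v$ with density $H(\cdot|W_v)$, and $W_{v2}=W_v-W_{v1}$; (iii) given $W_{v1}$ and $W_{v2}$, the sub-families (of $W$'s and $T$'s) indexed by the subtrees rooted at $v1$ and $v2$ are independent of each other (and are cascades started at $W_{v1}$, $W_{v2}$). There is also an i.i.d. family $\{K_v\}_{v\in\mathbb{T}}$ of Bernoulli($1/2$) variables (values $0,1$), independent of $\{W_v\}$ and $\{T_v\}$. The explosion time is $\zeta=\zeta_\xi=\sup_{n\ge0}\min_{|v|=n}\sum_{j=0}^nT_{v|j}$. Processes: $\mathbf{X}(\xi,t)=\mathbf{X}_0(t)$ where $\mathbf{X}_v(s)=\chi_0(W_v)$ if $T_v\ge s$ and $\mathbf{X}_v(s)=\mathbf{X}_{v1}(s-T_v)\odot_{W_v}\mathbf{X}_{v2}(s-T_v)$ if $T_v<s$. $\bar{\mathbf{X}}(\xi,t)=\bar{\mathbf{X}}_0(t)$ where $\bar{\mathbf{X}}_v(s)=\chi_0(W_v)$ if $T_v\ge s$; $=0$ if $T_v<s$, $K_v=0$; $=2\bar{\mathbf{X}}_{v1}(s-T_v)\odot_{W_v}\bar{\mathbf{X}}_{v2}(s-T_v)$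 if $T_v<s$, $K_v=1$. For measurable $\psi_0:\mathbb{R}^d\to[0,\infty]$, $\mathbf{Y}$ and $\bar{\mathbf{Y}}$ are defined by the same recursions with $\chi_0$ replaced by $\psi_0$ and $\odot_{W_v}$ replaced by multiplication of numbers. On $[\zeta>t]$ the non-thinned recursions terminate after finitely many steps, so $\mathbf{X}\mathbbm{1}_{\zeta>t}$, $\mathbf{Y}\mathbbm{1}_{\zeta>t}$ are well defined ($0$ off $[\zeta>t]$); the thinned recursions terminate a.s. Equations: with $U(w)(\xi,t)=e^{-t|\xi|^2}w(\xi)$, $$\mathfrak{B}(f,g)(\xi,t)=\int_0^te^{-s|\xi|^2}|\xi|^2\int_{\mathbb{R}^d}f(\eta,t-s)\odot_\xi g(\xi-\eta,t-s)H(\eta|\xi)\,d\eta\,ds,$$ $$\widetilde{\mathfrak{B}}(f,g)(\xi,t)=\int_0^te^{-s|\xi|^2}|\xi|^2\int_{\mathbb{R}^d}f(\eta,t-s)g(\xi-\eta,t-s)H(\eta|\xi)\,d\eta\,ds,$$ (nFNS)$_{\chi_0}$ is $\chi=U(\chi_0)+\mathfrak{B}(\chi,\chi)$ and (nFMS)$_{\psi_0}$ is $\psi=U(\psi_0)+\widetilde{\mathfrak{B}}(\psi,\psi)$. The minimal cascade solution to (nFMS)$_{\psi_0}$ is $\mathbb{E}_\xi[\mathbf{Y}\mathbbm{1}_{\zeta>t}]\in[0,\infty]$. Points $\xi$ range over $\xi\ne0$. A set has full measure if its complement is Lebesgue null.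
   Formalization: In (iii), given W_{v1} and W_{v2}, the pair of subtree families is also assumed independent of the clock T_v; without this the clocks could be coupled along a path (e.g. |W_v|²T_v = |W_{v1}|²T_{v1}) and (nFMS) would fail for constant data below 1. *)

(* Defs.v *)
From HB Require Import structures.
From mathcomp Require Import all_boot all_order all_algebra.
From mathcomp Require Import complex.
From mathcomp Require Import all_classical all_reals all_analysis.
From mathcomp Require Import measurable_realfun.

Set Implicit Arguments.
Unset Strict Implicit.
Unset Printing Implicit Defensive.
Import Order.TTheory GRing.Theory Num.Theory.
Import numFieldNormedType.Exports.

Local Open Scope classical_set_scope.
Local Open Scope ring_scope.

(* The product (i.e. Borel) sigma-algebra on R^n = 'rV[R]_n, generated by the
   coordinates. *)
Section row_vector_measurable.
Context d (T : measurableType d) (n : nat).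

Let coord (i : 'I_n) (x : 'rV[T]_n) : T := x ord0 i.

Let row0 : g_sigma_preimage coord set0.
Proof. exact: sigma_algebra0. Qed.

Let rowC A : g_sigma_preimage coord A -> g_sigma_preimage coord (~` A).
Proof. exact: sigma_algebraC. Qed.

Let row_bigcup (F : _^nat) : (forall i, g_sigma_preimage coord (F i)) ->
  g_sigma_preimage coord (\bigcup_i (F i)).
Proof. exact: sigma_algebra_bigcup. Qed.

HB.instance Definition _ := @isMeasurable.Build (measure_tuple_display d)
  'rV[T]_n (g_sigma_preimage coord) row0 rowC row_bigcup.

Lemma measurable_coord (i : 'I_n) :
  measurable_fun [set: 'rV[T]_n] (fun x : 'rV[T]_n => x ord0 i).
Proof.
move=> _ Y mY; rewrite setTI; apply: sub_sigma_algebra => /=.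
rewrite -bigcup_seq/=; exists i => /=; first by rewrite mem_index_enum.
by exists Y => //; rewrite setTI.
Qed.

Lemma measurable_fun_row d' (S : measurableType d') (f : S -> 'rV[T]_n) :
  (forall i, measurable_fun [set: S] (fun x => f x ord0 i)) ->
  measurable_fun [set: S] f.
Proof.
move=> mf; apply: (measurability
  (\big[setU/set0]_(i < n) preimage_set_system setT (coord i) measurable)) => //.
move=> _ [A + <-]; rewrite -bigcup_seq => -[i _ [B mB <-]].
rewrite setTI; have := mf i measurableT B mB.
by rewrite !setTI.
Qed.

End row_vector_measurable.

(* Lebesgue measure on R^n, as the n-fold product of the one-dimensional
   Lebesgue measure; see lebesgue_rV_box. *)
Section lebesgue_rV.
Context (R : realType).

Definition cons_row n (p : R * 'rV[R]_n) : 'rV[R]_n.+1 :=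
  \row_i oapp (fun j => p.2 ord0 j) p.1 (unlift ord0 i).

Lemma measurable_cons_row n : measurable_fun setT (@cons_row n).
Proof.
apply: measurable_fun_row => i; case: (unliftP ord0 i) => [j|] -> /=.
  apply: (eq_measurable_fun (fun p : R * 'rV[R]_n => p.2 ord0 j)).
    by move=> p _; rewrite mxE liftK.
  exact: (measurableT_comp (measurable_coord j) measurable_snd).
apply: (eq_measurable_fun fst) => //.
by move=> p _; rewrite mxE unlift_none.
Qed.

Definition uncons_row n (x : 'rV[R]_n.+1) : R * 'rV[R]_n :=
  (x ord0 ord0, \row_j x ord0 (lift ord0 j)).

Lemma cons_rowK n : cancel (@cons_row n) (@uncons_row n).
Proof.
move=> [a x]; rewrite /uncons_row /cons_row /=; congr pair.
  by rewrite mxE unlift_none.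
by apply/rowP => j; rewrite !mxE liftK.
Qed.

Lemma measurable_uncons_row n : measurable_fun setT (@uncons_row n).
Proof.
apply: measurable_fun_pair; first exact: measurable_coord.
apply: measurable_fun_row => j.
apply: (eq_measurable_fun (fun x : 'rV[R]_n.+1 => x ord0 (lift ord0 j))).
  by move=> x _; rewrite mxE.
exact: measurable_coord.
Qed.

Section step.
Context n (mu : {sigma_finite_measure set 'rV[R]_n -> \bar R}).

Definition lebesgue_step : set 'rV[R]_n.+1 -> \bar R :=
  pushforward (lebesgue_measure \x mu)%E (@cons_row n).

Let step0 : lebesgue_step set0 = 0%E.
Proof. by rewrite /lebesgue_step /pushforward preimage_set0 measure0. Qed.

Let step_ge0 A : (0 <= lebesgue_step A)%E.
Proof. by rewrite /lebesgue_step /pushforward; exact: measure_ge0. Qed.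

Let step_sigma_additive : semi_sigma_additive lebesgue_step.
Proof.
move=> F mF tF mUF; rewrite /lebesgue_step /pushforward preimage_bigcup.
have mc A : measurable A -> measurable (@cons_row n @^-1` A).
  by move=> mA; rewrite -[X in measurable X]setTI; exact: measurable_cons_row.
apply: measure_semi_sigma_additive.
- by move=> k; exact: mc.
- apply/trivIsetP => /= i j _ _ ij; rewrite -preimage_setI.
  by move/trivIsetP : tF => /(_ _ _ _ _ ij) ->//; rewrite preimage_set0.
- by rewrite -preimage_bigcup; exact: mc.
Qed.

HB.instance Definition _ := isMeasure.Build _ _ _ lebesgue_step
  step0 step_ge0 step_sigma_additive.

Let step_sigma_finite : sigma_finite setT lebesgue_step.
Proof.
have /sigma_finiteP[F [TF ndF Foo]] := sigma_finiteT (@lebesgue_measure R).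
have /sigma_finiteP[G [TG ndG Goo]] := sigma_finiteT mu.
exists (fun k => @uncons_row n @^-1` (F k `*` G k)).
  rewrite -preimage_bigcup; apply/seteqP; split => // x _.
  have [i _ Fi] : (\bigcup_i F i) (uncons_row x).1 by rewrite -TF.
  have [j _ Gj] : (\bigcup_i G i) (uncons_row x).2 by rewrite -TG.
  exists (maxn i j) => //; split.
    by move: Fi; exact/subsetPset/ndF/leq_maxl.
  by move: Gj; exact/subsetPset/ndG/leq_maxr.
move=> k; have [mF Fk] := Foo k; have [mG Gk] := Goo k; split.
  rewrite -[X in measurable X]setTI; apply: measurable_uncons_row => //.
  exact: measurableX.
rewrite /lebesgue_step /pushforward -comp_preimage.
have -> : @uncons_row n \o @cons_row n = id by apply/funext; exact: cons_rowK.
rewrite preimage_id.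
by rewrite product_measure1E// lte_mul_pinfty// ge0_fin_numE.
Qed.

HB.instance Definition _ := Measure_isSigmaFinite.Build _ _ _ lebesgue_step
  step_sigma_finite.

End step.

Fixpoint lebesgue_rV n : {sigma_finite_measure set 'rV[R]_n -> \bar R} :=
  if n is m.+1 then lebesgue_step (lebesgue_rV m) else \d_(0 : 'rV[R]_0).

Lemma lebesgue_rV_box n (A : 'I_n -> set R) : (forall i, measurable (A i)) ->
  lebesgue_rV n [set x | forall i, A i (x ord0 i)] =
  (\prod_(i < n) lebesgue_measure (A i))%E.
Proof.
elim: n A => [|n IHn] A mA.
  rewrite big_ord0 /= diracE mem_set//=.
  by move=> -[].
have mB : measurable [set x : 'rV[R]_n | forall i, A (lift ord0 i) (x ord0 i)].
  have -> : [set x : 'rV[R]_n | forall i, A (lift ord0 i) (x ord0 i)] =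
      \bigcap_(i in setT) ((fun x : 'rV[R]_n => x ord0 i) @^-1` A (lift ord0 i)).
    by apply/seteqP; split => [x Ax i _|x Ax i]; exact: Ax.
  apply: fin_bigcap_measurable => // i _; rewrite -[X in measurable X]setTI.
  exact: measurable_coord.
rewrite big_ord_recl -(IHn (fun i => A (lift ord0 i)))//.
rewrite -product_measure1E//=; last exact: (mA ord0).
rewrite /lebesgue_step /pushforward.
congr product_measure1; apply/seteqP; split => -[a x] /=.
  move=> H; split => /= [|i].
    by have := H ord0; rewrite mxE unlift_none.
  by have := H (lift ord0 i); rewrite mxE liftK.
move=> [/= Aa Ax] i; rewrite mxE.
by case: (unliftP ord0 i) => [j|] ->.
Qed.

End lebesgue_rV.

Section vectors.
Context (R : realType) (n : nat).
Implicit Types (x xi : 'rV[R]_n) (a b : 'rV[R[i]]_n).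
Local Open Scope complex_scope.

(* Euclidean and Hermitian norms: the library norm `|x| on matrices is the sup
   norm. *)
Definition enorm x : R := Num.sqrt (\sum_j x ord0 j ^+ 2).

Definition cnorm a : R :=
  Num.sqrt (\sum_j (complex.Re (a ord0 j) ^+ 2 + complex.Im (a ord0 j) ^+ 2)).

Definition edir xi : 'rV[R]_n := (enorm xi)^-1 *: xi.

(* Bilinear, without conjugation. *)
Definition rdot x a : R[i] := \sum_j (x ord0 j)%:C * a ord0 j.

Definition proj_perp xi a : 'rV[R[i]]_n :=
  a - rdot (edir xi) a *: map_mx (real_complex R) (edir xi).

Definition odot xi a b : 'rV[R[i]]_n :=
  (- 'i / 2) *: (rdot (edir xi) b *: proj_perp xi a
                 + rdot (edir xi) a *: proj_perp xi b).

Definition cv_measurable d (S : measurableType d) (f : S -> 'rV[R[i]]_n) :=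
  forall j, measurable_fun setT (fun s => complex.Re (f s ord0 j)) /\
            measurable_fun setT (fun s => complex.Im (f s ord0 j)).

Definition cv_integrable d (S : measurableType d)
    (mu : {measure set S -> \bar R}) (D : set S) (f : S -> 'rV[R[i]]_n) :=
  forall j, mu.-integrable D (fun s => (complex.Re (f s ord0 j))%:E) /\
            mu.-integrable D (fun s => (complex.Im (f s ord0 j))%:E).

(* Coordinatewise integral; meaningful only under cv_integrable. *)
Definition cv_integral d (S : measurableType d)
    (mu : {measure set S -> \bar R}) (D : set S) (f : S -> 'rV[R[i]]_n) :
    'rV[R[i]]_n :=
  \row_j (Rintegral mu D (fun s => complex.Re (f s ord0 j))
          +i* Rintegral mu D (fun s => complex.Im (f s ord0 j))).

End vectors.

Section kernel.
Context (R : realType) (n : nat).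
Local Open Scope ereal_scope.

(* h is only meaningful on R^n \ {0}; its value at 0 is arbitrary, and {0} is
   Lebesgue null for n > 0. *)
Definition standard_majorizing (h : 'rV[R]_n -> R) :=
  [/\ forall x, x != 0%R -> (0 < h x)%R,
      measurable_fun [set x : 'rV[R]_n | x != 0%R] h &
      forall xi, xi != 0%R ->
        \int[lebesgue_rV R n]_eta (h eta * h (xi - eta)%R)%:E =
        (enorm xi * h xi)%:E].

Definition Hker (h : 'rV[R]_n -> R) (eta xi : 'rV[R]_n) : R :=
  (h eta * h (xi - eta) / (enorm xi * h xi))%R.

End kernel.

Section conditioning.
Context d d1 d2 d3 (O : measurableType d) (S : measurableType d1)
  (S1 : measurableType d2) (S2 : measurableType d3) (R : realType)
  (P : probability O R).
Local Open Scope ereal_scope.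

(* p is a version of z |-> P(E | Z = z). *)
Definition cond_prob (Z : O -> S) (E : set O) (p : S -> \bar R) :=
  [/\ measurable_fun setT p, forall z, 0 <= p z &
      forall B, measurable B ->
        P (E `&` Z @^-1` B) = \int[P]_(w in Z @^-1` B) p (Z w)].

(* k is a regular conditional distribution of X given Z. *)
Definition cond_dist (Z : O -> S) (X : O -> S1) (k : S -> set S1 -> \bar R) :=
  forall A, measurable A -> cond_prob Z (X @^-1` A) (k ^~ A).

(* X and Y are conditionally independent given Z. *)
Definition cond_indep (Z : O -> S) (X : O -> S1) (Y : O -> S2) :=
  forall A B p q, measurable A -> measurable B ->
    cond_prob Z (X @^-1` A) p -> cond_prob Z (Y @^-1` B) q ->
    cond_prob Z (X @^-1` A `&` Y @^-1` B) (fun z => p z * q z).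

End conditioning.

(* Families of elements of T indexed by I, with the product sigma-algebra. *)
Definition family_of (I T : Type) : Type := I -> T.

Section family_of.
Context (I : Type) d (T : measurableType d).

HB.instance Definition _ := gen_eqMixin (family_of I T).
HB.instance Definition _ := gen_choiceMixin (family_of I T).
HB.instance Definition _ :=
  isPointed.Build (family_of I T) (fun _ : I => point).

Definition family_cylinders : set (set (family_of I T)) :=
  \bigcup_(i in [set: I])
    preimage_set_system setT (fun f : family_of I T => f i) measurable.

Let family0 : <<s family_cylinders >> set0.
Proof. exact: sigma_algebra0. Qed.

Let familyC A : <<s family_cylinders >> A -> <<s family_cylinders >> (~` A).
Proof. exact: sigma_algebraC. Qed.

Let family_bigcup (F : _^nat) : (forall i, <<s family_cylinders >> (F i)) ->
  <<s family_cylinders >> (\bigcup_i (F i)).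
Proof. exact: sigma_algebra_bigcup. Qed.

HB.instance Definition _ := @isMeasurable.Build (measure_tuple_display d)
  (family_of I T) <<s family_cylinders >> family0 familyC family_bigcup.

End family_of.

(* Vertices of the binary tree: the label 1 is encoded by false, 2 by true; the
   root is [::], the generation of v is size v, its truncation to generation j
   is take j v. *)
Definition vertex := seq bool.
Definition child1 (v : vertex) : vertex := rcons v false.
Definition child2 (v : vertex) : vertex := rcons v true.

(* A probability space carrying the random variables W_v, T_v, K_v, where true
   encodes the value 1 of K_v. *)
Record tree_space (R : realType) (n : nat) := TreeSpace {
  ts_display : measure_display;
  ts_sort : measurableType ts_display;
  ts_P : probability ts_sort R;
  ts_W : vertex -> ts_sort -> 'rV[R]_n;
  ts_T : vertex -> ts_sort -> R;
  ts_K : vertex -> ts_sort -> bool;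
  ts_measurable_W : forall v, measurable_fun setT (ts_W v);
  ts_measurable_T : forall v, measurable_fun setT (ts_T v);
  ts_measurable_K : forall v, measurable_fun setT (ts_K v) }.

Arguments ts_P {R n} c : rename.
Arguments ts_W {R n} c v w : rename.
Arguments ts_T {R n} c v w : rename.
Arguments ts_K {R n} c v w : rename.

Section cascade.
Context (R : realType) (n : nat).
Local Open Scope ereal_scope.
Implicit Type c : tree_space R n.

Definition sub_cascade c (v : vertex) (w : ts_sort c) :
    family_of vertex ('rV[R]_n * R)%type :=
  fun u => (ts_W c (v ++ u) w, ts_T c (v ++ u) w).

Definition thinning c (w : ts_sort c) : family_of vertex bool :=
  fun u => ts_K c u w.

Arguments sub_cascade : clear implicits.
Arguments thinning : clear implicits.

Definition cascade_law c (A : set (family_of vertex ('rV[R]_n * R)%type)) :=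
  ts_P c (sub_cascade c [::] @^-1` A).

Arguments cascade_law : clear implicits.

(* The space C xi carries a cascade started at xi; the law of the cascades
   started at W_v1 and W_v2 is taken from the spaces C (W_v1) and C (W_v2). The
   branching property makes the two subtrees independent of each other and,
   jointly, of the clock T_v (cascade_clock_subtrees), given (W_v1, W_v2). *)
Record is_cascade (h : 'rV[R]_n -> R) (C : 'rV[R]_n -> tree_space R n)
    (xi : 'rV[R]_n) : Prop := {
  cascade_root : {ae ts_P (C xi), forall w, ts_W (C xi) [::] w = xi};
  cascade_clock : forall v,
    cond_dist (ts_P (C xi)) (ts_W (C xi) v) (ts_T (C xi) v)
      (fun x => exponential_prob (enorm x ^+ 2));
  cascade_density : forall v,
    cond_dist (ts_P (C xi)) (ts_W (C xi) v) (ts_W (C xi) (child1 v))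
      (fun x A => \int[lebesgue_rV R n]_(eta in A) (Hker h eta x)%:E);
  cascade_clock_indep : forall v,
    cond_indep (ts_P (C xi)) (ts_W (C xi) v)
      (ts_T (C xi) v) (ts_W (C xi) (child1 v));
  cascade_split : forall v,
    {ae ts_P (C xi), forall w, ts_W (C xi) (child2 v) w =
                               (ts_W (C xi) v w - ts_W (C xi) (child1 v) w)%R};
  cascade_restart1 : forall v,
    cond_dist (ts_P (C xi))
      (fun w => (ts_W (C xi) (child1 v) w, ts_W (C xi) (child2 v) w))
      (sub_cascade (C xi) (child1 v))
      (fun z => cascade_law (C z.1));
  cascade_restart2 : forall v,
    cond_dist (ts_P (C xi))
      (fun w => (ts_W (C xi) (child1 v) w, ts_W (C xi) (child2 v) w))
      (sub_cascade (C xi) (child2 v))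
      (fun z => cascade_law (C z.2));
  cascade_branching : forall v,
    cond_indep (ts_P (C xi))
      (fun w => (ts_W (C xi) (child1 v) w, ts_W (C xi) (child2 v) w))
      (sub_cascade (C xi) (child1 v)) (sub_cascade (C xi) (child2 v));
  cascade_clock_subtrees : forall v,
    cond_indep (ts_P (C xi))
      (fun w => (ts_W (C xi) (child1 v) w, ts_W (C xi) (child2 v) w))
      (fun w => (sub_cascade (C xi) (child1 v) w, sub_cascade (C xi) (child2 v) w))
      (ts_T (C xi) v);
  cascade_bernoulli : forall v,
    ts_P (C xi) (ts_K (C xi) v @^-1` [set true]) = (2^-1)%:E;
  cascade_K_indep : forall (s : seq vertex) (B : vertex -> set bool), uniq s ->
    ts_P (C xi) (\bigcap_(v in [set` s]) ts_K (C xi) v @^-1` B v) =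
    \prod_(v <- s) ts_P (C xi) (ts_K (C xi) v @^-1` B v);
  cascade_thinning_indep : forall A B, measurable A -> measurable B ->
    ts_P (C xi) (thinning (C xi) @^-1` A `&` sub_cascade (C xi) [::] @^-1` B) =
    ts_P (C xi) (thinning (C xi) @^-1` A) *
    ts_P (C xi) (sub_cascade (C xi) [::] @^-1` B) }.

Definition explosion_time c (w : ts_sort c) : \bar R :=
  ereal_sup [set \big[Order.min/+oo]_(v : k.-tuple bool)
                    \sum_(j < k.+1) (ts_T c (take j v) w)%:E | k in [set: nat]].

End cascade.

Arguments sub_cascade {R n} c v w.
Arguments thinning {R n} c w.

(* tree_value v s x: the recursion started at vertex v with time s terminates,
   with value x. *)
Section recursions.
Context (R : realType) (V : Type) (T : vertex -> R)
  (leaf : vertex -> V) (node : vertex -> V -> V -> V).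

Inductive tree_value : vertex -> R -> V -> Prop :=
| TreeLeaf v s : s <= T v -> tree_value v s (leaf v)
| TreeNode v s x y : T v < s ->
    tree_value (child1 v) (s - T v) x -> tree_value (child2 v) (s - T v) y ->
    tree_value v s (node v x y).

Context (K : vertex -> bool) (zero : V).

Inductive thinned_value : vertex -> R -> V -> Prop :=
| ThinnedLeaf v s : s <= T v -> thinned_value v s (leaf v)
| ThinnedCut v s : T v < s -> K v = false -> thinned_value v s zero
| ThinnedNode v s x y : T v < s -> K v = true ->
    thinned_value (child1 v) (s - T v) x ->
    thinned_value (child2 v) (s - T v) y ->
    thinned_value v s (node v x y).

End recursions.

(* The processes, with value 0 where the recursion does not terminate. *)
Section processes.
Context (R : realType) (n : nat) (c : tree_space R n).
Local Open Scope ereal_scope.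

Definition procX (chi0 : 'rV[R]_n -> 'rV[R[i]]_n) (t : R) (w : ts_sort c) : 'rV[R[i]]_n :=
  xget 0%R [set x | tree_value (ts_T c ^~ w) (fun v => chi0 (ts_W c v w))
                      (fun v => odot (ts_W c v w)) [::] t x].

Definition procXbar (chi0 : 'rV[R]_n -> 'rV[R[i]]_n) (t : R) (w : ts_sort c) : 'rV[R[i]]_n :=
  xget 0%R [set x | thinned_value (ts_T c ^~ w) (fun v => chi0 (ts_W c v w))
                      (fun v a b => 2 *: odot (ts_W c v w) a b)%R
                      (ts_K c ^~ w) 0%R [::] t x].

Definition procY (psi0 : 'rV[R]_n -> \bar R) (t : R) (w : ts_sort c) : \bar R :=
  xget 0 [set x | tree_value (ts_T c ^~ w) (fun v => psi0 (ts_W c v w))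
                    (fun _ a b => a * b) [::] t x].

Definition procYbar (psi0 : 'rV[R]_n -> \bar R) (t : R) (w : ts_sort c) : \bar R :=
  xget 0 [set x | thinned_value (ts_T c ^~ w) (fun v => psi0 (ts_W c v w))
                    (fun _ a b => 2%:E * (a * b)) (ts_K c ^~ w) 0 [::] t x].

(* X 1_{zeta > t} and Y 1_{zeta > t}. *)
Definition liveX (chi0 : 'rV[R]_n -> 'rV[R[i]]_n) (t : R) (w : ts_sort c) : 'rV[R[i]]_n :=
  if t%:E < explosion_time w then procX chi0 t w else 0%R.

Definition liveY (psi0 : 'rV[R]_n -> \bar R) (t : R) (w : ts_sort c) : \bar R :=
  if t%:E < explosion_time w then procY psi0 t w else 0.

End processes.

Section equations.
Context (R : realType) (n : nat) (h : 'rV[R]_n -> R).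

Section scalar.
Local Open Scope ereal_scope.
Implicit Types f g : 'rV[R]_n -> R -> \bar R.

Definition U_nFMS (psi0 : 'rV[R]_n -> \bar R) (xi : 'rV[R]_n) (t : R) : \bar R :=
  (expR (- t * enorm xi ^+ 2))%:E * psi0 xi.

Definition B_nFMS f g (xi : 'rV[R]_n) (t : R) : \bar R :=
  \int[lebesgue_measure]_(s in `[0%R, t])
    ((expR (- s * enorm xi ^+ 2) * enorm xi ^+ 2)%:E *
     \int[lebesgue_rV R n]_eta
       (f eta (t - s)%R * g (xi - eta)%R (t - s)%R * (Hker h eta xi)%:E)).

Definition nFMS (psi0 : 'rV[R]_n -> \bar R) (psi : 'rV[R]_n -> R -> \bar R) :=
  forall xi t, xi != 0%R -> (0 <= t)%R ->
    psi xi t = U_nFMS psi0 xi t + B_nFMS psi psi xi t.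

Fixpoint picard_nFMS (psi0 : 'rV[R]_n -> \bar R) (k : nat) : 'rV[R]_n -> R -> \bar R :=
  if k is m.+1 then
    fun xi t => U_nFMS psi0 xi t +
                B_nFMS (picard_nFMS psi0 m) (picard_nFMS psi0 m) xi t
  else fun _ _ => 0.

End scalar.

Section vector.
Local Open Scope complex_scope.
Implicit Types f g : 'rV[R]_n -> R -> 'rV[R[i]]_n.

Definition U_nFNS (chi0 : 'rV[R]_n -> 'rV[R[i]]_n) (xi : 'rV[R]_n) (t : R) : 'rV[R[i]]_n :=
  (expR (- t * enorm xi ^+ 2))%:C *: chi0 xi.

Definition B_nFNS f g (xi : 'rV[R]_n) (t : R) : 'rV[R[i]]_n :=
  cv_integral lebesgue_measure `[0, t] (fun s =>
    (expR (- s * enorm xi ^+ 2) * enorm xi ^+ 2)%:C *: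
    cv_integral (lebesgue_rV R n) setT (fun eta =>
      (Hker h eta xi)%:C *: odot xi (f eta (t - s)) (g (xi - eta) (t - s)))).

(* The double integral defining B_nFNS f g xi t converges absolutely. *)
Definition B_nFNS_defined f g (xi : 'rV[R]_n) (t : R) :=
  cv_integrable (lebesgue_measure \x lebesgue_rV R n)%E (`[0, t] `*` setT)
    (fun p => (expR (- p.1 * enorm xi ^+ 2) * enorm xi ^+ 2 *
               Hker h p.2 xi)%:C *:
              odot xi (f p.2 (t - p.1)) (g (xi - p.2) (t - p.1))).

Fixpoint picard_nFNS (chi0 : 'rV[R]_n -> 'rV[R[i]]_n) (k : nat) : 'rV[R]_n -> R -> 'rV[R[i]]_n :=
  if k is m.+1 then
    fun xi t => U_nFNS chi0 xi t +
                B_nFNS (picard_nFNS chi0 m) (picard_nFNS chi0 m) xi t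
  else fun _ _ => 0.

End vector.
End equations.

(* Expectations under P_xi; C xi is the space carrying the cascade started at
   xi. *)
Section expectations.
Context (R : realType) (n : nat) (C : 'rV[R]_n -> tree_space R n).

Definition minimal_solution (psi0 : 'rV[R]_n -> \bar R) xi (t : R) : \bar R :=
  (\int[ts_P (C xi)]_w liveY psi0 t w)%E.

Definition thinned_solution (psi0 : 'rV[R]_n -> \bar R) xi (t : R) : \bar R :=
  (\int[ts_P (C xi)]_w procYbar psi0 t w)%E.

Definition cascade_solution (chi0 : 'rV[R]_n -> 'rV[R[i]]_n) xi (t : R) :=
  cv_integral (ts_P (C xi)) setT (liveX chi0 t).

Definition thinned_cascade_solution (chi0 : 'rV[R]_n -> 'rV[R[i]]_n)
    xi (t : R) :=
  cv_integral (ts_P (C xi)) setT (procXbar chi0 t).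

End expectations.

(* Main.v *)
From HB Require Import structures.
Require Import Defs.
From mathcomp Require Import all_boot all_order all_algebra.
From mathcomp Require Import complex.
From mathcomp Require finmap.
From mathcomp Require Import all_classical all_reals all_analysis.
From mathcomp Require Import measurable_realfun.
From mathcomp Require Import ring lra.

(** The scalar part rests on one computation. Let T be the root clock, W1 the
    label of its first child, and let F1, F2 be the two subtrees of a cascade
    started at xi. The branching property says that T is independent of
    (F1, F2), and that, given W1, the subtrees are independent cascades started
    at W1 and xi - W1. Hence, for nonnegative functionals G1, G2 of a cascade and
    a remaining time, the expectation of G1 (F1, t - T) G2 (F2, t - T) on [T < t]
    does not change when both factors are replaced by their means over cascades
    started at W1 and xi - W1 ([ge0_integral_branch]). As T has an exponential
    density, W1 has the density H (. | xi), and the two are independent, the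
    result is the bilinear term of (nFMS) ([nFMS_step]). The
    recursion truncated at depth k therefore has the k-th Picard iterate as
    expectation ([picard_mean]); the truncations increase to the value of the
    recursion, which gives the convergence of the iteration, and this value is
    reproduced by one step of the recursion, which gives the equation.
    Multiplying the equation by e^(t|xi|^2) makes it visibly monotone
    in t ([Psi_mono]), and comparison is the monotonicity of the recursion in its
    data.

    Two reductions bring the processes of the statement to this form. First, a
    recursion that does not terminate is given the value 0, which is absorbing
    for both products, so the value satisfies the recursion everywhere. The
    indicator of [zeta > t] then makes no difference: a terminating recursion has
    all late path sums at least t, and almost surely no path sum is equal to t
    ([explosion_ae]). Secondly, the thinned value is the unthinned one times a
    weight, which is 2^m if all coins at the m internal vertices show 1, and 0
    otherwise ([thinned_valE]). The coins are fair and independent of the tree, so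
    the weight has conditional mean 1 ([ge0_integral_thinning]).

    For the vector equation, |a odot b| <= |a| |b| / 2 ([cnorm_odot]) gives
    |X| <= 2 Y at every depth ([cnorm_approxX], [cnorm_valX]). Where psi is
    finite, X is thus integrable, and dominated convergence turns the truncations
    into the Picard iterates. The branching
    formula for products of signed functions follows by splitting into positive
    and negative parts ([integral_branch]), and for odot by expanding it in real
    coordinates ([branch_odot_mean]). The delicate point is that the bilinear term
    at (xi, t) also evaluates the unknown at points where psi may be infinite.
    Since psi (xi, t) is finite, the product of the two values of psi at the
    labels of the children is almost surely finite; if one of them is infinite,
    the other is 0, the corresponding vector mean vanishes, and so does the
    product ([split_odot_ae]).

    Finally, finiteness of psi almost everywhere gives, for almost every xi,
    finiteness at a dense set of times ([ae_product_sections]), and by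
    monotonicity at all times before T. *)

Set Implicit Arguments.
Unset Strict Implicit.
Unset Printing Implicit Defensive.
Import Order.TTheory GRing.Theory Num.Theory.
Import numFieldNormedType.Exports.
Local Open Scope classical_set_scope.
Local Open Scope ring_scope.

(** * Recursions on the binary tree *)

Section tree_values.
Context (R : realType) (V : Type) (zero : V).
Implicit Types (T : vertex -> R) (leaf : vertex -> V) (node : vertex -> V -> V -> V).

(** Bounding the depth of the recursion by [k] is what relates it to Picard
    iteration: the expectation of the truncation of depth [k] is the [k]-th
    iterate. *)
Fixpoint trunc T leaf node (k : nat) (v : vertex) (s : R) : V :=
  if k is m.+1 then
    if s <= T v then leaf v
    else node v (trunc T leaf node m (child1 v) (s - T v))
                (trunc T leaf node m (child2 v) (s - T v))
  else zero.

Definition absorbing node :=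
  forall v x, node v zero x = zero /\ node v x zero = zero.

Lemma tree_value_fun T leaf node v s x y :
  tree_value T leaf node v s x -> tree_value T leaf node v s y -> x = y.
Proof.
move=> H; elim: H y => {v s x} [v s sT|v s x1 x2 sT _ IH1 _ IH2] y H.
  by inversion H => //; subst; move: sT; rewrite leNgt H0.
inversion H; subst; first by move: sT; rewrite ltNge H0.
by rewrite (IH1 _ H1) (IH2 _ H2).
Qed.

End tree_values.

Definition tree_val (R : realType) (V : choiceType) (zero : V) T leaf node v s :=
  xget zero [set x | @tree_value R V T leaf node v s x].

Section tree_val.
Context (R : realType) (V : choiceType) (zero : V).
Context (T : vertex -> R) (leaf : vertex -> V) (node : vertex -> V -> V -> V).
Local Notation val := (tree_val zero T leaf node).
Local Notation tval := (tree_value T leaf node).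
Local Notation tr := (trunc zero T leaf node).

Lemma tree_valE v s x : tval v s x -> val v s = x.
Proof. by move=> tx; apply: xget_unique => // y ty; exact: tree_value_fun ty tx. Qed.

Lemma tree_val_none v s : ~ (exists x, tval v s x) -> val v s = zero.
Proof. by move=> tN; apply: xgetPN => x tx; apply: tN; exists x. Qed.

Context (node0 : absorbing zero node).

(** Giving the value [zero] to a recursion that does not terminate is consistent
    with the recursion itself, because [zero] is absorbing: if one child does
    not terminate, neither does its parent. *)
Lemma tree_val_step v s :
  val v s = if s <= T v then leaf v
            else node v (val (child1 v) (s - T v)) (val (child2 v) (s - T v)).
Proof.
case: leP => sT; first by apply: tree_valE; exact: TreeLeaf.
have [[x tx]|N1] := pselect (exists x, tval (child1 v) (s - T v) x); last first.
  rewrite (tree_val_none N1) (node0 _ _).1 tree_val_none// => -[x tx].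
  by inversion tx; subst; [move: sT; rewrite ltNge H|apply: N1; exists x0].
have [[y ty]|N1] := pselect (exists x, tval (child2 v) (s - T v) x); last first.
  rewrite (tree_val_none N1) (node0 _ _).2 tree_val_none// => -[z tz].
  by inversion tz; subst; [move: sT; rewrite ltNge H|apply: N1; exists y].
by rewrite (tree_valE tx) (tree_valE ty); apply: tree_valE; exact: TreeNode.
Qed.

(** A terminating recursion has a finite height, and any larger depth
    reproduces its value. A recursion that does not terminate exhausts every
    depth along some branch, so that all its truncations are [zero], which is
    also its value. *)
Lemma trunc_near v s : exists n, forall m, (n <= m)%N -> tr m v s = val v s.
Proof.
have [[x tx]|tN] := pselect (exists x, tval v s x).
  rewrite (tree_valE tx); elim: tx => {v s x} [v s sT|v s x y sT _ [n Hn] _ [m Hm]].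
    by exists 1%N => -[|m] //= _; rewrite sT.
  exists (maxn n m).+1 => -[|k]//; rewrite ltnS geq_max => /andP[nk mk] /=.
  by rewrite leNgt sT /= Hn// Hm.
exists 0%N => m _; rewrite (tree_val_none tN).
elim: m v s tN => // m IH v s tN /=; case: leP => sT.
  by exfalso; apply: tN; exists (leaf v); exact: TreeLeaf.
have [[x tx]|N1] := pselect (exists x, tval (child1 v) (s - T v) x); last first.
  by rewrite IH// (node0 _ _).1.
have [[y ty]|N1] := pselect (exists x, tval (child2 v) (s - T v) x); last first.
  by rewrite (IH _ _ N1) (node0 _ _).2.
by exfalso; apply: tN; exists (node v x y); exact: TreeNode.
Qed.

End tree_val.

Section subtree.
Context (R : realType) (V : choiceType) (zero : V).
Context (T : vertex -> R) (leaf : vertex -> V) (node : vertex -> V -> V -> V).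
Context (b : bool).
Local Notation sh f := (fun v => f (b :: v)).

Lemma trunc_cons k v s : trunc zero T leaf node k (b :: v) s =
  trunc zero (sh T) (sh leaf) (sh node) k v s.
Proof. by elim: k v s => //= k IH v s; rewrite -!IH. Qed.

(** The two subtrees at the root carry cascades of their own; this lemma and
    the next one are the change of coordinates. *)
Lemma tree_value_cons v s x : tree_value T leaf node (b :: v) s x <->
  tree_value (sh T) (sh leaf) (sh node) v s x.
Proof.
split.
  move: {-2}(b :: v) (erefl (b :: v)) => u uE H.
  elim: H v uE => {u s x} [u s sT|u s x y sT _ IH1 _ IH2] v uE; subst u.
    exact: (@TreeLeaf _ _ (sh T) (sh leaf) (sh node)).
  by apply: (@TreeNode _ _ (sh T) (sh leaf) (sh node)) => //; [exact: IH1|exact: IH2].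
elim=> {v s x} [v s sT|v s x y sT _ IH1 _ IH2].
  exact: (@TreeLeaf _ _ T leaf node).
exact: (@TreeNode _ _ T leaf node).
Qed.

Lemma tree_val_cons v s : tree_val zero T leaf node (b :: v) s =
  tree_val zero (sh T) (sh leaf) (sh node) v s.
Proof.
congr (xget _ _); apply/funext => x /=; apply/propext; exact: tree_value_cons.
Qed.

End subtree.

Section explosion.
Context (R : realType) (T : vertex -> R).

(** Path sums that start at [v] rather than at the root make the induction
    on a terminating recursion possible. *)
Fixpoint path_sum (v u : vertex) : R :=
  T v + (if u is b :: u' then path_sum (rcons v b) u' else 0).

Lemma path_sumE u : path_sum [::] u = \sum_(j < (size u).+1) T (take j u).
Proof.
suff H v : path_sum v u = \sum_(j < (size u).+1) T (v ++ take j u) by exact: H.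
elim: u v => [|b u IH] v /=.
  by rewrite big_ord_recl big_ord0 cats0.
rewrite IH [RHS]big_ord_recl take0 cats0; congr (_ + _).
by apply: eq_bigr => j _; rewrite cat_rcons.
Qed.

(** All paths that are longer than the height of a terminating recursion have
    already passed one of its leaves, and at a leaf the clocks have used up the
    time [s]. *)
Lemma tree_value_path_sum (V : Type) leaf node v s (x : V) :
  (forall u, 0 <= T u) -> tree_value T leaf node v s x ->
  exists n, forall u, (n <= size u)%N -> s <= path_sum v u.
Proof.
move=> T0.
have ps0 w u : 0 <= path_sum w u.
  by elim: u w => [|b u IH] w /=; rewrite addr_ge0.
elim=> {v s x} [v s sT|v s x y sT _ [n Hn] _ [m Hm]].
  exists 0%N => u _; apply: (le_trans sT).
  by case: u => [|b u] /=; rewrite ?addr0// lerDl.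
exists (maxn n m).+1 => -[|b u]//=; rewrite ltnS geq_max => /andP[nu mu].
by rewrite -lerBlDl; case: b; [exact: Hm|exact: Hn].
Qed.

End explosion.

(** * Thinning multiplies a value by a weight *)

(** The list of the internal vertices of a recursion is itself computed by the
    recursion on the tree, with [None] for non-termination, so that the general
    facts on [tree_val] apply to it. *)
Definition inode (v : vertex) (a b : option (seq vertex)) :=
  if a is Some x then if b is Some y then Some (v :: x ++ y) else None else None.

Definition internal (R : realType) (T : vertex -> R) :=
  tree_val (V := option (seq vertex)) None T (fun=> Some [::]) inode.

(** Every internal vertex contributes the factor 2 of the thinned recursion, and
    a single cut makes the value vanish. *)
Definition weight (K : vertex -> bool) (L : seq vertex) : nat :=
  if all K L then (2 ^ size L)%N else 0%N.

Lemma inode_absorbing : absorbing None inode.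
Proof. by move=> v [x|]. Qed.

Section internal.
Context (R : realType) (T : vertex -> R).
Local Notation ival := (tree_value T (fun=> Some [::] : option (seq vertex)) inode).

Lemma tree_value_internal (V : Type) leaf node v s (x : V) :
  tree_value T leaf node v s x -> exists L, ival v s (Some L).
Proof.
elim=> {v s x} [v s sT|v s x y sT _ [L1 H1] _ [L2 H2]].
  by exists [::]; exact: TreeLeaf.
by exists (v :: L1 ++ L2); apply: TreeNode H1 H2.
Qed.

Lemma internal_tree_value (V : Type) leaf node v s L :
  ival v s (Some L) -> exists x : V, tree_value T leaf node v s x.
Proof.
elim=> {v s L} [v s sT|v s x y sT _ [z1 H1] _ [z2 H2]].
  by exists (leaf v); exact: TreeLeaf.
by exists (node v z1 z2); exact: TreeNode H1 H2.
Qed.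

Lemma internal_uniq v s L : internal T v s = Some L -> uniq L.
Proof.
have H o : ival v s o -> forall L, o = Some L ->
    uniq L /\ (forall u, u \in L -> exists w, u = v ++ w).
  elim=> {v s o L} [v s sT L [<-]//|v s [x|]// [y|]// sT _ IH1 _ IH2 L [<-{L}]].
  have [u1 p1] := IH1 _ erefl; have [u2 p2] := IH2 _ erefl; split.
    rewrite /= cat_uniq u1 u2 mem_cat /= andbT; apply/andP; split.
      apply/negP => /orP[/p1|/p2] [w]; rewrite /child1 /child2 cat_rcons => /esym/eqP;
        by rewrite -[X in _ == X]cats0 eqseq_cat// eqxx.
    apply/hasPn => u /p2[w ->]; apply/negP => /p1[w'].
    by rewrite /child1 /child2 !cat_rcons => /eqP; rewrite eqseq_cat// eqxx.
  move=> u; rewrite in_cons mem_cat => /orP[/eqP->|/orP[/p1|/p2]].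
  - by exists [::]; rewrite cats0.
  - by move=> [w ->]; exists (false :: w); rewrite cat_rcons.
  - by move=> [w ->]; exists (true :: w); rewrite cat_rcons.
rewrite /internal; have [[q iq]|qN] := pselect (exists q, ival v s q).
  by rewrite (tree_valE _ iq) => qE; have [] := H _ iq _ qE.
by rewrite tree_val_none.
Qed.

End internal.

Section thinning.
Context (R : realType) (V : choiceType) (zero : V) (T : vertex -> R)
  (K : vertex -> bool) (leaf : vertex -> V) (node node2 : vertex -> V -> V -> V)
  (act : nat -> V -> V).
Context (act0 : forall x, act 0 x = zero).
Context (act1 : forall x, act 1 x = x).
Context (node_act : forall v m p x y,
  node2 v (act m x) (act p y) = act (2 * (m * p)) (node v x y)).
Context (node20 : absorbing zero node2).

Local Notation ival := (tree_value T (fun=> Some [::] : option (seq vertex)) inode).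
Local Notation tval := (tree_value T leaf node).
Local Notation thval := (thinned_value T leaf node2 K zero).

Lemma weight_cat v L1 L2 : K v ->
  weight K (v :: L1 ++ L2) = (2 * (weight K L1 * weight K L2))%N.
Proof.
move=> Kv; rewrite /weight /= Kv all_cat size_cat /=.
by case: all; case: all; rewrite /= ?mul0n ?muln0// expnS expnD.
Qed.

Lemma tree_value_thinned v s x : tval v s x -> exists z, thval v s z.
Proof.
elim=> {v s x} [v s sT|v s x y sT _ [z1 H1] _ [z2 H2]].
  by exists (leaf v); exact: ThinnedLeaf.
case Kv : (K v); last by exists zero; exact: ThinnedCut.
by exists (node2 v z1 z2); exact: ThinnedNode.
Qed.

(** A cut can make the thinned recursion terminate where the full one does
    not; then the thinned value is [zero], which is the second case. *)
Lemma thinned_value_weight v s z : thval v s z ->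
  (exists x L, [/\ tval v s x, ival v s (Some L) & z = act (weight K L) x]) \/
  (~ (exists x, tval v s x) /\ z = zero).
Proof.
elim=> {v s z} [v s sT|v s sT Kv|v s x y sT Kv _ IH1 _ IH2].
- left; exists (leaf v), [::]; split; [exact: TreeLeaf|exact: TreeLeaf|].
  by rewrite /weight /= expn0 act1.
- have [[x tx]|tN] := pselect (exists x, tval v s x); last by right.
  have [L iL] := tree_value_internal tx.
  left; exists x, L; split => //.
  suff vL : v \in L by rewrite /weight; case: allP => [/(_ _ vL)|]; rewrite ?Kv// act0.
  inversion iL as [w r sT' wE rE oE|w r a c sT' ta tc wE rE oE]; subst.
    by move: sT; rewrite ltNge sT'.
  by move: oE; clear; case: a => // L1; case: c => // L2 [<-]; rewrite mem_head.
- case: IH1 => [[x1 [L1 [tx1 iL1 ->]]]|[N1 ->]]; last first.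
    right; split; last by rewrite (node20 _ _).1.
    by move=> [z tz]; inversion tz as [w r sT'|w r a c sT' ta tc]; subst;
      [move: sT; rewrite ltNge sT'|apply: N1; exists a].
  case: IH2 => [[x2 [L2 [tx2 iL2 ->]]]|[N1 ->]]; last first.
    right; split; last by rewrite (node20 _ _).2.
    by move=> [z tz]; inversion tz as [w r sT'|w r a c sT' ta tc]; subst;
      [move: sT; rewrite ltNge sT'|apply: N1; exists c].
  left; exists (node v x1 x2), (v :: L1 ++ L2); split.
  + exact: TreeNode.
  + exact: (TreeNode (node := inode) sT iL1 iL2).
  + by rewrite weight_cat// node_act.
Qed.

Lemma thinned_value_fun v s x y : thval v s x -> thval v s y -> x = y.
Proof.
move=> H; elim: H y => {v s x} [v s sT|v s sT Kv|v s x1 x2 sT Kv _ IH1 _ IH2] y H;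
  inversion H as [w r sT'|w r sT' Kv'|w r a c sT' Kv' ta tc]; subst => //;
  try by [move: sT; rewrite ltNge sT'|move: sT; rewrite leNgt sT'|
    move: Kv; rewrite Kv'].
by rewrite (IH1 _ ta) (IH2 _ tc).
Qed.

(** The operation [act] stands for the multiplication by a natural number, so
    that numbers in [0, +oo] and complex vectors are treated at once. Where the
    full recursion does not terminate, both sides are [zero]. *)
Lemma thinned_valE v s :
  xget zero [set z | thval v s z] =
  if internal T v s is Some L then act (weight K L) (tree_val zero T leaf node v s)
  else zero.
Proof.
have [[z tz]|tN] := pselect (exists z, thval v s z).
  rewrite (@xget_unique _ zero [set z | thval v s z] z)//; last first.
    by move=> y ty; exact: thinned_value_fun ty tz.
  have [[x [L [tx iL ->]]]|[N ->]] := thinned_value_weight tz.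
    by rewrite /internal (tree_valE _ iL) (tree_valE _ tx).
  rewrite /internal tree_val_none//= => -[[L|] iL].
    by apply: N; exact: internal_tree_value iL.
  suff [L []] : exists L, None = Some L :> option (seq vertex) by [].
  by elim: iL => {N tz s v z} [v s _|v s x y sT _ [L1 ->] _ [L2 ->]]; eexists.
rewrite xgetPN//; last by move=> x tx; apply: tN; exists x.
rewrite /internal tree_val_none//= => -[L iL]; apply: tN.
suff [x tx] : exists x, tval v s x by exact: tree_value_thinned tx.
suff [M iM] : exists M, ival v s (Some M) by exact: internal_tree_value iM.
have [M iM] := tree_value_internal iL; by exists M.
Qed.

End thinning.

(** * Real coordinates of complex vectors and the product *)

Section cauchy_schwarz.
Context (R : realType) (I : finType).
Implicit Types f g : I -> R.

Lemma cauchy_schwarz_sum f g :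
  \sum_i f i * g i <= Num.sqrt (\sum_i f i ^+ 2) * Num.sqrt (\sum_i g i ^+ 2).
Proof.
have s0 h : 0 <= \sum_i h i ^+ 2 :> R by apply: sumr_ge0 => i _; exact: sqr_ge0.
rewrite -sqrtrM//; apply: le_trans (ler_norm _) _; rewrite -sqrtr_sqr ler_sqrt; last first.
  by rewrite mulr_ge0.
rewrite expr2 !big_distrlr /= -subr_ge0.
have -> : \sum_i \sum_j f i ^+ 2 * g j ^+ 2 - \sum_i \sum_j f i * g i * (f j * g j) =
    2^-1 * \sum_i \sum_j (f i * g j - f j * g i) ^+ 2.
  rewrite [X in 2^-1 * X](_ : _ = \sum_i \sum_j f i ^+ 2 * g j ^+ 2 +
      \sum_i \sum_j f j ^+ 2 * g i ^+ 2 - 2 * \sum_i \sum_j f i * g i * (f j * g j)).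
    rewrite [X in _ + X - _]exchange_big /=.
    by set A := \sum_i _; set B := \sum_i _; field.
  rewrite mulr_sumr -big_split -sumrN -big_split /=; apply: eq_bigr => i _.
  rewrite mulr_sumr -big_split -sumrN -big_split /=; apply: eq_bigr => j _; ring.
by rewrite mulr_ge0// sumr_ge0// => i _; rewrite sumr_ge0// => j _; exact: sqr_ge0.
Qed.

End cauchy_schwarz.

Section coordinates.
Context (R : realType) (n : nat).
Local Notation C := R[i].
Local Notation J := ('I_n * bool)%type.
Implicit Types (a b : 'rV[C]_n) (x xi : 'rV[R]_n) (p q r : J).
Local Open Scope complex_scope.

(** Integrals of vectors are integrals of their real coordinates: the pair
    (j, true) selects the real part of the entry j, and (j, false) its imaginary
    part. *)
Definition coord p a : R :=
  if p.2 then complex.Re (a ord0 p.1) else complex.Im (a ord0 p.1).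

Definition unit_vec p : 'rV[C]_n :=
  (if p.2 then 1 else 'i) *: delta_mx 0 p.1.

Lemma ReD (z w : C) : complex.Re (z + w) = complex.Re z + complex.Re w.
Proof. by case: z; case: w. Qed.
Lemma ImD (z w : C) : complex.Im (z + w) = complex.Im z + complex.Im w.
Proof. by case: z; case: w. Qed.
Lemma ReZ (k : R) (z : C) : complex.Re (k%:C * z) = k * complex.Re z.
Proof. by case: z => u v /=; rewrite mul0r subr0. Qed.
Lemma ImZ (k : R) (z : C) : complex.Im (k%:C * z) = k * complex.Im z.
Proof. by case: z => u v /=; rewrite mul0r addr0. Qed.

Lemma coordD p a b : coord p (a + b) = coord p a + coord p b.
Proof. by rewrite /coord mxE; case: p.2; rewrite ?ReD ?ImD. Qed.

Lemma coordZ p (k : R) a : coord p (k%:C *: a) = k * coord p a.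
Proof. by rewrite /coord mxE; case: p.2; rewrite ?ReZ ?ImZ. Qed.

Lemma coord0 p : coord p 0 = 0.
Proof. by rewrite /coord mxE; case: p.2. Qed.

Lemma coordN p a : coord p (- a) = - coord p a.
Proof. by apply/eqP; rewrite -addr_eq0 -coordD addNr coord0. Qed.

Lemma coord_sum p I (s : seq I) (F : I -> 'rV[C]_n) :
  coord p (\sum_(i <- s) F i) = \sum_(i <- s) coord p (F i).
Proof. by elim/big_ind2: _ => [|x a y b <- <-|//]; rewrite ?coord0 ?coordD. Qed.

Lemma coordP a b : (forall p, coord p a = coord p b) -> a = b.
Proof.
move=> ab; apply/rowP => j; apply/eqP; rewrite eq_complex.
have := ab (j, true); have := ab (j, false).
by rewrite /coord /= => -> ->; rewrite !eqxx.
Qed.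

Lemma sum_coord a : a = \sum_p (coord p a)%:C *: unit_vec p.
Proof.
rewrite -(pair_bigA _ (fun j c => (coord (j, c) a)%:C *: unit_vec (j, c))) /=.
apply/rowP => j; rewrite summxE (bigD1 j)//= [X in _ + X]big1 ?addr0.
  rewrite summxE big_bool /= /unit_vec /coord /= !mxE /= !eqxx /=.
  by rewrite !mulr1 [LHS]complexE; congr (_ + _); rewrite mulrC.
move=> k kj; rewrite summxE big_bool /= /unit_vec !mxE.
by rewrite [j == k]eq_sym (negbTE kj) andbF !mulr0 addr0.
Qed.

Definition cdot a b := \sum_p coord p a * coord p b.

Lemma cnormE a : cnorm a = Num.sqrt (\sum_p coord p a ^+ 2).
Proof.
rewrite /cnorm; congr Num.sqrt.
rewrite -(pair_bigA _ (fun j c => coord (j, c) a ^+ 2)) /=.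
by apply: eq_bigr => j _; rewrite big_bool.
Qed.

Lemma cnorm_ge0 a : 0 <= cnorm a. Proof. exact: sqrtr_ge0. Qed.

Lemma sqr_cnorm a : cnorm a ^+ 2 = \sum_p coord p a ^+ 2.
Proof. by rewrite cnormE sqr_sqrtr// sumr_ge0// => p _; exact: sqr_ge0. Qed.

Lemma le_cdot a b : cdot a b <= cnorm a * cnorm b.
Proof. by rewrite !cnormE; exact: cauchy_schwarz_sum. Qed.

Lemma cnormD a b : cnorm (a + b) <= cnorm a + cnorm b.
Proof.
rewrite -ler_sqr ?nnegrE ?addr_ge0 ?cnorm_ge0//.
have -> : cnorm (a + b) ^+ 2 = cnorm a ^+ 2 + 2 * cdot a b + cnorm b ^+ 2.
  rewrite !sqr_cnorm /cdot mulr_sumr -!big_split; apply: eq_bigr => p _ /=.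
  rewrite coordD; ring.
rewrite sqrrD lerD2r lerD2l mulr_natl lerMn2r le_cdot orbT //.
Qed.

Lemma le_coord_cnorm p a : `|coord p a| <= cnorm a.
Proof.
rewrite cnormE -sqrtr_sqr ler_wsqrtr// (bigD1 p)//= lerDl sumr_ge0// => q _.
exact: sqr_ge0.
Qed.

Lemma cnorm0 : cnorm (0 : 'rV[C]_n) = 0.
Proof. by rewrite cnormE big1 ?sqrtr0// => p _; rewrite coord0 expr0n. Qed.

Lemma cnorm_eq0 a : cnorm a = 0 -> a = 0.
Proof.
move=> a0; apply/coordP => p; rewrite coord0; apply/eqP; rewrite -normr_le0.
by rewrite -a0 le_coord_cnorm.
Qed.

Lemma cnorm_le_sum a : cnorm a <= \sum_p `|coord p a|.
Proof.
have s0 : 0 <= \sum_p `|coord p a| by rewrite sumr_ge0.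
rewrite -ler_sqr ?nnegrE ?cnorm_ge0// sqr_cnorm expr2 mulr_suml ler_sum// => p _.
rewrite -real_normK ?num_real// expr2 ler_wpM2l// (bigD1 p)//= lerDl sumr_ge0//.
Qed.

Definition cmod (z : C) : R := ComplexField.Normc.normc z.

Lemma cnormZ z a : cnorm (z *: a) = cmod z * cnorm a.
Proof.
rewrite /cnorm /cmod; case: z => u v /=; rewrite -sqrtrM ?addr_ge0 ?sqr_ge0//.
congr Num.sqrt; rewrite mulr_sumr; apply: eq_bigr => j _; rewrite !mxE.
case: (a ord0 j) => s t /=; ring.
Qed.

Lemma cmod_ge0 z : 0 <= cmod z. Proof. by case: z => u v; exact: sqrtr_ge0. Qed.

Lemma sqr_cmod z : cmod z ^+ 2 = complex.Re z ^+ 2 + complex.Im z ^+ 2.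
Proof. by case: z => u v /=; rewrite sqr_sqrtr// addr_ge0 ?sqr_ge0. Qed.

Lemma rdotD x a b : rdot x (a + b) = rdot x a + rdot x b.
Proof. by rewrite /rdot -big_split; apply: eq_bigr => j _; rewrite mxE mulrDr. Qed.

Lemma rdotZ x z a : rdot x (z *: a) = z * rdot x a.
Proof. by rewrite /rdot mulr_sumr; apply: eq_bigr => j _; rewrite mxE mulrCA. Qed.

Lemma proj_perpD xi a b : proj_perp xi (a + b) = proj_perp xi a + proj_perp xi b.
Proof. by rewrite /proj_perp rdotD scalerDl opprD addrACA. Qed.

Lemma proj_perpZ xi z a : proj_perp xi (z *: a) = z *: proj_perp xi a.
Proof. by rewrite /proj_perp rdotZ scalerBr scalerA. Qed.

Lemma odotC xi a b : odot xi a b = odot xi b a.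
Proof. by rewrite /odot addrC. Qed.

Lemma odotDl xi a a' b : odot xi (a + a') b = odot xi a b + odot xi a' b.
Proof.
rewrite /odot rdotD proj_perpD -[RHS]scalerDr; congr (_ *: _).
by rewrite scalerDr scalerDl addrACA.
Qed.

Lemma odotZl xi z a b : odot xi (z *: a) b = z *: odot xi a b.
Proof.
rewrite /odot rdotZ proj_perpZ [RHS]scalerA [z * (- _ / _)]mulrC -[RHS]scalerA.
by congr (_ *: _); rewrite [RHS]scalerDr !scalerA [_ * z]mulrC.
Qed.

Lemma odotZr xi z a b : odot xi a (z *: b) = z *: odot xi a b.
Proof. by rewrite ![odot xi a _]odotC odotZl. Qed.

Lemma odot0l xi b : odot xi 0 b = 0.
Proof. by rewrite -[X in odot _ X _](scale0r 0) odotZl scale0r. Qed.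

Lemma odot0r xi b : odot xi b 0 = 0.
Proof. by rewrite odotC odot0l. Qed.

Lemma odot_suml xi I (s : seq I) (F : I -> 'rV[C]_n) b :
  odot xi (\sum_(i <- s) F i) b = \sum_(i <- s) odot xi (F i) b.
Proof. by elim/big_ind2: _ => [|x a y c <- <-|//]; rewrite ?odot0l ?odotDl. Qed.

Lemma odot_sumr xi I (s : seq I) (F : I -> 'rV[C]_n) b :
  odot xi b (\sum_(i <- s) F i) = \sum_(i <- s) odot xi b (F i).
Proof. by rewrite odotC odot_suml; apply: eq_bigr => i _; rewrite odotC. Qed.

(** The structure constants of the product over the reals; with them the
    expectation of a product of vectors reduces to expectations of products of
    real functions. *)
Definition odot_coef r xi p q := coord r (odot xi (unit_vec p) (unit_vec q)).

Lemma coord_odot r xi a b : coord r (odot xi a b) =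
  \sum_p \sum_q odot_coef r xi p q * (coord p a * coord q b).
Proof.
rewrite {1}(sum_coord a) odot_suml coord_sum; apply: eq_bigr => p _.
rewrite {1}(sum_coord b) odot_sumr coord_sum; apply: eq_bigr => q _.
by rewrite odotZl odotZr !coordZ /odot_coef; ring.
Qed.

Lemma enorm_ge0 x : 0 <= enorm x. Proof. exact: sqrtr_ge0. Qed.

Lemma enorm_gt0 x : x != 0 -> 0 < enorm x.
Proof.
move=> x0; rewrite lt_def enorm_ge0 andbT; apply: contra x0.
rewrite sqrtr_eq0 => x0; apply/eqP/rowP => j; rewrite mxE; apply/eqP.
rewrite -sqrf_eq0; apply/eqP/le_anti; rewrite sqr_ge0 andbT; apply: le_trans x0.
by rewrite (bigD1 j)//= lerDl sumr_ge0// => k _; exact: sqr_ge0.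
Qed.

Lemma enorm0 : enorm (0 : 'rV[R]_n) = 0.
Proof. by rewrite /enorm big1 ?sqrtr0// => j _; rewrite mxE expr0n. Qed.

Lemma sum_edir xi : xi != 0 -> \sum_j edir xi ord0 j ^+ 2 = 1.
Proof.
move=> xi0; have e0 := enorm_gt0 xi0.
under eq_bigr do rewrite mxE exprMn.
rewrite -mulr_sumr -[X in _ * X]sqr_sqrtr; last by rewrite sumr_ge0// => j _; exact: sqr_ge0.
by rewrite -/(enorm xi) -exprMn mulVf ?expr1n// gt_eqF.
Qed.

(** Pythagoras for the decomposition along the real unit vector [edir xi]. *)
Lemma sqr_cnorm_proj xi a : xi != 0 ->
  cnorm a ^+ 2 = cmod (rdot (edir xi) a) ^+ 2 + cnorm (proj_perp xi a) ^+ 2.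
Proof.
move=> /sum_edir; set e := edir xi => e1.
have sq b : cnorm b ^+ 2 =
    \sum_j (complex.Re (b ord0 j) ^+ 2 + complex.Im (b ord0 j) ^+ 2).
  by rewrite sqr_sqrtr// sumr_ge0// => j _; rewrite addr_ge0 ?sqr_ge0.
rewrite !sq sqr_cmod /proj_perp -/e.
set z := rdot e a.
have ReE : complex.Re z = \sum_j e ord0 j * complex.Re (a ord0 j).
  rewrite /z /rdot; elim/big_ind2: _ => [//|x u y v <- <-|j _]; first by rewrite ReD.
  by rewrite ReZ.
have ImE : complex.Im z = \sum_j e ord0 j * complex.Im (a ord0 j).
  rewrite /z /rdot; elim/big_ind2: _ => [//|x u y v <- <-|j _]; first by rewrite ImD.
  by rewrite ImZ.
move: z ReE ImE => [s t] /= sE tE.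
transitivity (s ^+ 2 + t ^+ 2 + \sum_j (complex.Re (a ord0 j) ^+ 2 +
   complex.Im (a ord0 j) ^+ 2 - 2 * s * (e ord0 j * complex.Re (a ord0 j))
   - 2 * t * (e ord0 j * complex.Im (a ord0 j)) + (s ^+ 2 + t ^+ 2) * e ord0 j ^+ 2)).
  rewrite !big_split /= !sumrN -!mulr_sumr e1 -sE -tE; ring.
congr (_ + _); apply: eq_bigr => j _; rewrite !mxE.
by case: (a ord0 j) => u v /=; ring.
Qed.

(** With [al], [be] the components of [a], [b] along the direction of [xi], the
    product is, up to a factor of modulus 1/2, the sum of [be] times the
    orthogonal part of [a] and [al] times the orthogonal part of [b];
    Cauchy-Schwarz in the plane bounds the norm of that sum by the product of
    the norms. The factor 1/2 explains the choice of |chi0| / 2 as scalar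
    data. *)
Lemma cnorm_odot xi a b : cnorm (odot xi a b) <= cnorm a * cnorm b / 2.
Proof.
have [->|xi0] := eqVneq xi 0.
  have e0 : edir (0 : 'rV[R]_n) = 0 by rewrite /edir scaler0.
  have r0 c : rdot (0 : 'rV[R]_n) c = 0.
    by rewrite /rdot big1// => j _; rewrite mxE mul0r.
  rewrite /odot e0 !r0 !scale0r addr0 scaler0 cnorm0.
  by rewrite divr_ge0// mulr_ge0// cnorm_ge0.
rewrite /odot cnormZ.
have -> : cmod (- 'i / 2) = 2^-1.
  rewrite /cmod ComplexField.Normc.normcM ComplexField.Normc.normcV /=.
  by rewrite oppr0 expr0n sqrrN expr1n add0r sqrtr1 mul1r addr0 expr0n addr0
     sqrtr_sqr ger0_norm.
rewrite [leRHS]mulrC ler_wpM2l//.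
apply: (le_trans (cnormD _ _)); rewrite !cnormZ.
have := sqr_cnorm_proj a xi0; have := sqr_cnorm_proj b xi0.
have := cmod_ge0 (rdot (edir xi) a); have := cmod_ge0 (rdot (edir xi) b).
have := cnorm_ge0 (proj_perp xi a); have := cnorm_ge0 (proj_perp xi b).
have := cnorm_ge0 a; have := cnorm_ge0 b.
move: (cmod _) (cmod _) (cnorm _) (cnorm _) (cnorm _) (cnorm _) => A B x y u v.
move=> v0 u0 y0 x0 B0 A0 vE uE.
rewrite -ler_sqr ?nnegrE ?addr_ge0 ?mulr_ge0// exprMn uE vE -subr_ge0.
rewrite [leRHS](_ : _ = (A * B - x * y) ^+ 2); first exact: sqr_ge0.
by ring.
Qed.

Definition cmeasurable d (S : measurableType d) (f : S -> C) :=
  measurable_fun setT (fun s => complex.Re (f s)) /\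
  measurable_fun setT (fun s => complex.Im (f s)).

Section cmeasurable.
Context d (S : measurableType d).
Implicit Types f g : S -> C.

Lemma cmeasurableD f g : cmeasurable f -> cmeasurable g ->
  cmeasurable (fun s => f s + g s).
Proof.
move=> [f1 f2] [g1 g2]; split.
  by under eq_fun do rewrite ReD; exact: measurable_funD.
by under eq_fun do rewrite ImD; exact: measurable_funD.
Qed.

Lemma cmeasurableM f g : cmeasurable f -> cmeasurable g ->
  cmeasurable (fun s => f s * g s).
Proof.
move=> [f1 f2] [g1 g2]; split.
  rewrite (_ : (fun _ => _) = (fun s => complex.Re (f s) * complex.Re (g s) -
     complex.Im (f s) * complex.Im (g s))).
    by apply: measurable_funB; exact: measurable_funM.
  by apply/funext => s; case: (f s); case: (g s).
rewrite (_ : (fun _ => _) = (fun s => complex.Re (f s) * complex.Im (g s) +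
    complex.Im (f s) * complex.Re (g s))).
  by apply: measurable_funD; exact: measurable_funM.
by apply/funext => s; case: (f s); case: (g s).
Qed.

Lemma cmeasurable_cst z : cmeasurable (fun _ : S => z).
Proof. by split; exact: measurable_cst. Qed.

Lemma cmeasurable_real (f : S -> R) : measurable_fun setT f ->
  cmeasurable (fun s => (f s)%:C).
Proof. by move=> mf; split => //; exact: measurable_cst. Qed.

Lemma cmeasurable_sum (I : eqType) (s : seq I) (F : I -> S -> C) :
  (forall i, cmeasurable (F i)) -> cmeasurable (fun y => \sum_(i <- s) F i y).
Proof.
move=> mF; elim: s => [|i s IH].
  by under eq_fun do rewrite big_nil; exact: cmeasurable_cst.
by under eq_fun do rewrite big_cons; exact: cmeasurableD.
Qed.

Lemma cv_measurableP (f : S -> 'rV[C]_n) :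
  cv_measurable f <-> forall p, measurable_fun setT (fun s => coord p (f s)).
Proof.
split=> [mf [j []]|mf j]; rewrite /coord /=; [exact: (mf j).1|exact: (mf j).2|].
by split; [exact: (mf (j, true))|exact: (mf (j, false))].
Qed.

Lemma measurable_sqrt : measurable_fun setT (Num.sqrt : R -> R).
Proof. by apply: nondecreasing_measurable => // x y; exact: ler_wsqrtr. Qed.

Lemma measurable_cnorm (f : S -> 'rV[C]_n) :
  cv_measurable f -> measurable_fun setT (fun s => cnorm (f s)).
Proof.
move=> mf; apply: (measurableT_comp measurable_sqrt).
apply: measurable_sum => j; have [? ?] := mf j.
by apply: measurable_funD; exact: measurable_funX.
Qed.

Lemma measurable_enorm (f : S -> 'rV[R]_n) : measurable_fun setT f ->
  measurable_fun setT (fun s => enorm (f s)).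
Proof.
move=> mf; apply: (measurableT_comp measurable_sqrt).
apply: measurable_sum => j; apply: measurable_funX.
exact: measurableT_comp (measurable_coord j) mf.
Qed.

Lemma measurable_edir (f : S -> 'rV[R]_n) j : measurable_fun setT f ->
  measurable_fun setT (fun s => edir (f s) ord0 j).
Proof.
move=> mf; rewrite /edir; under eq_fun do rewrite mxE -powR_inv1 ?enorm_ge0//.
apply: measurable_funM; last exact: measurableT_comp (measurable_coord j) mf.
exact: measurableT_comp (measurable_powR _) (measurable_enorm mf).
Qed.

Lemma cv_measurable_odot (w : S -> 'rV[R]_n) (f g : S -> 'rV[C]_n) :
  measurable_fun setT w -> cv_measurable f -> cv_measurable g ->
  cv_measurable (fun s => odot (w s) (f s) (g s)).
Proof.
move=> mw mf mg j; rewrite -/(cmeasurable (fun s => odot (w s) (f s) (g s) ord0 j)).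
have me k : cmeasurable (fun s => (edir (w s) ord0 k)%:C).
  by apply: cmeasurable_real; exact: measurable_edir.
have mr (a : S -> 'rV[C]_n) : cv_measurable a ->
    cmeasurable (fun s => rdot (edir (w s)) (a s)).
  by move=> ma; apply: cmeasurable_sum => k; apply: cmeasurableM => //; exact: ma.
have mp (a : S -> 'rV[C]_n) : cv_measurable a ->
    cmeasurable (fun s => proj_perp (w s) (a s) ord0 j).
  move=> ma; rewrite (_ : (fun _ => _) = fun s =>
    a s ord0 j + (-1) * (rdot (edir (w s)) (a s) * (edir (w s) ord0 j)%:C)).
    apply: cmeasurableD; first exact: ma.
    apply: cmeasurableM; first exact: cmeasurable_cst.
    by apply: cmeasurableM; [exact: mr|exact: me].
  by apply/funext => s; rewrite !mxE mulN1r.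
rewrite (_ : (fun _ => _) = fun s => (- 'i / 2) *
    (rdot (edir (w s)) (g s) * proj_perp (w s) (f s) ord0 j +
     rdot (edir (w s)) (f s) * proj_perp (w s) (g s) ord0 j)).
  apply: cmeasurableM; first exact: cmeasurable_cst.
  by apply: cmeasurableD; apply: cmeasurableM; (exact: mr || exact: mp).
by apply/funext => s; rewrite /odot mxE [in LHS]mxE; congr (_ * (_ + _)); rewrite mxE.
Qed.

End cmeasurable.

End coordinates.

(** * Functionals of a cascade *)

Section family_measurability.
Context (I : Type) d (T : measurableType d).

Lemma measurable_family_coord (i : I) :
  measurable_fun setT (fun f : family_of I T => f i).
Proof.
move=> _ Y mY; rewrite setTI; apply: sub_sigma_algebra.
by exists i => //; exists Y => //; rewrite setTI.
Qed.

Lemma measurable_to_family d' (S : measurableType d') (g : S -> family_of I T) :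
  (forall i, measurable_fun setT (fun s => g s i)) -> measurable_fun setT g.
Proof.
move=> mg; apply: (measurability (@family_cylinders I _ T)) => //.
move=> _ [A [i _ [B mB <-]] <-]; rewrite setTI.
by have := mg i measurableT B mB; rewrite !setTI.
Qed.

End family_measurability.

Section families.
Context (R : realType) (n : nat).
Local Notation Fam := (family_of vertex ('rV[R]_n * R)%type).

Definition shift (b : bool) (f : Fam) : Fam := fun u => f (b :: u).

Lemma measurable_shift b : measurable_fun setT (shift b).
Proof. by apply: measurable_to_family => v; exact: measurable_family_coord. Qed.

Definition fam_clock v (f : Fam) : R := (f v).2.
Definition fam_label v (f : Fam) : 'rV[R]_n := (f v).1.

Lemma measurable_fam_clock v : measurable_fun setT (fam_clock v).
Proof. exact: measurableT_comp measurable_snd (measurable_family_coord _). Qed.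

Lemma measurable_fam_label v : measurable_fun setT (fam_label v).
Proof. exact: measurableT_comp measurable_fst (measurable_family_coord _). Qed.

Lemma measurable_sub_cascade (c : tree_space R n) v :
  measurable_fun setT (sub_cascade c v).
Proof.
apply: measurable_to_family => u; apply: measurable_fun_pair.
  exact: ts_measurable_W.
exact: ts_measurable_T.
Qed.

Lemma measurable_thinning (c : tree_space R n) : measurable_fun setT (@thinning R n c).
Proof. by apply: measurable_to_family => u; exact: ts_measurable_K. Qed.

(** Processes are regarded as functions of the whole family of labels and
    clocks together with the remaining time, because the restart property of a
    cascade is a statement on laws of families. *)
Definition fam_trunc (V : Type) (zero : V) (leaf : 'rV[R]_n -> V)
    (node : 'rV[R]_n -> V -> V -> V) k v (p : Fam * R) : V :=
  trunc zero (fam_clock ^~ p.1) (fun u => leaf (fam_label u p.1))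
    (fun u => node (fam_label u p.1)) k v p.2.

Definition fam_val (V : choiceType) (zero : V) (leaf : 'rV[R]_n -> V)
    (node : 'rV[R]_n -> V -> V -> V) (p : Fam * R) : V :=
  tree_val zero (fam_clock ^~ p.1) (fun u => leaf (fam_label u p.1))
    (fun u => node (fam_label u p.1)) [::] p.2.

(** One step of the recursion, continued by an arbitrary functional [G] on the
    two subtrees: both the truncations and the full value are described by
    it. *)
Definition fam_step (V : Type) (leaf : 'rV[R]_n -> V)
    (node : 'rV[R]_n -> V -> V -> V) (G : Fam * R -> V) (p : Fam * R) : V :=
  if p.2 <= fam_clock [::] p.1 then leaf (fam_label [::] p.1)
  else node (fam_label [::] p.1)
    (G (shift false p.1, p.2 - fam_clock [::] p.1))
    (G (shift true p.1, p.2 - fam_clock [::] p.1)).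

Lemma fam_truncS (V : choiceType) (zero : V) leaf node k :
  fam_trunc zero leaf node k.+1 [::] =
  fam_step leaf node (fam_trunc zero leaf node k [::]).
Proof.
by apply/funext => p; rewrite /fam_trunc /fam_step /= /child1 /child2 /= !trunc_cons.
Qed.

Lemma fam_val_step (V : choiceType) (zero : V) leaf node :
  (forall x, forall a, node x zero a = zero /\ node x a zero = zero) ->
  fam_val zero leaf node = fam_step leaf node (fam_val zero leaf node).
Proof.
move=> node0; apply/funext => p.
rewrite {1}/fam_val tree_val_step; last by move=> v x; exact: node0.
by rewrite /fam_step /child1 /child2 /= !tree_val_cons.
Qed.

Lemma fam_trunc_near (V : choiceType) (zero : V) leaf node p :
  (forall x, forall a, node x zero a = zero /\ node x a zero = zero) ->
  \forall k \near \oo, fam_trunc zero leaf node k [::] p = fam_val zero leaf node p.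
Proof.
move=> node0.
have [|k0 Hk] := @trunc_near R V zero (fam_clock ^~ p.1)
   (fun u => leaf (fam_label u p.1)) (fun u => node (fam_label u p.1)) _ [::] p.2.
  by move=> v x; exact: node0.
by exists k0.
Qed.

Lemma measurable_clock_test v :
  measurable_fun setT (fun p : Fam * R => p.2 <= fam_clock v p.1).
Proof.
apply: measurable_fun_ler => //.
exact: measurableT_comp (measurable_fam_clock v) measurable_fst.
Qed.

Lemma measurable_clock_sub v :
  measurable_fun setT (fun p : Fam * R => (p.1, p.2 - fam_clock v p.1)).
Proof.
apply: measurable_fun_pair => //; apply: measurable_funB => //.
exact: measurableT_comp (measurable_fam_clock v) measurable_fst.
Qed.

Section ereal_valued.
Context (psi0 : 'rV[R]_n -> \bar R) (mpsi0 : measurable_fun setT psi0).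
Local Open Scope ereal_scope.
Local Notation tr := (fam_trunc 0 psi0 (fun _ a b => a * b)).
Local Notation fv := (fam_val 0 psi0 (fun _ a b => a * b)).

Definition valY : Fam * R -> \bar R := fv.
Definition approxY k : Fam * R -> \bar R := tr k [::].

Lemma measurable_fam_trunc k v : measurable_fun setT (tr k v).
Proof.
elim: k v => [|k IH] v; first exact: measurable_cst.
apply: measurable_fun_ifT; first exact: measurable_clock_test.
  apply: measurableT_comp => //.
  exact: measurableT_comp (measurable_fam_label v) measurable_fst.
apply: emeasurable_funM.
  exact: (measurableT_comp (IH (child1 v)) (measurable_clock_sub v)).
exact: (measurableT_comp (IH (child2 v)) (measurable_clock_sub v)).
Qed.

Lemma mule_absorbing (x : 'rV[R]_n) (a : \bar R) : 0 * a = 0 /\ a * 0 = 0.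
Proof. by rewrite mul0e mule0. Qed.

Lemma approxY_near p : \forall k \near \oo, approxY k p = valY p.
Proof. by apply: fam_trunc_near => x a; exact: mule_absorbing. Qed.

Lemma valY_step : valY = fam_step psi0 (fun _ a b => a * b) valY.
Proof. by apply: fam_val_step => x a; exact: mule_absorbing. Qed.

Lemma approxYS k : approxY k.+1 = fam_step psi0 (fun _ a b => a * b) (approxY k).
Proof. exact: fam_truncS. Qed.

Lemma measurable_approxY k : measurable_fun setT (approxY k).
Proof. exact: measurable_fam_trunc. Qed.

Lemma measurable_valY : measurable_fun setT valY.
Proof.
apply: (emeasurable_fun_cvg approxY) => [k|p _]; first exact: measurable_approxY.
by apply: cvg_near_cst; exact: approxY_near.
Qed.

Context (psi0_ge0 : forall x, 0 <= psi0 x).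

Lemma fam_trunc_ge0 k v p : 0 <= tr k v p.
Proof.
rewrite /fam_trunc; elim: k v p.2 => [|k IH] v s //=; case: ifP => // _.
by rewrite mule_ge0.
Qed.

Lemma approxY_ge0 k p : 0 <= approxY k p. Proof. exact: fam_trunc_ge0. Qed.

Lemma approxY_le p : {homo approxY ^~ p : k m / (k <= m)%N >-> k <= m}.
Proof.
apply: homo_leq => [//|a b c|k]; first exact: le_trans.
rewrite /approxY /fam_trunc; elim: k [::] p.2 => [|k IH] v s.
  by have := fam_trunc_ge0 1 v (p.1, s).
rewrite /= -/(trunc _ _ _ _ k.+1); case: ifP => // _.
apply: lee_pmul; rewrite ?IH//.
  by have := fam_trunc_ge0 k (child1 v) (p.1, s - fam_clock v p.1)%R.
by have := fam_trunc_ge0 k (child2 v) (p.1, s - fam_clock v p.1)%R.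
Qed.

Lemma valY_ge0 p : 0 <= valY p.
Proof.
by have [k _ /(_ k (leqnn k)) <-] := approxY_near p; exact: approxY_ge0.
Qed.

Lemma approxY_le_valY k p : approxY k p <= valY p.
Proof.
have [m _ /(_ (maxn k m) (leq_maxr _ _)) <-] := approxY_near p.
exact: (approxY_le p (leq_maxl k m)).
Qed.

End ereal_valued.

Lemma valY_le (psi0 phi0 : 'rV[R]_n -> \bar R) p :
  (forall x, 0 <= psi0 x)%E -> (forall x, psi0 x <= phi0 x)%E ->
  (valY psi0 p <= valY phi0 p)%E.
Proof.
move=> p0 pp.
have [k1 _ H1] := approxY_near psi0 p; have [k2 _ H2] := approxY_near phi0 p.
rewrite -(H1 (maxn k1 k2) (leq_maxl _ _)) -(H2 (maxn k1 k2) (leq_maxr _ _)).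
rewrite /approxY /fam_trunc; elim: (maxn k1 k2) [::] p.2 => [|k IH] v s //=.
case: ifP => // _; apply: lee_pmul; rewrite ?IH//.
  exact: (@fam_trunc_ge0 psi0 p0 k (child1 v) (p.1, s - fam_clock v p.1)).
exact: (@fam_trunc_ge0 psi0 p0 k (child2 v) (p.1, s - fam_clock v p.1)).
Qed.

Section vector_valued.
Context (chi0 : 'rV[R]_n -> 'rV[R[i]]_n) (mchi0 : cv_measurable chi0).

Definition valX : Fam * R -> 'rV[R[i]]_n := fam_val 0 chi0 (@odot R n).
Definition approxX k : Fam * R -> 'rV[R[i]]_n := fam_trunc 0 chi0 (@odot R n) k [::].

Lemma odot_absorbing (x : 'rV[R]_n) (a : 'rV[R[i]]_n) : odot x 0 a = 0 /\ odot x a 0 = 0.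
Proof. by rewrite odot0l odot0r. Qed.

Lemma approxX_near p : \forall k \near \oo, approxX k p = valX p.
Proof. by apply: fam_trunc_near => x a; exact: odot_absorbing. Qed.

Lemma valX_step : valX = fam_step chi0 (@odot R n) valX.
Proof. by apply: fam_val_step => x a; exact: odot_absorbing. Qed.

Lemma approxXS k : approxX k.+1 = fam_step chi0 (@odot R n) (approxX k).
Proof. exact: fam_truncS. Qed.

Lemma cv_measurable_comp d1 d2 (S1 : measurableType d1) (S2 : measurableType d2)
    (g : S2 -> 'rV[R[i]]_n) (f : S1 -> S2) :
  cv_measurable g -> measurable_fun setT f -> cv_measurable (g \o f).
Proof.
by move=> mg mf j; have [m1 m2] := mg j; split;
  [exact: measurableT_comp m1 mf|exact: measurableT_comp m2 mf].
Qed.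

Lemma cv_measurable_if d1 (S : measurableType d1) (c : S -> bool)
    (f g : S -> 'rV[R[i]]_n) : measurable_fun setT c ->
  cv_measurable f -> cv_measurable g -> cv_measurable (fun s => if c s then f s else g s).
Proof.
move=> mc mf mg; apply/cv_measurableP => p.
rewrite (_ : (fun _ => _) = fun s => if c s then coord p (f s) else coord p (g s)).
  by apply: measurable_fun_ifT => //; [exact: (cv_measurableP f).1|exact: (cv_measurableP g).1].
by apply/funext => s; case: ifP.
Qed.

Lemma cv_measurable_fam_trunc k v : cv_measurable (fam_trunc 0 chi0 (@odot R n) k v).
Proof.
elim: k v => [|k IH] v; first by move=> j; split; exact: measurable_cst.
apply: cv_measurable_if; first exact: measurable_clock_test.
  apply: (cv_measurable_comp mchi0).
  exact: measurableT_comp (measurable_fam_label v) measurable_fst.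
apply: cv_measurable_odot.
- exact: measurableT_comp (measurable_fam_label v) measurable_fst.
- exact: (cv_measurable_comp (IH _) (measurable_clock_sub v)).
- exact: (cv_measurable_comp (IH _) (measurable_clock_sub v)).
Qed.

Lemma cv_measurable_approxX k : cv_measurable (approxX k).
Proof. exact: cv_measurable_fam_trunc. Qed.

Lemma cv_measurable_valX : cv_measurable valX.
Proof.
apply/cv_measurableP => q.
apply: (measurable_fun_cvg (h := fun k p => coord q (approxX k p))) => [k|p _].
  by have /cv_measurableP := cv_measurable_approxX k; exact.
apply: cvg_near_cst; have := approxX_near p.
by apply: filterS => k ->.
Qed.

Let psi0 x : \bar R := (cnorm (chi0 x) / 2)%:E.

Lemma cnorm_approxX k p : ((cnorm (approxX k p))%:E <= 2%:E * approxY psi0 k p)%E.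
Proof.
have p0 x : (0 <= psi0 x)%E by rewrite lee_fin divr_ge0// cnorm_ge0.
rewrite /approxX /approxY /fam_trunc; elim: k [::] p.2 => [|k IH] v s /=.
  by rewrite cnorm0 mule0.
case: ifP => _; first by rewrite -EFinM lee_fin mulrC divfK.
move: (IH (child1 v) (s - fam_clock v p.1)) (IH (child2 v) (s - fam_clock v p.1)).
set X1 := trunc _ _ _ _ _ _ _; set Y1 := trunc _ _ _ _ _ _ _.
set X2 := trunc _ _ _ _ _ _ _; set Y2 := trunc _ _ _ _ _ _ _.
have Y10 : (0 <= Y1)%E by exact: (@fam_trunc_ge0 psi0 p0 k (child1 v) (p.1, _)).
have Y20 : (0 <= Y2)%E by exact: (@fam_trunc_ge0 psi0 p0 k (child2 v) (p.1, _)).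
move=> H1 H2.
have := cnorm_odot (fam_label v p.1) X1 X2; rewrite -lee_fin => /le_trans; apply.
apply: (@le_trans _ _ ((2^-1)%:E * ((2%:E * Y1) * (2%:E * Y2)))%E).
  rewrite [X in (X%:E <= _)%E]mulrC EFinM; apply: lee_pmul => //.
  - by rewrite lee_fin mulr_ge0// cnorm_ge0.
  - by rewrite EFinM; apply: lee_pmul => //; rewrite lee_fin cnorm_ge0.
by rewrite muleACA !muleA -!EFinM mulVf// mul1r.
Qed.

(** By the inequality [cnorm_odot], half the norm of X is submultiplicative
    where Y is multiplicative, and both start from the same data. *)
Lemma cnorm_valX p : ((cnorm (valX p))%:E <= 2%:E * valY psi0 p)%E.
Proof.
have [k1 _ H1] := approxX_near p; have [k2 _ H2] := approxY_near psi0 p.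
rewrite -(H1 (maxn k1 k2) (leq_maxl _ _)) -(H2 (maxn k1 k2) (leq_maxr _ _)).
exact: cnorm_approxX.
Qed.

End vector_valued.

End families.

(** * Null sets, densities and independence *)

Section off_null.
Context d (T : measurableType d) (R : realType) (mu : {measure set T -> \bar R}).
Local Open Scope ereal_scope.
Import HBNNSimple.

(** The integral of a nonnegative function is a supremum over simple functions
    below it, and a simple function may be set to 0 on a measurable null set
    without changing its integral. Arbitrary functions can therefore be
    compared. *)
Let ge0_le_integral_off_null (N : set T) (f g : T -> \bar R) :
  measurable N -> mu N = 0 -> (forall x, 0 <= f x) -> (forall x, 0 <= g x) ->
  (forall x, ~ N x -> f x = g x) -> \int[mu]_x f x <= \int[mu]_x g x.
Proof.
move=> mN N0 f0 g0 fg; rewrite ge0_integralTE// (ge0_integralTE _ g0).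
apply: ge_ereal_sup => _ [h hf <-].
apply: ereal_sup_ubound; exists (proj_nnsfun h (measurableC mN)) => /=.
  move=> x; rewrite mindicE; have [Nx|Nx] := pselect (N x).
    by rewrite memNset ?mulr0//=; exact.
  by rewrite mem_set ?mulr1//= -fg.
rewrite -!integralT_nnsfun; apply: ge0_ae_eq_integral => //.
- by apply/measurable_EFinP.
- by apply/measurable_EFinP.
- by move=> x _; rewrite lee_fin.
- by move=> x _; rewrite lee_fin.
exists N; split => // x; apply: contra_notP => Nx _ /=.
by rewrite mindicE mem_set// mulr1.
Qed.

Lemma integral_off_null (N D : set T) (f g : T -> \bar R) :
  measurable N -> mu N = 0 -> (forall x, D x -> ~ N x -> f x = g x) ->
  \int[mu]_(x in D) f x = \int[mu]_(x in D) g x.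
Proof.
move=> mN N0 fg; rewrite integral_mkcond [RHS]integral_mkcond.
have fgD x : ~ N x -> (f \_ D) x = (g \_ D) x.
  move=> Nx; rewrite !patchE; case: ifPn => // /set_mem Dx; exact: fg.
rewrite integralE [RHS]integralE; congr (_ - _); apply/eqP; rewrite eq_le;
  apply/andP; split; apply: (ge0_le_integral_off_null mN N0) => // x Nx;
  by rewrite ?funeposE ?funenegE fgD.
Qed.

End off_null.

Section integral_like.
Context d (T : measurableType d) (R : realType).
Local Open Scope ereal_scope.
Import HBNNSimple.
Implicit Types (f g : T -> \bar R) (I J : (T -> \bar R) -> \bar R).

(** The properties of f |-> \int f dm on nonnegative measurable functions that
    determine it from its values on indicators. Two expressions in [f] can so be
    compared without first building the measure that each of them defines. *)
Record integral_like I : Prop := {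
  int_likeD : forall f g, measurable_fun setT f -> measurable_fun setT g ->
    (forall x, 0 <= f x) -> (forall x, 0 <= g x) ->
    I (fun x => f x + g x) = I f + I g;
  int_likeZ : forall (r : R) f, (0 <= r)%R -> measurable_fun setT f ->
    (forall x, 0 <= f x) -> I (fun x => r%:E * f x) = r%:E * I f;
  int_like_cvg : forall (F : (T -> \bar R)^nat) f,
    (forall k, measurable_fun setT (F k)) -> (forall k x, 0 <= F k x) ->
    (forall x, {homo F ^~ x : k m / (k <= m)%N >-> k <= m}) ->
    (forall x, F ^~ x @ \oo --> f x) -> (fun k => I (F k)) @ \oo --> I f }.

(** Linearity extends the equality from indicators to simple functions, and
    monotone limits to all nonnegative measurable functions. *)
Lemma eq_integral_like I J : integral_like I -> integral_like J ->
  (forall A, measurable A -> I (fun x => (\1_A x)%:E) = J (fun x => (\1_A x)%:E)) ->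
  forall f, measurable_fun setT f -> (forall x, 0 <= f x) -> I f = J f.
Proof.
move=> iI iJ IJ f mf f0.
have IJs (h : {nnsfun T >-> R}) : I (EFin \o h) = J (EFin \o h).
  have -> : EFin \o h = fun x => \sum_(y <- finmap.enum_fset (fset_set (range h)))
      (y%:E * (\1_(h @^-1` [set y]) x)%:E).
    apply/funext => x /=; rewrite fimfunE fsbig_finite//= -sumEFin.
    by apply: eq_bigr => y _; rewrite -EFinM.
  have y0 y : y \in finmap.enum_fset (fset_set (range h)) -> (0 <= y)%R.
    by move=> yh; have := in_fset_set (fimfunP h) y; rewrite yh => /esym/set_mem[x _ <-].
  have mi y : measurable_fun setT (fun x => (\1_(h @^-1` [set y]) x)%:E : \bar R).
    by apply/measurable_EFinP; exact: measurable_indic.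
  have i0 y x : 0 <= (\1_(h @^-1` [set y]) x)%:E :> \bar R by rewrite lee_fin.
  elim: (finmap.enum_fset (fset_set (range h))) y0 => [|y s IH] y0.
    under eq_fun do rewrite big_nil -(mul0e 0).
    by rewrite !int_likeZ ?mul0e//; exact: measurable_cst.
  have ys : (0 <= y)%R by apply: y0; rewrite mem_head.
  have IHs := IH (fun z zs => y0 z (mem_behead (s := y :: s) zs)).
  under eq_fun do rewrite big_cons.
  have ms : measurable_fun setT (fun x => \sum_(j <- s) (j%:E * (\1_(h @^-1` [set j]) x)%:E)).
    by apply: emeasurable_sum => j; exact: measurable_funeM.
  have s0 x : 0 <= \sum_(j <- s) (j%:E * (\1_(h @^-1` [set j]) x)%:E).
    rewrite big_seq; apply: sume_ge0 => j js; rewrite mule_ge0// lee_fin.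
    by apply: y0; rewrite in_cons js orbT.
  have my : measurable_fun setT (fun x => y%:E * (\1_(h @^-1` [set y]) x)%:E).
    exact: measurable_funeM.
  have yi x : 0 <= y%:E * (\1_(h @^-1` [set y]) x)%:E by rewrite mule_ge0.
  rewrite (int_likeD iI)// (int_likeD iJ)// IHs; congr (_ + _).
  by rewrite (int_likeZ iI)// (int_likeZ iJ)// IJ.
pose F k := EFin \o nnsfun_approx measurableT mf k.
have mF k : measurable_fun setT (F k) by apply/measurable_EFinP.
have F0 k x : 0 <= F k x by rewrite lee_fin.
have ndF x : {homo F ^~ x : k m / (k <= m)%N >-> k <= m}.
  by move=> a b ab; rewrite lee_fin; exact/lefP/nd_nnsfun_approx.
have Ff x : F ^~ x @ \oo --> f x by apply: cvg_nnsfun_approx.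
have cI := int_like_cvg iI mF F0 ndF Ff.
have cJ := int_like_cvg iJ mF F0 ndF Ff.
apply: (cvg_unique _ cI) => //.
have -> : (fun k => I (F k)) = fun k => J (F k) by apply/funext => k; exact: IJs.
exact: cJ.
Qed.

Section kernel_like.
Context d' (X : measurableType d') (mu : {measure set X -> \bar R}).
Context (k : X -> \bar R) (k0 : forall x, 0 <= k x) (mk : measurable_fun setT k).

Lemma integral_like_kernel (l : X -> {measure set T -> \bar R}) :
  (forall U, measurable U -> measurable_fun setT (l ^~ U)) ->
  integral_like (fun f => \int[mu]_x (k x * \int[l x]_y f y)).
Proof.
move=> ml.
have mi f : measurable_fun setT f -> (forall x, 0 <= f x) ->
    measurable_fun setT (fun x => \int[l x]_y f y).
  by move=> mf f0; exact: measurable_fun_integral_kernel.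
have mki f : measurable_fun setT f -> (forall x, 0 <= f x) ->
    measurable_fun setT (fun x => k x * \int[l x]_y f y).
  by move=> mf f0; apply: emeasurable_funM => //; exact: mi.
have ki0 f x : (forall x, 0 <= f x) -> 0 <= k x * \int[l x]_y f y.
  by move=> f0; rewrite mule_ge0// integral_ge0.
split=> [f g mf mg f0 g0|r f r0 mf f0|F f mF F0 ndF Ff].
- rewrite -ge0_integralD//; [|by move=> x _; exact: ki0|exact: mki|
    by move=> x _; exact: ki0|exact: mki].
  by apply: eq_integral => x _; rewrite ge0_integralD// ge0_muleDr// integral_ge0.
- rewrite -ge0_integralZl//; [|exact: mki|by move=> x _; exact: ki0].
  by apply: eq_integral => x _; rewrite ge0_integralZl// muleCA.
- have f0 x : 0 <= f x.
    by apply: (cvge_ge _ (Ff x)); exact: nearW.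
  have mf : measurable_fun setT f by apply: (emeasurable_fun_cvg F).
  have H1 x : (fun m => \int[l x]_y F m y) @ \oo --> \int[l x]_y f y.
    rewrite (_ : \int[l x]_y f y = \int[l x]_y limn (F ^~ y)).
      by apply: cvg_monotone_convergence.
    by apply: eq_integral => y _; apply/esym/cvg_lim => //; exact: Ff.
  (* multiplication on [0, +oo] is not continuous at (0, +oo), so a vanishing
     factor is treated apart *)
  have H0 x : (fun m => k x * \int[l x]_y F m y) @ \oo --> k x * \int[l x]_y f y.
    have [If0|If0] := eqVneq (\int[l x]_y f y) 0.
      rewrite If0 mule0 (_ : (fun _ => _) = cst 0); first exact: cvg_cst.
      apply/funext => m /=; suff -> : \int[l x]_y F m y = 0 by rewrite mule0.
      apply/eqP; rewrite eq_le integral_ge0// andbT -If0.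
      apply: ge0_le_integral => // y _.
      by apply: (cvge_ge _ (Ff y)); exists m => // p /= /ndF.
    have [kx0|kx0] := eqVneq (k x) 0.
      rewrite kx0 mul0e (_ : (fun _ => _) = cst 0); first exact: cvg_cst.
      by apply/funext => m /=; rewrite mul0e.
    apply: cvgeM => //; last exact: cvg_cst.
    have If1 : (0 <= \int[l x]_y f y) by exact: integral_ge0.
    by move: kx0 If0 If1; case: (\int[l x]_y f y) => [r| |]//=;
      case: (k x) (k0 x) => [q| |]//=;
      rewrite /mule_def ?eqe ?andbF ?andbT//= => _ q0 r0 _;
      rewrite ?(negbTE r0) ?(negbTE q0) ?orbF.
  have H x : (fun m => k x * \int[l x]_y F m y) @ \oo --> k x * \int[l x]_y f y.
    exact: H0.
  rewrite (_ : (\int[mu]_x (k x * \int[l x]_y f y)) =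
     \int[mu]_x limn (fun m => k x * \int[l x]_y F m y)).
    apply: cvg_monotone_convergence => //.
    - by move=> m; apply: mki.
    - by move=> m x _; exact: ki0.
    - by move=> x _ a b ab; rewrite lee_wpmul2l// ge0_le_integral// => y _; exact: ndF.
  by apply: eq_integral => x _; apply/esym/cvg_lim => //; exact: H.
Qed.

End kernel_like.
End integral_like.

Section integral_like_map.
Context d (T : measurableType d) (R : realType).
Local Open Scope ereal_scope.

Lemma integral_like_ext (I J : (T -> \bar R) -> \bar R) :
  (forall f, measurable_fun setT f -> (forall x, 0 <= f x) -> I f = J f) ->
  integral_like I -> integral_like J.
Proof.
move=> IJ iI; split=> [f g mf mg f0 g0|r f r0 mf f0|F f mF F0 ndF Ff].
- rewrite -!IJ// ?(int_likeD iI)//; last by move=> x; rewrite adde_ge0.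
  exact: emeasurable_funD.
- by rewrite -!IJ ?(int_likeZ iI)// => [|x]; [exact: measurable_funeM|rewrite mule_ge0].
- have f0 x : 0 <= f x by apply: (cvge_ge _ (Ff x)); exact: nearW.
  have mf : measurable_fun setT f by apply: (emeasurable_fun_cvg F).
  rewrite -IJ//; have -> : (fun k => J (F k)) = fun k => I (F k).
    by apply/funext => k; rewrite IJ.
  exact: (int_like_cvg iI).
Qed.

Lemma integral_like_map d' (X : measurableType d') (mu : {measure set X -> \bar R})
    (k : X -> \bar R) (phi : X -> T) : (forall x, 0 <= k x) ->
  measurable_fun setT k -> measurable_fun setT phi ->
  integral_like (fun f => \int[mu]_x (k x * f (phi x))).
Proof.
move=> k0 mk mphi.
apply: (integral_like_ext (I := fun f => \int[mu]_x (k x * \int[\d_(phi x)]_y f y))).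
  by move=> f mf f0; apply: eq_integral => x _; rewrite integral_dirac// diracT mul1e.
apply: integral_like_kernel => // U mU.
rewrite (_ : (fun _ => _) = fun x => (\1_U (phi x))%:E).
  by apply/measurable_EFinP; apply: measurableT_comp mphi; exact: measurable_indic.
by apply/funext => x; rewrite /= diracE indicE.
Qed.

Lemma ge0_integral_density (m mu : {measure set T -> \bar R}) (k : T -> \bar R) :
  (forall x, 0 <= k x) -> measurable_fun setT k ->
  (forall A, measurable A -> m A = \int[mu]_(x in A) k x) ->
  forall f, measurable_fun setT f -> (forall x, 0 <= f x) ->
  \int[m]_x f x = \int[mu]_x (k x * f x).
Proof.
move=> k0 mk mE; apply: eq_integral_like.
- apply: (integral_like_ext (I := fun f => \int[m]_x (cst 1 x * f (id x)))).
    by move=> f mf f0; apply: eq_integral => x _; rewrite mul1e.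
  by apply: integral_like_map => // x; exact: lee01.
- exact: (integral_like_map mu (phi := id)).
- move=> A mA; rewrite integral_indic// setIT mE// integral_mkcond.
  by apply: eq_integral => x _; rewrite patchE indicE; case: ifPn => _; rewrite ?mule1 ?mule0.
Qed.

End integral_like_map.

Section rectangles.
Context d1 d2 (T1 : measurableType d1) (T2 : measurableType d2) (R : realType).
Local Open Scope ereal_scope.

(** Rectangles are stable under intersection and generate the product
    sigma-algebra. *)
Lemma eq_measure_rectangles (m1 m2 : {measure set (T1 * T2) -> \bar R}) :
  m1 setT < +oo -> (forall A B, measurable A -> measurable B ->
    m1 (A `*` B) = m2 (A `*` B)) -> forall C, measurable C -> m1 C = m2 C.
Proof.
move=> m1oo mE C mC.
pose G : set (set (T1 * T2)) :=
  [set C | exists A, measurable A /\ exists B, measurable B /\ C = A `*` B].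
have GT : G setT.
  by exists setT; split => //; exists setT; split => //; rewrite setXTT.
apply: (measure_unique G (fun=> setT)) => //.
- rewrite measurable_prod_measurableType //; congr (<<s _ >>).
  rewrite predeqE; split => [[A mA [B mB <-]]|[A [mA [B [mB ->]]]]].
    by exists A; split => //; exists B.
  by exists A => //; exists B.
- move=> /= _ _ [X1 [mX1 [X2 [mX2 ->]]]] [Y1 [mY1 [Y2 [mY2 ->]]]].
  rewrite -setXI; exists (X1 `&` Y1); split; first exact: measurableI.
  by exists (X2 `&` Y2); split => //; exact: measurableI.
- by rewrite bigcup_const//; exists 0%N.
- by move=> _ [A [mA [B [mB ->]]]]; exact: mE.
Qed.

End rectangles.

Section law_of.
Context d d1 (O : measurableType d) (T : measurableType d1) (R : realType)
  (P : probability O R) (X : O -> T) (mX : measurable_fun setT X).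
Local Open Scope ereal_scope.

Let rX : {mfun O >-> T} := HB.pack X (isMeasurableFun.Build _ _ _ _ _ mX).

Definition law_of : probability T R := distribution P rX.

Lemma ge0_integral_law_of (f : T -> \bar R) :
  measurable_fun setT f -> (forall y, 0 <= f y) ->
  \int[law_of]_y f y = \int[P]_w f (X w).
Proof. by move=> mf f0; rewrite ge0_integral_distribution. Qed.

End law_of.

Section independence.
Context d d1 d2 (O : measurableType d) (T1 : measurableType d1)
  (T2 : measurableType d2) (R : realType) (P : probability O R).
Local Open Scope ereal_scope.
Context (X : O -> T1) (Y : O -> T2) (mX : measurable_fun setT X)
  (mY : measurable_fun setT Y).
Context (XY : forall A B, measurable A -> measurable B ->
    P (X @^-1` A `&` Y @^-1` B) = P (X @^-1` A) * P (Y @^-1` B)).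

(** Independence says that the law of the pair is the product of the laws;
    then Tonelli applies. *)
Lemma ge0_integral_indep (f : T1 * T2 -> \bar R) :
  measurable_fun setT f -> (forall z, 0 <= f z) ->
  \int[P]_w f (X w, Y w) = \int[P]_w \int[P]_w' f (X w, Y w').
Proof.
move=> mf f0.
have mXY : measurable_fun setT (fun w => (X w, Y w)) by exact: measurable_fun_pair.
transitivity (\int[law_of P mX \x law_of P mY]_z f z).
  transitivity (\int[law_of P mXY]_z f z); first by rewrite ge0_integral_law_of.
  apply: eq_measure_integral => C mC _; apply/esym.
  by apply: (product_measure_unique (m' := law_of P mXY)) => // A B mA mB; exact: XY.
rewrite fubini_tonelli1// ge0_integral_law_of//.
- apply: eq_integral => w _; rewrite /fubini_F ge0_integral_law_of//.
  exact: measurableT_comp mf (measurable_pair1 _).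
- exact: measurable_fun_fubini_tonelli_F.
- by move=> x; exact: integral_ge0.
Qed.

End independence.

Section parametric_Rintegral.
Context d1 d2 (T1 : measurableType d1) (T2 : measurableType d2) (R : realType).
Local Open Scope ereal_scope.

(** Positive and negative parts are integrated separately; the hypothesis is
    what Tonelli or a kernel provides for nonnegative functions. *)
Lemma measurable_param_Rintegral (l : T1 -> {measure set T2 -> \bar R}) (f : T1 * T2 -> R) :
  (forall g : T1 * T2 -> \bar R, measurable_fun setT g -> (forall z, 0 <= g z) ->
    measurable_fun setT (fun x => \int[l x]_y g (x, y))) ->
  measurable_fun setT f ->
  measurable_fun setT (fun x => (\int[l x]_y f (x, y))%R).
Proof.
move=> ml mf; apply: (measurableT_comp (f := fine)) => //.
have mEf : measurable_fun setT (EFin \o f) by exact/measurable_EFinP.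
rewrite (_ : (fun x => _) = fun x => \int[l x]_y (EFin \o f)^\+ (x, y) -
    \int[l x]_y (EFin \o f)^\- (x, y)).
  apply: emeasurable_funB; apply: ml => // ; [exact: measurable_funepos|exact: measurable_funeneg].
apply/funext => x; rewrite integralE; congr (_ - _); apply: eq_integral => y _.
  by rewrite !funeposE.
by rewrite !funenegE.
Qed.

End parametric_Rintegral.

Section lebesgue_facts.
Context (R : realType).
Local Open Scope ereal_scope.

Lemma measurable_row1 n (x : 'rV[R]_n) : measurable [set x].
Proof.
rewrite (_ : [set x] = \bigcap_(i in [set: 'I_n])
    ((fun y : 'rV[R]_n => y ord0 i) @^-1` [set x ord0 i])).
  apply: fin_bigcap_measurable => // i _; rewrite -[X in measurable X]setTI.
  by apply: measurable_coord => //; exact: measurable_set1.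
apply/seteqP; split => [y -> i _//|y yx]; apply/rowP => i; exact: yx.
Qed.

Lemma lebesgue_rV1 n (x : 'rV[R]_n) : (0 < n)%N -> lebesgue_rV R n [set x] = 0.
Proof.
move=> n0; rewrite (_ : [set x] = [set y | forall i, [set x ord0 i] (y ord0 i)]).
  transitivity (\prod_(i < n) lebesgue_measure [set x ord0 i]).
    by apply: (@lebesgue_rV_box R n (fun i => [set x ord0 i])) => i; exact: measurable_set1.
  case: n n0 x => // n _ x.
  by rewrite big_ord_recl lebesgue_measure_set1 mul0e.
by apply/seteqP; split => [y -> i//|y yx]; apply/rowP => i; exact: yx.
Qed.

Lemma lebesgue_measure_reflect (t : R) (A : set R) : measurable A ->
  pushforward (@lebesgue_measure R) ((fun s => (t - s)%R) : _ -> measurableTypeR R) A =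
  lebesgue_measure A.
Proof.
have mt : measurable_fun setT ((fun s => (t - s)%R) : R -> measurableTypeR R).
  exact: measurable_funB.
pose rt : {mfun R >-> measurableTypeR R} := HB.pack (fun s : R => (t - s)%R : measurableTypeR R)
  (isMeasurableFun.Build _ _ _ _ _ mt).
move=> mA; apply/esym; apply: (lebesgue_measure_unique (mu := pushforward lebesgue_measure rt)) => //= _ [[a b]] _ <-.
rewrite /pushforward.
rewrite (_ : rt @^-1` _ = `[(t - b)%R, (t - a)%R[%classic); last first.
  apply/seteqP; split => x /=; rewrite !in_itv /= => /andP[xa xb]; apply/andP; split; lra.
rewrite !lebesgue_measure_itv/= !lte_fin ltrD2l ltrN2.
by case: ifPn => // _; rewrite -!EFinB; congr EFin; ring.
Qed.

Lemma ge0_integral_reflect (t : R) (f : R -> \bar R) : measurable_fun setT f ->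
  (forall s, 0 <= f s) ->
  \int[lebesgue_measure]_(s in `[0%R, t]) f (t - s)%R =
  \int[lebesgue_measure]_(s in `[0%R, t]) f s.
Proof.
move=> mf f0.
have mt : measurable_fun setT ((fun s => (t - s)%R) : R -> measurableTypeR R).
  exact: measurable_funB.
transitivity (\int[pushforward (@lebesgue_measure R) ((fun s => (t - s)%R) : _ -> measurableTypeR R)]_(s in `[0%R, t]) f s).
  rewrite ge0_integral_pushforward//; last exact: measurable_funS mf.
  rewrite (_ : _ @^-1` _ = `[0%R, t]%classic)//.
  apply/seteqP; split => x /=; rewrite !in_itv /= => /andP[xa xb]; apply/andP; split; lra.
by apply: eq_measure_integral => A mA _; exact: lebesgue_measure_reflect.
Qed.

End lebesgue_facts.

(** * The law of the first branching *)

Section almost_everywhere.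
Context d (T : measurableType d) (R : realType) (mu : {measure set T -> \bar R}).
Local Open Scope ereal_scope.

Lemma integral_ae (D : set T) (f g : T -> \bar R) :
  {ae mu, forall x, D x -> f x = g x} ->
  \int[mu]_(x in D) f x = \int[mu]_(x in D) g x.
Proof.
move=> [N [mN N0 fgN]]; apply: (integral_off_null mN N0) => x Dx Nx.
by apply: contrapT => fg; apply: Nx; apply: fgN => /= /(_ Dx).
Qed.

Lemma eq_measure_ae (A B : set T) : measurable A -> measurable B ->
  {ae mu, forall x, A x <-> B x} -> mu A = mu B.
Proof.
move=> mA mB AB; rewrite -[A]setIT -[B]setIT -!integral_indic//.
apply: integral_ae; apply: filterS AB => x ABx _.
by rewrite !indicE; congr ((nat_of_bool _)%:R)%:E; apply/idP/idP => /set_mem /ABx /mem_set.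
Qed.

End almost_everywhere.

Section cascade_law.
Context (R : realType) (n : nat).
Local Notation rV := ('rV[R]_n).
Local Notation Fam := (family_of vertex (rV * R)%type).
Local Open Scope ereal_scope.

Lemma measurable_subr (xi : rV) : measurable_fun setT (fun eta : rV => xi - eta)%R.
Proof.
apply: measurable_fun_row => i; under eq_fun do rewrite !mxE.
by apply: measurable_funB => //; exact: measurable_coord.
Qed.

Definition fam_law (c : tree_space R n) : probability Fam R :=
  law_of (ts_P c) (@measurable_sub_cascade _ _ c [::]).

Lemma ge0_integral_fam_law c (f : Fam -> \bar R) : measurable_fun setT f ->
  (forall x, 0 <= f x) ->
  \int[fam_law c]_x f x = \int[ts_P c]_w f (sub_cascade c [::] w).
Proof. by move=> mf f0; rewrite ge0_integral_law_of. Qed.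

Context (h : rV -> R) (C : rV -> tree_space R n).
Context (hC : forall xi, xi != 0%R -> is_cascade h C xi).
Context (n_gt0 : (0 < n)%N).

(** The restart property at the root of one cascade already contains the law of
    the cascade as a measurable function of its starting point. *)
Lemma measurable_fam_law U : measurable U ->
  measurable_fun setT (fun x => fam_law (C x) U).
Proof.
move=> mU.
have [x0 x00] : exists x : rV, x != 0%R.
  exists (\row_i 1)%R; apply/eqP => /rowP /(_ (Ordinal n_gt0)).
  by rewrite !mxE => /eqP; rewrite oner_eq0.
have [mp _ _] := cascade_restart1 (hC x00) [::] mU.
(* the law of the first subtree depends only on the first label of the pair *)
have mx : measurable_fun setT (fun x : rV => (x, 0%R : rV)) by exact: measurable_fun_pair.
exact: measurableT_comp mp mx.
Qed.

Lemma measurable_integral_fam_law (g : (rV * R) * Fam -> \bar R) :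
  measurable_fun setT g -> (forall z, 0 <= g z) ->
  measurable_fun setT (fun x : rV * R => \int[fam_law (C x.1)]_f g (x, f)).
Proof.
move=> mg g0.
pose k0 (x : rV * R) : {measure set Fam -> \bar R} := fam_law (C x.1).
have mk U : measurable U -> measurable_fun setT (k0 ^~ U).
  by move=> mU; exact: measurableT_comp (measurable_fam_law mU) measurable_fst.
have pk x : k0 x setT = 1 by exact: probability_setT.
pose k1 : R.-ker (rV * R)%type ~> Fam := HB.pack k0 (isKernel.Build _ _ _ _ _ k0 mk).
pose k2 : R.-pker (rV * R)%type ~> Fam := HB.pack (Kernel.sort k1)
  (Kernel_isProbability.Build _ _ _ _ _ (Kernel.sort k1) pk).
exact: (measurable_fun_integral_finite_kernel g k2 g0 mg).
Qed.

Definition mean (G : Fam * R -> \bar R) (x : rV) (s : R) : \bar R :=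
  \int[fam_law (C x)]_f G (f, s).

Lemma mean_ge0 G x s : (forall p, 0 <= G p) -> 0 <= mean G x s.
Proof. by move=> G0; exact: integral_ge0. Qed.

Lemma measurable_mean G : measurable_fun setT G -> (forall p, 0 <= G p) ->
  measurable_fun setT (fun x : rV * R => mean G x.1 x.2).
Proof.
move=> mG G0.
apply: (@measurable_integral_fam_law (fun z => G (z.2, z.1.2))) => //.
apply: measurableT_comp mG _; apply: measurable_fun_pair => //.
exact: measurableT_comp measurable_snd measurable_fst.
Qed.

Section root.
Context (xi : rV) (xi0 : xi != 0%R).
Local Notation c := (C xi).
Local Notation P := (ts_P (C xi)).
Local Notation T0 := (ts_T (C xi) [::]).
Local Notation W1 := (ts_W (C xi) [:: false]).
Local Notation W2 := (ts_W (C xi) [:: true]).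
Local Notation F1 := (sub_cascade (C xi) [:: false]).
Local Notation F2 := (sub_cascade (C xi) [:: true]).
Let H : is_cascade h C xi := hC xi0.
Local Notation rate := (enorm xi ^+ 2)%R.

Let mT0 : measurable_fun setT T0. Proof. exact: ts_measurable_T. Qed.
Let mW1 : measurable_fun setT W1. Proof. exact: ts_measurable_W. Qed.
Let mW2 : measurable_fun setT W2. Proof. exact: ts_measurable_W. Qed.
Let mF1 : measurable_fun setT F1. Proof. exact: measurable_sub_cascade. Qed.
Let mF2 : measurable_fun setT F2. Proof. exact: measurable_sub_cascade. Qed.

Let meas_pre d (T : measurableType d) (f : ts_sort c -> T) A :
  measurable_fun setT f -> measurable A -> measurable (f @^-1` A).
Proof. by move=> mf mA; rewrite -[X in measurable X]setTI; exact: mf. Qed.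

(** The root label is almost surely constant, so conditioning on it is
    trivial. *)
Lemma cond_prob_root (E : set (ts_sort c)) p :
  cond_prob P (ts_W c [::]) E p -> P E = p xi.
Proof.
move=> [mp p0 /(_ setT measurableT)]; rewrite preimage_setT setIT => ->.
transitivity (\int[P]_w cst (p xi) w).
  by apply: integral_ae; apply: filterS (cascade_root H) => w -> _.
by rewrite (integral_cst _ measurableT) -[RHS]mule1; congr (_ * _); exact: probability_setT.
Qed.

Lemma clock_law A : measurable A -> P (T0 @^-1` A) = exponential_prob rate A.
Proof. by move=> mA; rewrite (cond_prob_root (cascade_clock H [::] mA)). Qed.

Lemma label1_law A : measurable A ->
  P (W1 @^-1` A) = \int[lebesgue_rV R n]_(eta in A) (Hker h eta xi)%:E.
Proof. by move=> mA; rewrite (cond_prob_root (cascade_density H [::] mA)). Qed.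

Lemma clock_label1_indep A B : measurable A -> measurable B ->
  P (T0 @^-1` A `&` W1 @^-1` B) = P (T0 @^-1` A) * P (W1 @^-1` B).
Proof.
move=> mA mB.
have cA := cascade_clock H [::] mA; have cB := cascade_density H [::] mB.
rewrite (cond_prob_root (cascade_clock_indep H mA mB cA cB)).
by rewrite (cond_prob_root cA) (cond_prob_root cB).
Qed.

Lemma label2E : {ae P, forall w, W2 w = (xi - W1 w)%R}.
Proof. by apply: filterS2 (cascade_root H) (cascade_split H [::]) => w W0 W2E; rewrite W0 in W2E. Qed.

Local Notation Z := (fun w => (W1 w, W2 w)).
Let mZ : measurable_fun setT Z. Proof. exact: measurable_fun_pair. Qed.

(** The second label is a function of the first, so the clock is independent of
    the pair of labels and its conditional law is constant. *)
Lemma clock_cond E : measurable E -> cond_prob P Z (T0 @^-1` E) (cst (P (T0 @^-1` E))).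
Proof.
move=> mE; split => // B mB.
have mS : measurable_fun setT (fun eta : rV => (eta, xi - eta)%R).
  by apply: measurable_fun_pair => //; exact: measurable_subr.
pose B' := (fun eta : rV => (eta, xi - eta)%R) @^-1` B.
have mB' : measurable B' by rewrite -[X in measurable X]setTI; exact: mS.
have ZB : {ae P, forall w, (Z @^-1` B) w <-> (W1 @^-1` B') w}.
  by apply: filterS label2E => w W2w; rewrite /B' /= W2w.
have mZB := meas_pre mZ mB; have mWB := meas_pre mW1 mB'; have mTE := meas_pre mT0 mE.
rewrite integral_cst// (eq_measure_ae mZB mWB ZB) -clock_label1_indep//.
apply: eq_measure_ae; [exact: measurableI|exact: measurableI|].
by apply: filterS ZB => w /= [ZB1 ZB2]; split => -[? ?]; split => //; [exact: ZB1|exact: ZB2].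
Qed.

Let cond_F A B : measurable A -> measurable B ->
  cond_prob P Z (F1 @^-1` A `&` F2 @^-1` B)
    (fun z => cascade_law (C z.1) A * cascade_law (C z.2) B).
Proof.
move=> mA mB.
exact: (cascade_branching H mA mB (cascade_restart1 H [::] mA) (cascade_restart2 H [::] mB)).
Qed.

Lemma subtrees_law A B : measurable A -> measurable B ->
  P (F1 @^-1` A `&` F2 @^-1` B) =
  \int[P]_w (fam_law (C (W1 w)) A * fam_law (C (xi - W1 w)%R) B).
Proof.
move=> mA mB; have [_ _ /(_ setT measurableT)] := cond_F mA mB.
rewrite preimage_setT setIT => ->.
by apply: integral_ae; apply: filterS label2E => w <- _.
Qed.

Local Notation F := (fun w => (F1 w, F2 w)).
Let mF : measurable_fun setT F. Proof. exact: measurable_fun_pair. Qed.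

(** Conditionally on the labels of the children, the clock is independent of the
    two subtrees, and its conditional law does not depend on these labels;
    hence the independence is unconditional. *)
Lemma clock_subtrees_indep E D : measurable E -> measurable D ->
  P (T0 @^-1` E `&` F @^-1` D) = P (T0 @^-1` E) * P (F @^-1` D).
Proof.
move=> mE mD; have mTE := meas_pre mT0 mE.
pose rF : {mfun ts_sort c >-> (Fam * Fam)%type} := HB.pack F (isMeasurableFun.Build _ _ _ _ _ mF).
pose e := fine (P (T0 @^-1` E)).
have e0 : (0 <= e)%R by rewrite /e fine_ge0.
have eE : P (T0 @^-1` E) = e%:E by rewrite /e fineK// fin_num_measure.
pose m1 := pushforward (mrestr P mTE) rF.
pose m2 := mscale (NngNum e0) (law_of P mF).
have m2E A : m2 A = P (T0 @^-1` E) * P (F @^-1` A) by rewrite /m2 /mscale /= eE.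
suff m12 : m1 D = m2 D by rewrite setIC; exact: etrans m12 (m2E D).
apply: (eq_measure_rectangles (m1 := m1) (m2 := m2)) => //.
  apply: (@le_lt_trans _ _ 1); last exact: ltry.
  by apply: probability_le1; apply: measurableI => //; exact: meas_pre.
move=> A B mA mB.
suff m12 : P (F @^-1` (A `*` B) `&` T0 @^-1` E) = P (T0 @^-1` E) * P (F @^-1` (A `*` B)).
  exact: etrans m12 (esym (m2E _)).
have cF := cond_F mA mB.
have [_ _ /(_ setT measurableT)] :=
  @cascade_clock_subtrees _ _ _ _ _ H [::] _ _ _ _ (measurableX mA mB) mE cF (clock_cond mE).
rewrite preimage_setT setIT => ->.
have [mp p0 /(_ setT measurableT)] := cF.
rewrite preimage_setT setIT => FE.
have -> : P (F @^-1` (A `*` B)) = P (F1 @^-1` A `&` F2 @^-1` B) by [].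
rewrite FE -ge0_integralZl//; first by apply: eq_integral => w _; rewrite muleC.
exact: measurableT_comp mp mZ.
Qed.

(** Given the labels of the children, the subtrees are independent cascades
    started there. As functions of [a], and then of [b], both sides are
    integrals, so indicators suffice. *)
Lemma ge0_integral_subtrees (a b : Fam -> \bar R) :
  measurable_fun setT a -> measurable_fun setT b ->
  (forall x, 0 <= a x) -> (forall x, 0 <= b x) ->
  \int[P]_w (a (F1 w) * b (F2 w)) =
  \int[P]_w ((\int[fam_law (C (W1 w))]_f a f) *
             (\int[fam_law (C (xi - W1 w)%R)]_f b f)).
Proof.
move=> ma mb a0 b0.
have mi (W : ts_sort c -> rV) : measurable_fun setT W ->
    forall U, measurable U -> measurable_fun setT (fun w => fam_law (C (W w)) U).
  by move=> mW U mU; exact: measurableT_comp (measurable_fam_law mU) mW.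
have mxW : measurable_fun setT (fun w => (xi - W1 w)%R).
  exact: measurableT_comp (measurable_subr xi) mW1.
have mib : measurable_fun setT (fun w => \int[fam_law (C (xi - W1 w)%R)]_f b f).
  by apply: measurable_fun_integral_kernel => //; exact: mi.
move: a ma a0; apply: eq_integral_like.
- apply: (integral_like_ext (I := fun a => \int[P]_w (b (F2 w) * a (F1 w)))).
    by move=> f mf f0; apply: eq_integral => w _; rewrite muleC.
  by apply: integral_like_map => //; exact: measurableT_comp mb mF2.
- apply: (integral_like_ext (I := fun a => \int[P]_w (\int[fam_law (C (xi - W1 w)%R)]_f b f *
      \int[fam_law (C (W1 w))]_f a f))).
    by move=> f mf f0; apply: eq_integral => w _; rewrite muleC.
  apply: (@integral_like_kernel _ _ _ _ _ P (fun w => \int[fam_law (C (xi - W1 w)%R)]_f b f)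
    _ _ (fun w => fam_law (C (W1 w)))) => //.
  - by move=> w; exact: integral_ge0.
  - exact: mi.
move=> A mA.
move: b mb b0 {mib}; apply: eq_integral_like.
- apply: (@integral_like_map _ _ _ _ _ P (fun w => (\1_A (F1 w))%:E)) => //.
  apply/measurable_EFinP; exact: measurableT_comp (measurable_indic mA) mF1.
- apply: (@integral_like_kernel _ _ _ _ _ P (fun w => \int[fam_law (C (W1 w))]_f (\1_A f)%:E)
   _ _ (fun w => fam_law (C (xi - W1 w)%R))).
  - by move=> w; apply: integral_ge0 => f _; rewrite lee_fin.
  - apply: measurable_fun_integral_kernel => //; first exact: mi.
    by apply/measurable_EFinP; exact: measurable_indic.
  - exact: mi.
move=> B mB.
under [RHS]eq_integral do rewrite !integral_indic// !setIT.
rewrite -subtrees_law//.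
have mI : measurable (F1 @^-1` A `&` F2 @^-1` B).
  by apply: measurableI; exact: meas_pre.
rewrite -[X in P X]setIT -integral_indic//.
by apply: eq_integral => w _; rewrite indicI -EFinM.
Qed.

(** The clock is independent of everything that happens after the first
   branching, so it can be frozen while the subtrees are averaged. *)
Lemma ge0_integral_branch (G1 G2 : Fam * R -> \bar R) t :
  measurable_fun setT G1 -> measurable_fun setT G2 ->
  (forall x, 0 <= G1 x) -> (forall x, 0 <= G2 x) ->
  \int[P]_w (if (T0 w < t)%R then G1 (F1 w, t - T0 w)%R * G2 (F2 w, t - T0 w)%R else 0) =
  \int[P]_w (if (T0 w < t)%R then mean G1 (W1 w) (t - T0 w)%R *
                                  mean G2 (xi - W1 w)%R (t - T0 w)%R else 0).
Proof.
move=> mG1 mG2 G10 G20.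
have mt (S : measurableType _) (f : S -> R) : measurable_fun setT f ->
    measurable_fun setT (fun s => (f s < t)%R).
  by move=> mf; exact: measurable_fun_ltr.
pose f1 (z : R * (Fam * Fam)) := if (z.1 < t)%R then
  G1 (z.2.1, t - z.1)%R * G2 (z.2.2, t - z.1)%R else 0.
have mf1 : measurable_fun setT f1.
  apply: measurable_fun_ifT => //; first exact: measurable_fun_ltr.
  apply: emeasurable_funM; [apply: measurableT_comp mG1 _|apply: measurableT_comp mG2 _];
    apply: measurable_fun_pair; [|exact: measurable_funB| |exact: measurable_funB].
    exact: measurableT_comp measurable_fst measurable_snd.
  exact: measurableT_comp measurable_snd measurable_snd.
have f10 z : 0 <= f1 z by rewrite /f1; case: ifP => // _; rewrite mule_ge0.
pose f2 (z : R * rV) := if (z.1 < t)%R then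
  mean G1 z.2 (t - z.1)%R * mean G2 (xi - z.2)%R (t - z.1)%R else 0.
have mf2 : measurable_fun setT f2.
  apply: measurable_fun_ifT => //; first exact: measurable_fun_ltr.
  apply: emeasurable_funM.
    apply: (measurableT_comp (measurable_mean mG1 G10) (g := fun z : R * rV => (z.2, t - z.1)%R)).
    by apply: measurable_fun_pair => //; exact: measurable_funB.
  apply: (measurableT_comp (measurable_mean mG2 G20) (g := fun z : R * rV => (xi - z.2, t - z.1)%R)).
  apply: measurable_fun_pair; last exact: measurable_funB.
  exact: measurableT_comp (measurable_subr xi) measurable_snd.
have f20 z : 0 <= f2 z.
  by rewrite /f2; case: ifP => // _; rewrite mule_ge0//; exact: mean_ge0.
transitivity (\int[P]_w \int[P]_w' f1 (T0 w, F w')).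
  exact: (ge0_integral_indep mT0 mF clock_subtrees_indep mf1 f10).
transitivity (\int[P]_w \int[P]_w' f2 (T0 w, W1 w')); last first.
  by apply/esym; exact: (ge0_integral_indep mT0 mW1 clock_label1_indep mf2 f20).
apply: eq_integral => w _; rewrite /f1 /f2 /=.
case: (T0 w < t)%R => //; apply: ge0_integral_subtrees => //.
  exact: measurableT_comp mG1 (measurable_pair2 _).
exact: measurableT_comp mG2 (measurable_pair2 _).
Qed.

Context (h_gt0 : forall x, (0 < h x)%R) (mh : measurable_fun setT h).

Lemma Hker_ge0 eta : (0 <= Hker h eta xi)%R.
Proof. by rewrite /Hker divr_ge0 ?mulr_ge0 ?enorm_ge0 ?ltW. Qed.

Lemma measurable_Hker : measurable_fun setT (Hker h ^~ xi).
Proof.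
apply: measurable_funM => //; apply: measurable_funM => //.
exact: measurableT_comp mh (measurable_subr xi).
Qed.

Lemma ge0_integral_clock_label (f : R * rV -> \bar R) :
  measurable_fun setT f -> (forall z, 0 <= f z) ->
  \int[P]_w f (T0 w, W1 w) =
  \int[lebesgue_measure]_s ((exponential_pdf rate s)%:E *
    \int[lebesgue_rV R n]_eta ((Hker h eta xi)%:E * f (s, eta))).
Proof.
move=> mf f0.
rewrite (ge0_integral_indep mT0 mW1 clock_label1_indep mf f0).
have mW s : \int[P]_w f (s, W1 w) =
    \int[lebesgue_rV R n]_eta ((Hker h eta xi)%:E * f (s, eta)).
  have mfs : measurable_fun setT (fun eta => f (s, eta)).
    exact: measurableT_comp mf (measurable_pair1 _).
  transitivity (\int[law_of P mW1]_eta f (s, eta)); first by rewrite ge0_integral_law_of.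
  apply: ge0_integral_density => //.
  - by move=> eta; rewrite lee_fin Hker_ge0.
  - by apply/measurable_EFinP; exact: measurable_Hker.
  - by move=> A mA; exact: label1_law.
under eq_integral do rewrite mW.
pose g s := \int[lebesgue_rV R n]_eta ((Hker h eta xi)%:E * f (s, eta)).
have mg : measurable_fun setT g.
  apply: (@measurable_fun_fubini_tonelli_F _ _ _ _ _ _ (fun z => (Hker h z.2 xi)%:E * f z)).
    apply: emeasurable_funM => //; apply/measurable_EFinP.
    exact: measurableT_comp measurable_Hker measurable_snd.
  by move=> z; rewrite mule_ge0// lee_fin Hker_ge0.
have g0 s : 0 <= g s.
  by apply: integral_ge0 => eta _; rewrite mule_ge0// lee_fin Hker_ge0.
have mT0' : measurable_fun setT (T0 : ts_sort c -> measurableTypeR R) by exact: mT0.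
have mg' : measurable_fun [set: measurableTypeR R] g by exact: mg.
transitivity (\int[law_of P mT0']_s g s); first by rewrite (ge0_integral_law_of P mT0' mg' g0).
apply: (@ge0_integral_density _ _ _ (law_of P mT0') (@lebesgue_measure R)
  (fun s => (exponential_pdf rate s)%:E) _ _ _ g) => //.
- by move=> s; rewrite lee_fin exponential_pdf_ge0// sqr_ge0.
- by apply/measurable_EFinP; exact: measurable_exponential_pdf.
- by move=> A mA; exact: clock_law.
Qed.

End root.
End cascade_law.

(** * Explosion and the one-step equation *)

Lemma ae_forall_countable d (T : measurableType d) (R : realType)
    (mu : {measure set T -> \bar R}) (I : countType) (Q : I -> T -> Prop) :
  (forall i, {ae mu, forall x, Q i x}) -> {ae mu, forall x, forall i, Q i x}.
Proof.
move=> H.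
have : {ae mu, forall x, forall k : nat, forall i, unpickle k = Some i -> Q i x}.
  apply: ae_foralln => k; case: (@unpickle I k) => [i|]; last exact: aeW.
  by apply: filterS (H i) => x Qx j [<-].
by apply: filterS => x Hx i; apply: (Hx (pickle i)); rewrite pickleK.
Qed.

(** Termination only bounds the path sums of a late generation from below by
    [t]; the strict inequality comes from the absence of a path sum equal to
    [t]. *)
Lemma tree_value_explosion (R : realType) (T : vertex -> R) (V : Type) leaf node t (x : V) :
  (forall u, 0 <= T u) -> (forall u, path_sum T [::] u != t) ->
  tree_value T leaf node [::] t x ->
  (t%:E < ereal_sup [set \big[Order.min/+oo]_(v : k.-tuple bool)
                    \sum_(j < k.+1) (T (take j v))%:E | k in [set: nat]])%E.
Proof.
move=> T0 Tt /(tree_value_path_sum T0)[k Hk].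
apply/ereal_sup_gtP; exists (\big[Order.min/+oo%E]_(v : k.-tuple bool)
                    \sum_(j < k.+1) (T (take j v))%:E)%E; first by exists k.
apply/bigmin_gtP; split; first exact: ltry.
move=> v _; rewrite sumEFin lte_fin.
have := path_sumE T v; rewrite size_tuple => <-.
by rewrite lt_def Tt Hk// size_tuple.
Qed.

Section scalar.
Context (R : realType) (n : nat).
Local Notation rV := ('rV[R]_n).
Local Notation Fam := (family_of vertex (rV * R)%type).
Local Open Scope ereal_scope.
Context (h : rV -> R) (C : rV -> tree_space R n).
Context (hC : forall xi, xi != 0%R -> is_cascade h C xi).
Context (n_gt0 : (0 < n)%N).

(** The integrand evaluates [f] and [g] at the origin only when [eta] is 0 or
    [xi], which is a null set. *)
Lemma B_nFMS_ext (f f' g g' : rV -> R -> \bar R) xi t :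
  (forall eta s, eta != 0%R -> (0 <= s)%R -> f eta s = f' eta s) ->
  (forall eta s, eta != 0%R -> (0 <= s)%R -> g eta s = g' eta s) ->
  B_nFMS h f g xi t = B_nFMS h f' g' xi t.
Proof.
move=> ff gg; apply: eq_integral => s /set_mem; rewrite /= in_itv/= => /andP[s0 st].
congr (_ * _); apply: (integral_off_null (N := [set 0%R; xi])).
- by apply: measurableU; exact: measurable_row1.
- have null x : lebesgue_rV R n [set x] = 0 by exact: lebesgue_rV1.
  by apply: etrans (measureU0 _ _ (null xi)) (null 0%R); exact: measurable_row1.
- move=> eta _ Neta; rewrite ff ?gg ?subr_ge0//; apply/eqP => e; apply: Neta; [right|left].
    by apply/eqP; rewrite eq_sym -subr_eq0; apply/eqP.
  exact: e.
Qed.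

Context (h_gt0 : forall x, (0 < h x)%R) (mh : measurable_fun setT h).

Section root.
Context (xi : rV) (xi0 : xi != 0%R).
Local Notation c := (C xi).
Local Notation P := (ts_P (C xi)).
Local Notation T0 := (ts_T (C xi) [::]).
Local Notation W1 := (ts_W (C xi) [:: false]).
Local Notation F1 := (sub_cascade (C xi) [:: false]).
Local Notation F2 := (sub_cascade (C xi) [:: true]).
Local Notation F := (fun w => (F1 w, F2 w)).
Let H : is_cascade h C xi := hC xi0.
Local Notation rate := (enorm xi ^+ 2)%R.

Let mT0 : measurable_fun setT T0. Proof. exact: ts_measurable_T. Qed.
Let mW1 : measurable_fun setT W1. Proof. exact: ts_measurable_W. Qed.
Let mF : measurable_fun setT F.
Proof. by apply: measurable_fun_pair; exact: measurable_sub_cascade. Qed.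

Lemma clocks_ge0 : {ae P, forall w, forall v, (0 <= ts_T c v w)%R}.
Proof.
apply: ae_forall_countable => v.
have mneg : measurable [set x : R | (x < 0)%R].
  rewrite (_ : [set x | _] = [set` Interval -oo%O (BLeft (0 : R)%R)]).
    exact: measurable_itv.
  by apply/seteqP; split => x /=; rewrite in_itv.
have [mp p0 /(_ setT measurableT)] := cascade_clock H v mneg.
rewrite preimage_setT setIT => PE.
exists (ts_T c v @^-1` [set x : R | (x < 0)%R]); split.
- by rewrite -[X in measurable X]setTI; exact: ts_measurable_T.
- apply: etrans PE _; apply: integral0_eq => w _; apply: integral0_eq => x /= x0.
  by rewrite lt0_exponential_pdf.
- by move=> w /= /negP; rewrite -ltNge.
Qed.

Lemma path_sum_shift (T : vertex -> R) b v u :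
  path_sum T (b :: v) u = path_sum (fun v => T (b :: v)) v u.
Proof. by elim: u v => //= b' u IH v; rewrite IH. Qed.

Lemma clock_atomless x : P (T0 @^-1` [set x]) = 0.
Proof.
rewrite (clock_law hC xi0); last exact: measurable_set1.
exact: integral_set1.
Qed.

(** A path sum is the root clock, which has no atoms, plus a quantity that
    depends only on the subtrees and is therefore independent of it. *)
Lemma path_sum_neq t : {ae P, forall w, forall u, path_sum (ts_T c ^~ w) [::] u != t}.
Proof.
apply: ae_forall_countable => u.
pose r (p : Fam * Fam) : R := if u is b :: u' then
  path_sum (fun v => fam_clock v (if b then p.2 else p.1)) [::] u' else 0%R.
have mps (g : Fam * Fam -> Fam) v u' : measurable_fun setT g ->
    measurable_fun setT (fun p => path_sum (fun v => fam_clock v (g p)) v u').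
  move=> mg; have mc v' := measurableT_comp (measurable_fam_clock v') mg.
  by elim: u' v => [|b u' IH] v /=; apply: measurable_funD; rewrite ?IH//; exact: mc.
have mr : measurable_fun setT r.
  rewrite /r; case: u {r} => [|b u']; first exact: measurable_cst.
  by case: b; [exact: (mps snd)|exact: (mps fst)].
pose f (z : (Fam * Fam) * R) : \bar R := (\1_[set t] (z.2 + r z.1)%R)%:E.
have mf : measurable_fun setT f.
  apply/measurable_EFinP; apply: measurableT_comp.
    exact: measurable_indic.
  by apply: measurable_funD => //; exact: measurableT_comp mr measurable_fst.
have f0 z : 0 <= f z by rewrite lee_fin.
have indep A B : measurable A -> measurable B ->
    P (F @^-1` A `&` T0 @^-1` B) = P (F @^-1` A) * P (T0 @^-1` B).
  by move=> mA mB; rewrite setIC (clock_subtrees_indep hC xi0)// muleC.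
have Ef : \int[P]_w f (F w, T0 w) = 0.
  rewrite (ge0_integral_indep mF mT0 indep mf f0); apply: integral0_eq => w _.
  rewrite -[RHS](clock_atomless (t - r (F w))%R) -[X in P X]setIT -integral_indic//; last first.
    by rewrite -[X in measurable X]setTI; exact: mT0.
  apply: eq_integral => w' _; rewrite /f /= !indicE; congr ((nat_of_bool _)%:R)%:E.
  apply/idP/idP => /set_mem /= e; apply/mem_set => /=; first by rewrite -e; ring.
  by rewrite e; ring.
have mfF : measurable_fun setT (fun w => f (F w, T0 w)).
  by apply: (measurableT_comp mf); exact: measurable_fun_pair.
have : \int[P]_w `|f (F w, T0 w)| = 0.
  by rewrite -[RHS]Ef; apply: eq_integral => w _; rewrite gee0_abs.
move=> /(ae_eq_integral_abs P measurableT mfF).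
apply: filterS => w /(_ I) /=; rewrite /f indicE => fE; apply/eqP => pE.
have e : (T0 w + r (F w))%R = t.
  rewrite -pE /r; case: u {mr mf f0 Ef mfF f fE r} pE => [|b u'] //= _.
  by rewrite path_sum_shift; case: b.
by move: fE; rewrite e mem_set//= => -[] /eqP; rewrite oner_eq0.
Qed.

(** Almost surely the recursion terminates only before the explosion time;
    hence the processes restricted to [zeta > t] are, up to null sets, the
    values of the recursion with the convention that non-termination gives
    0. *)
Lemma explosion_ae t : {ae P, forall w (V : Type) leaf node (x : V),
  tree_value (ts_T c ^~ w) leaf node [::] t x -> t%:E < explosion_time w}.
Proof.
apply: filterS2 clocks_ge0 (path_sum_neq t) => w w0 wt V leaf node x.
exact: tree_value_explosion.
Qed.

Lemma liveY_ae psi0 t : {ae P, forall w,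
  liveY psi0 t w = valY psi0 (sub_cascade c [::] w, t)}.
Proof.
apply: filterS (explosion_ae t) => w wt; rewrite /liveY.
case: ifPn => // tz; apply/esym/tree_val_none => -[x tx].
by move/negP: tz; apply; exact: wt tx.
Qed.

Lemma minimal_solutionE psi0 t : measurable_fun setT psi0 -> (forall x, 0 <= psi0 x) ->
  minimal_solution C psi0 xi t = mean C (valY psi0) xi t.
Proof.
move=> mpsi0 psi00; rewrite /mean ge0_integral_fam_law.
- by apply: integral_ae; apply: filterS (liveY_ae psi0 t) => w -> _.
- exact: measurableT_comp (measurable_valY mpsi0) (measurable_pair2 _).
- by move=> f; exact: valY_ge0.
Qed.

Lemma clock_tail t : (0 <= t)%R ->
  P (T0 @^-1` [set s | (t <= s)%R]) = (expR (- t * rate))%:E.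
Proof.
move=> t0.
have mge : measurable [set s : R | (t <= s)%R].
  rewrite (_ : [set s | _] = [set` Interval (BLeft t) +oo%O]); first exact: measurable_itv.
  by apply/seteqP; split => x /=; rewrite in_itv/= andbT.
have mlt : measurable (~` [set s : R | (t <= s)%R]) by exact: measurableC.
have -> : T0 @^-1` [set s | (t <= s)%R] = ~` (T0 @^-1` (~` [set s | (t <= s)%R])).
  by rewrite preimage_setC setCK.
rewrite probability_setC; last by rewrite -[X in measurable X]setTI; exact: mT0.
rewrite (clock_law hC xi0)//.
have -> : exponential_prob rate (~` [set s | (t <= s)%R]) = exponential_prob rate `[0%R, t].
  rewrite /exponential_prob integral_mkcond [RHS]integral_mkcond.
  apply: (@integral_off_null _ _ R (@lebesgue_measure R) [set t]) => //.
  - exact: lebesgue_measure_set1.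
  - move=> s _ st; rewrite !patchE.
    have [s0|s0] := ltP s 0%R; first by rewrite !lt0_exponential_pdf// !if_same.
    congr (if _ then _ else _); apply/idP/idP => /set_mem /=.
      by move=> /negP; rewrite -ltNge => /ltW ts; apply/mem_set; rewrite /= in_itv/= s0.
    rewrite in_itv/= s0/= => ts; apply/mem_set => /= ts'; apply: st.
    by apply/eqP; rewrite eq_le ts ts'.
have [->|tn0] := eqVneq t 0%R.
  by rewrite set_itv1 /exponential_prob integral_set1 sube0 oppr0 mul0r expR0.
rewrite exponential_prob_itv0c ?lt_def ?tn0//.
by rewrite -!EFinB opprB addrC subrK mulNr mulrC mulNr.
Qed.

(** The first term comes from a root clock beyond [t]; otherwise the branching
    formula replaces the two subtrees by their means and the density of the
    clock and of the first label produces the double integral. *)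
Lemma nFMS_step psi0 (G : Fam * R -> \bar R) t :
  measurable_fun setT psi0 -> (forall x, 0 <= psi0 x) ->
  measurable_fun setT G -> (forall p, 0 <= G p) -> (0 <= t)%R ->
  mean C (fam_step psi0 (fun _ a b => a * b) G) xi t =
  U_nFMS psi0 xi t + B_nFMS h (mean C G) (mean C G) xi t.
Proof.
move=> mpsi0 psi00 mG G0 t0.
have mstep : measurable_fun setT (fam_step psi0 (fun _ a b => a * b) G).
  apply: measurable_fun_ifT; first exact: measurable_clock_test.
    apply: measurableT_comp => //.
    exact: measurableT_comp (measurable_fam_label [::]) measurable_fst.
  have ms b : measurable_fun setT (fun p : Fam * R =>
      (shift b p.1, p.2 - fam_clock [::] p.1)%R).
    apply: measurable_fun_pair.
      exact: measurableT_comp (measurable_shift b) measurable_fst.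
    exact: measurableT_comp measurable_snd (measurable_clock_sub [::]).
  by apply: emeasurable_funM; exact: measurableT_comp mG (ms _).
have step0 p : 0 <= fam_step psi0 (fun _ a b => a * b) G p.
  by rewrite /fam_step; case: ifP => // _; rewrite mule_ge0.
rewrite /mean ge0_integral_fam_law//; last exact: measurableT_comp mstep (measurable_pair2 _).
transitivity (\int[P]_w (psi0 xi * (\1_[set s | (t <= s)%R] (T0 w))%:E +
   (if (T0 w < t)%R then G (F1 w, t - T0 w)%R * G (F2 w, t - T0 w)%R else 0))).
  apply: integral_ae; apply: filterS (cascade_root H) => w W0 _.
  rewrite /fam_step /fam_clock /fam_label /= W0 indicE.
  have [tT|tT] := leP t (T0 w); first by rewrite mem_set// mule1 adde0.
  by rewrite memNset ?mule0 ?add0e//= leNgt tT.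
have mge : measurable [set s : R | (t <= s)%R].
  rewrite (_ : [set s | _] = [set` Interval (BLeft t) +oo%O]); first exact: measurable_itv.
  by apply/seteqP; split => x /=; rewrite in_itv/= andbT.
have m1 : measurable_fun setT (fun w => (\1_[set s | (t <= s)%R] (T0 w))%:E : \bar R).
  apply/measurable_EFinP; exact: measurableT_comp (measurable_indic mge) mT0.
have mGF (V : ts_sort c -> Fam) : measurable_fun setT V ->
    measurable_fun setT (fun w => G (V w, t - T0 w)%R).
  move=> mV; apply: (measurableT_comp mG); apply: measurable_fun_pair => //.
  exact: measurable_funB.
rewrite ge0_integralD//; first last.
- apply: measurable_fun_ifT => //; first exact: measurable_fun_ltr.
  by apply: emeasurable_funM; apply: mGF => //; exact: measurable_sub_cascade.
- by move=> w _; case: ifP => // _; rewrite mule_ge0.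
- exact: emeasurable_funM.
- by move=> w _; rewrite mule_ge0// lee_fin.
congr (_ + _).
  rewrite ge0_integralZl// /U_nFMS muleC; congr (_ * _).
  rewrite -(clock_tail t0) -[X in P X]setIT -integral_indic//.
  by rewrite -[X in measurable X]setTI; exact: mT0.
rewrite (ge0_integral_branch hC n_gt0 xi0)//.
pose f (z : R * rV) := if (z.1 < t)%R then
  mean C G z.2 (t - z.1)%R * mean C G (xi - z.2)%R (t - z.1)%R else 0.
have mm := measurable_mean hC n_gt0 mG G0.
have mf : measurable_fun setT f.
  apply: measurable_fun_ifT => //; first exact: measurable_fun_ltr.
  apply: emeasurable_funM.
    apply: (measurableT_comp mm (g := fun z : R * rV => (z.2, t - z.1)%R)).
    by apply: measurable_fun_pair => //; exact: measurable_funB.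
  apply: (measurableT_comp mm (g := fun z : R * rV => (xi - z.2, t - z.1)%R)).
  apply: measurable_fun_pair; last exact: measurable_funB.
  exact: measurableT_comp (measurable_subr xi) measurable_snd.
have f0 z : 0 <= f z.
  by rewrite /f; case: ifP => // _; rewrite mule_ge0//; exact: mean_ge0.
rewrite (ge0_integral_clock_label hC xi0 h_gt0 mh mf f0).
(* the density of the clock vanishes at negative times and [f] at times s >= t;
   only s = t belongs to the closed interval without contributing *)
rewrite /B_nFMS [RHS]integral_mkcond.
apply: (@integral_off_null _ _ R (@lebesgue_measure R) [set t]) => //.
- exact: lebesgue_measure_set1.
move=> s _ /eqP st; rewrite patchE.
have [s0|s0] := ltP s 0%R.
  by rewrite lt0_exponential_pdf// mul0e memNset//= in_itv/= leNgt s0.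
have [ts|ts] := ltP t s.
  rewrite memNset//=; last by rewrite in_itv/= s0/= leNgt ts.
  by rewrite integral0_eq ?mule0// => eta _; rewrite /f /= ltNge (ltW ts) mule0.
rewrite mem_set/=; last by rewrite in_itv/= s0.
rewrite exponential_pdfE//; congr (_ * _).
  by congr EFin; rewrite mulrC; congr (expR _ * _)%R; ring.
by apply: eq_integral => eta _; rewrite /f /= lt_def eq_sym st ts/= muleC.
Qed.

End root.
End scalar.

(** * The scalar solution *)

Section psi.
Context (R : realType) (n : nat).
Local Notation rV := ('rV[R]_n).
Local Notation Fam := (family_of vertex (rV * R)%type).
Local Open Scope ereal_scope.
Context (h : rV -> R) (C : rV -> tree_space R n).
Context (hC : forall xi, xi != 0%R -> is_cascade h C xi).
Context (n_gt0 : (0 < n)%N).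
Context (h_gt0 : forall x, (0 < h x)%R) (mh : measurable_fun setT h).
Context (psi0 : rV -> \bar R) (mpsi0 : measurable_fun setT psi0)
  (psi0_ge0 : forall x, 0 <= psi0 x).

Local Notation Psi := (mean C (valY psi0)).

(** One Picard step adds one generation to the truncated recursion. *)
Lemma picard_mean k xi t : xi != 0%R -> (0 <= t)%R ->
  picard_nFMS h psi0 k xi t = mean C (approxY psi0 k) xi t.
Proof.
elim: k xi t => [|k IH] xi t xi0 t0.
  by rewrite /= /mean /approxY integral0_eq.
rewrite approxYS; apply/esym.
apply: etrans (nFMS_step hC n_gt0 h_gt0 mh xi0 mpsi0 psi0_ge0
  (measurable_approxY mpsi0 k) (fun p => approxY_ge0 psi0_ge0 k p) t0) _.
apply: (congr1 (fun z => U_nFMS psi0 xi t + z)).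
by apply: (B_nFMS_ext h n_gt0) => eta s eta0 s0; apply/esym; exact: IH.
Qed.

Lemma Psi_ge0 xi t : 0 <= Psi xi t.
Proof. by apply: mean_ge0 => p; exact: valY_ge0. Qed.

Lemma measurable_Psi : measurable_fun setT (fun x : rV * R => Psi x.1 x.2).
Proof.
by apply: (measurable_mean hC) => //; [exact: measurable_valY|move=> p; exact: valY_ge0].
Qed.

Lemma Psi_nFMS xi t : xi != 0%R -> (0 <= t)%R ->
  Psi xi t = U_nFMS psi0 xi t + B_nFMS h Psi Psi xi t.
Proof.
move=> xi0 t0; rewrite {1}valY_step (nFMS_step hC n_gt0 h_gt0 mh xi0)//.
  exact: measurable_valY.
by move=> p; exact: valY_ge0.
Qed.

(** Nonnegative truncations increase with the depth and are eventually equal to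
    the value, so monotone convergence applies. *)
Lemma mean_approxY_cvg xi t : (fun k => mean C (approxY psi0 k) xi t) @ \oo --> Psi xi t.
Proof.
rewrite /mean; have -> : \int[fam_law (C xi)]_f valY psi0 (f, t) =
    \int[fam_law (C xi)]_f limn (fun k => approxY psi0 k (f, t)).
  apply: eq_integral => f _; apply/esym/cvg_lim => //; apply: cvg_near_cst.
  exact: approxY_near.
apply: cvg_monotone_convergence => //.
- by move=> k; exact: measurableT_comp (measurable_approxY mpsi0 k) (measurable_pair2 _).
- by move=> k f _; exact: approxY_ge0.
- by move=> f _; exact: approxY_le.
Qed.

Lemma picard_cvg xi t : xi != 0%R -> (0 <= t)%R ->
  picard_nFMS h psi0 k xi t @[k --> \oo] --> Psi xi t.
Proof.
move=> xi0 t0; have -> : (fun k => picard_nFMS h psi0 k xi t) =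
    fun k => mean C (approxY psi0 k) xi t.
  by apply/funext => k; exact: picard_mean.
exact: mean_approxY_cvg.
Qed.

(** Multiply the equation by [expR (t * enorm xi ^+ 2)] and reflect the time
    integral: the result is the initial value plus the integral over [0, t] of
    a nonnegative function that does not depend on [t]. *)
Lemma Psi_mono xi s t : xi != 0%R -> (0 <= s)%R -> (s <= t)%R ->
  (expR (s * enorm xi ^+ 2))%:E * Psi xi s <= (expR (t * enorm xi ^+ 2))%:E * Psi xi t.
Proof.
move=> xi0 s0 st; set r := (enorm xi ^+ 2)%R.
pose J u := \int[lebesgue_rV R n]_eta (Psi eta u * Psi (xi - eta)%R u * (Hker h eta xi)%:E).
have J0 u : 0 <= J u.
  apply: integral_ge0 => eta _; rewrite mule_ge0 ?mule_ge0 ?Psi_ge0//.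
  by rewrite lee_fin Hker_ge0.
have mJ : measurable_fun setT J.
  have H0 z : 0 <= Psi z.2 z.1 * Psi (xi - z.2)%R z.1 * (Hker h z.2 xi)%:E.
    by rewrite mule_ge0 ?mule_ge0 ?Psi_ge0// lee_fin Hker_ge0.
  apply: (@measurable_fun_fubini_tonelli_F _ _ R rV R (lebesgue_rV R n)
    (fun z => Psi z.2 z.1 * Psi (xi - z.2)%R z.1 * (Hker h z.2 xi)%:E) _ H0).
  apply: emeasurable_funM; first apply: emeasurable_funM.
  - apply: (measurableT_comp measurable_Psi (g := fun z : R * rV => (z.2, z.1))).
    exact: measurable_fun_pair.
  - apply: (measurableT_comp measurable_Psi (g := fun z : R * rV => (xi - z.2, z.1)%R)).
    apply: measurable_fun_pair => //.
    exact: measurableT_comp (measurable_subr xi) measurable_snd.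
  - apply/measurable_EFinP.
    exact: measurableT_comp (measurable_Hker xi mh) measurable_snd.
pose k u := (expR (u * r) * r)%:E * J u.
have k0 u : 0 <= k u by rewrite mule_ge0// lee_fin mulr_ge0 ?expR_ge0 ?sqr_ge0.
have mk : measurable_fun setT k.
  apply: emeasurable_funM => //; apply/measurable_EFinP; apply: measurable_funM => //.
  by apply: measurableT_comp => //; exact: measurable_funM.
have key u : (0 <= u)%R -> (expR (u * r))%:E * Psi xi u =
    psi0 xi + \int[lebesgue_measure]_(v in `[0%R, u]) k v.
  move=> u0; rewrite Psi_nFMS// ge0_muleDr; last 2 first.
  - by rewrite /U_nFMS mule_ge0// lee_fin expR_ge0.
  - apply: integral_ge0 => v /= _; rewrite mule_ge0//; last exact: J0.
    by rewrite lee_fin mulr_ge0 ?expR_ge0 ?sqr_ge0.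
  congr (_ + _).
    by rewrite /U_nFMS muleA -EFinM -expRD mulNr addrN expR0 mul1e.
  have mJu : measurable_fun setT (fun v : R => J (u - v)%R).
    by apply: (measurableT_comp mJ); exact: measurable_funB.
  apply: (etrans _ (ge0_integral_reflect u mk k0)); rewrite /B_nFMS -ge0_integralZl//.
  - apply: eq_integral => v _; rewrite muleA -EFinM /k /J; congr (_%:E * _).
    by rewrite mulrA -expRD; congr (expR _ * _)%R; rewrite -/r; ring.
  - apply: measurable_funTS; apply: emeasurable_funM.
      apply/measurable_EFinP; apply: measurable_funM => //.
      by apply: measurableT_comp => //; apply: measurable_funM => //; exact: measurableT_comp.
    exact: mJu.
  - move=> v _; rewrite mule_ge0//; last exact: J0.
    by rewrite lee_fin mulr_ge0 ?expR_ge0 ?sqr_ge0.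
rewrite !key//; last exact: le_trans st.
rewrite leeD2l// ge0_subset_integral//.
- exact: measurable_funTS.
- by apply: subset_itvl; rewrite bnd_simp.
Qed.

End psi.

Section scalar_statements.
Context (R : realType) (n : nat).
Local Notation rV := ('rV[R]_n).
Local Open Scope ereal_scope.
Context (h : rV -> R) (C : rV -> tree_space R n).
Context (hC : forall xi, xi != 0%R -> is_cascade h C xi).
Context (n_gt0 : (0 < n)%N).

Lemma minimal_solution_le (phi0 gamma0 : rV -> \bar R) xi t :
  measurable_fun setT phi0 -> measurable_fun setT gamma0 ->
  (forall x, 0 <= phi0 x) -> (forall x, 0 <= gamma0 x) ->
  (forall x, phi0 x <= gamma0 x) -> xi != 0%R ->
  minimal_solution C phi0 xi t <= minimal_solution C gamma0 xi t.
Proof.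
move=> mp mg p0 g0 pg xi0; rewrite !(minimal_solutionE hC)//.
apply: ge0_le_integral => //.
- by move=> f _; exact: valY_ge0.
- exact: measurableT_comp (measurable_valY mp) (measurable_pair2 _).
- exact: measurableT_comp (measurable_valY mg) (measurable_pair2 _).
- by move=> f _; exact: valY_le.
Qed.

End scalar_statements.

(** * Averaging out the thinning *)

Section countable_valued.
Context d (D : measurableType d) (I : countType).

(** A selection among countably many measurable functions is measurable as soon
    as the levels of the selector are. It is used with the list of internal
    vertices as selector, a type without a sigma-algebra. *)
Definition measurable_levels (S : D -> I) := forall i, measurable (S @^-1` [set i]).

Lemma measurable_countable_select d' (T : measurableType d') (S : D -> I)
    (g : I -> D -> T) : measurable_levels S ->
  (forall i, measurable_fun setT (g i)) -> measurable_fun setT (fun x => g (S x) x).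
Proof.
move=> mS mg _ Y mY; rewrite setTI.
rewrite (_ : _ @^-1` Y = \bigcup_k
  (if @unpickle I k is Some i then S @^-1` [set i] `&` g i @^-1` Y else set0)).
  apply: bigcupT_measurable => k; case: unpickle => [i|]; last exact: measurable0.
  by apply: measurableI => //; rewrite -[X in measurable X]setTI; exact: mg.
apply/seteqP; split => x /=.
  by move=> Yx; exists (pickle (S x)) => //; rewrite pickleK.
by move=> [k _]; case: unpickle => [i|//] [/= -> ?].
Qed.

Lemma measurable_levelsP (S : D -> I) :
  (forall i, measurable_fun setT (fun x => S x == i)) -> measurable_levels S.
Proof.
move=> mS i; have := mS i measurableT [set true]; rewrite setTI => /(_ _).
rewrite (_ : S @^-1` [set i] = (fun x => S x == i) @^-1` [set true]); first exact.
by apply/seteqP; split => x /=; [move=> ->; rewrite eqxx|move=> /eqP].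
Qed.

End countable_valued.

Section internal_measurable.
Context (R : realType) (n : nat).
Local Notation rV := ('rV[R]_n).
Local Notation Fam := (family_of vertex (rV * R)%type).

Definition fam_internal (p : Fam * R) : option (seq vertex) :=
  internal (fun v => fam_clock v p.1) [::] p.2.

Let truncS k v (p : Fam * R) : option (seq vertex) :=
  trunc None (fun v => fam_clock v p.1) (fun=> Some [::]) inode k v p.2.

Let truncS_levels k v : measurable_levels (truncS k v).
Proof.
elim: k v => [|k IH] v; apply: measurable_levelsP => o; first exact: measurable_cst.
rewrite (_ : (fun p => _) = fun p => if p.2 <= fam_clock v p.1 then Some [::] == o
   else inode v (truncS k (child1 v) (p.1, p.2 - fam_clock v p.1))
          (truncS k (child2 v) (p.1, p.2 - fam_clock v p.1)) == o); last first.
  by apply/funext => p; rewrite /truncS /=; case: ifP.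
apply: measurable_fun_ifT; [exact: measurable_clock_test|exact: measurable_cst|].
have lv u : measurable_levels (fun p : Fam * R => truncS k u (p.1, p.2 - fam_clock v p.1)).
  by move=> o'; have := @measurable_clock_sub R n v measurableT _ (IH u o'); rewrite setTI.
apply: (measurable_countable_select (S := fun p : Fam * R =>
  truncS k (child1 v) (p.1, p.2 - fam_clock v p.1)) (g := fun a p => inode v a
    (truncS k (child2 v) (p.1, p.2 - fam_clock v p.1)) == o)) => // a.
apply: (measurable_countable_select (S := fun p : Fam * R =>
  truncS k (child2 v) (p.1, p.2 - fam_clock v p.1)) (g := fun b _ => inode v a b == o)) => // b.
Qed.

Lemma fam_internal_levels : measurable_levels fam_internal.
Proof.
move=> o; rewrite (_ : _ @^-1` _ = \bigcup_m \bigcap_(k in [set k | (m <= k)%N])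
    (truncS k [::] @^-1` [set o])).
  apply: bigcupT_measurable => m; apply: bigcap_measurableType => k _; exact: truncS_levels.
apply/seteqP; split => p /=; have [m Hm] := @trunc_near R _ None
    (fun v => fam_clock v p.1) (fun=> Some [::]) inode inode_absorbing [::] p.2.
  by move=> po; exists m => // k /= mk; rewrite -po /fam_internal /internal -(Hm k).
move=> [m' _ H]; have := H (maxn m m') (leq_maxr _ _); rewrite /= /truncS Hm ?leq_maxl//.
Qed.

Lemma fam_internal_none p : fam_internal p = None ->
  forall (V : Type) leaf node, ~ exists x : V, tree_value (fun v => fam_clock v p.1) leaf node [::] p.2 x.
Proof.
move=> pN V leaf node [x tx]; have [L iL] := tree_value_internal tx.
by move: pN; rewrite /fam_internal /internal (tree_valE _ iL).
Qed.

End internal_measurable.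

Section thinning_expectation.
Context (R : realType) (n : nat).
Local Notation rV := ('rV[R]_n).
Local Notation Fam := (family_of vertex (rV * R)%type).
Local Open Scope ereal_scope.
Context (h : rV -> R) (C : rV -> tree_space R n).
Context (hC : forall xi, xi != 0%R -> is_cascade h C xi).
Context (xi : rV) (xi0 : xi != 0%R).
Local Notation c := (C xi).
Local Notation P := (ts_P (C xi)).
Let H : is_cascade h C xi := hC xi0.

Definition fam_weight t (f : Fam) (k : family_of vertex bool) : nat :=
  if fam_internal (f, t) is Some L then weight k L else 0%N.

Lemma procYbarE (psi0 : rV -> \bar R) t (w : ts_sort c) :
  procYbar psi0 t w = (fam_weight t (sub_cascade c [::] w) (thinning c w))%:R%:E *
    valY psi0 (sub_cascade c [::] w, t).
Proof.
rewrite /procYbar (@thinned_valE R _ 0 (ts_T c ^~ w) (ts_K c ^~ w)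
  (fun v => psi0 (ts_W c v w)) (fun _ a b => a * b) _ (fun m x => m%:R%:E * x)).
- rewrite /fam_weight /fam_internal /fam_clock /=.
  by case: internal => [L|]; rewrite ?mul0e.
- by move=> x; rewrite mul0e.
- by move=> x; rewrite mul1e.
- by move=> v m p x y; rewrite !natrM !EFinM -!muleA; congr (_ * (_ * _)); exact: muleCA.
- by move=> v x; rewrite mul0e !mule0.
Qed.

Lemma procXbarE (chi0 : rV -> 'rV[R[i]]_n) t (w : ts_sort c) :
  procXbar chi0 t w =
  (real_complex R (fam_weight t (sub_cascade c [::] w) (thinning c w))%:R *:
    valX chi0 (sub_cascade c [::] w, t))%R.
Proof.
rewrite /procXbar (@thinned_valE R _ 0%R (ts_T c ^~ w) (ts_K c ^~ w)
  (fun v => chi0 (ts_W c v w)) (fun v => odot (ts_W c v w)) _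
  (fun m x => (real_complex R m%:R *: x)%R)).
- rewrite /fam_weight /fam_internal /fam_clock /=.
  by case: internal => [L|]; rewrite ?mulr0n ?rmorph0 ?scale0r.
- by move=> x; rewrite mulr0n rmorph0 scale0r.
- by move=> x; rewrite rmorph1 scale1r.
- move=> v m p x y; rewrite odotZl odotZr !scalerA !natrM !rmorphM /=.
  by congr (_ * _ *: _)%R; rewrite mulrA; congr (_ * _ * _)%R; rewrite -(rmorph_nat (real_complex R)).
- by move=> v x; rewrite odot0l odot0r scaler0.
Qed.

Lemma all_thinning_prob L : uniq L ->
  P [set w | all (ts_K c ^~ w) L] = ((2^-1) ^+ size L)%:E.
Proof.
move=> uL; have := cascade_K_indep H (fun=> [set true]) uL.
rewrite (_ : \bigcap_(v in _) _ = [set w | all (ts_K c ^~ w) L]).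
  move=> ->; under eq_bigr do rewrite (cascade_bernoulli H).
  by rewrite prodEFin big_const_seq count_predT iter_mulr_1.
apply/seteqP; split => w /=.
  by move=> HK; apply/allP => v vL; exact: HK.
by move=> /allP HK v /= vL; exact: HK.
Qed.

Lemma measurable_fam_weight t :
  measurable_fun setT (fun z : Fam * family_of vertex bool => (fam_weight t z.1 z.2)%:R : R).
Proof.
rewrite (_ : (fun _ => _) = fun z : Fam * family_of vertex bool =>
    if fam_internal (z.1, t) is Some L then (weight z.2 L)%:R else 0%R : R); last first.
  by apply/funext => z; rewrite /fam_weight; case: fam_internal.
pose g (o : option (seq vertex)) (z : Fam * family_of vertex bool) : R :=
  if o is Some L then (weight z.2 L)%:R else 0%R.
suff : measurable_fun setT (fun z => g (fam_internal (z.1, t)) z) by [].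
apply: (measurable_countable_select (S := fun z : Fam * family_of vertex bool =>
  fam_internal (z.1, t))).
  have mz : measurable_fun setT (fun z : Fam * family_of vertex bool => (z.1, t)).
    exact: measurable_fun_pair.
  by move=> o; have := mz measurableT _ (@fam_internal_levels R n o); rewrite setTI.
move=> [L|]; last exact: measurable_cst.
rewrite (_ : g (Some L) = fun z : Fam * family_of vertex bool =>
    if all z.2 L then (2 ^ size L)%:R else 0%R : R).
  apply: measurable_fun_ifT => //.
  elim: L => [|v L IH] /=; first exact: measurable_cst.
  apply: measurable_and => //.
  exact: measurableT_comp (measurable_family_coord v) measurable_snd.
by apply/funext => z; rewrite /g /weight; case: all.
Qed.

(** Given the tree, the weight is 2 ^ m times the indicator of m independent
    fair coins all showing 1, so its mean is 1. *)
Lemma ge0_integral_thinning (f : Fam * R -> \bar R) t :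
  measurable_fun setT f -> (forall x, 0 <= f x) ->
  (forall p, fam_internal p = None -> f p = 0) ->
  \int[P]_w ((fam_weight t (sub_cascade c [::] w) (thinning c w))%:R%:E *
             f (sub_cascade c [::] w, t)) =
  \int[P]_w f (sub_cascade c [::] w, t).
Proof.
move=> mf f0 fN.
have mS : measurable_fun setT (sub_cascade c [::]) by exact: measurable_sub_cascade.
have mK : measurable_fun setT (thinning c) by exact: measurable_thinning.
have mft : measurable_fun setT (fun z : Fam * family_of vertex bool => f (z.1, t)).
  by apply: (measurableT_comp mf); exact: measurable_fun_pair.
pose g (z : Fam * family_of vertex bool) := (fam_weight t z.1 z.2)%:R%:E * f (z.1, t).
have mg : measurable_fun setT g.
  apply: emeasurable_funM => //; apply/measurable_EFinP; exact: measurable_fam_weight.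
have g0 z : 0 <= g z by rewrite mule_ge0// lee_fin ler0n.
have indep A B : measurable A -> measurable B ->
    P (sub_cascade c [::] @^-1` A `&` thinning c @^-1` B) =
    P (sub_cascade c [::] @^-1` A) * P (thinning c @^-1` B).
  by move=> mA mB; rewrite setIC (cascade_thinning_indep H mB mA) muleC.
transitivity (\int[P]_w \int[P]_w' g (sub_cascade c [::] w, thinning c w')).
  exact: (ge0_integral_indep mS mK indep mg g0).
apply: eq_integral => w _; rewrite /g /=.
set S := sub_cascade c [::] w.
case SE : (fam_internal (S, t)) => [L|]; last first.
  by rewrite fN// integral0_eq// => w' _; rewrite mule0.
have uL : uniq L by exact: internal_uniq SE.
rewrite (eq_integral (fun w' => ((2 ^ size L)%:R%:E * f (S, t)) *
    (\1_[set w | all (ts_K c ^~ w) L] w')%:E)); last first.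
  move=> w' _; rewrite /fam_weight SE indicE /weight.
  rewrite (_ : thinning c w' = ts_K c ^~ w')//.
  case: (boolP (all _ L)) => aK; first by rewrite mem_set// mule1.
  by rewrite memNset ?mule0 ?mul0e//; apply/negP.
have mA : measurable [set w | all (ts_K c ^~ w) L].
  have ma : measurable_fun setT (fun w => all (ts_K c ^~ w) L).
    elim: (L) => [|v L' IH] /=; first exact: measurable_cst.
    by apply: measurable_and => //; exact: ts_measurable_K.
  by have := ma measurableT [set true]; rewrite setTI; exact.
rewrite ge0_integralZl//; last 2 first.
- by apply/measurable_EFinP; exact: measurable_indic.
- by rewrite mule_ge0// lee_fin ler0n.
rewrite integral_indic// setIT.
apply: etrans (congr1 (fun x => (2 ^ size L)%:R%:E * f (S, t) * x) (all_thinning_prob uL)) _.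
rewrite muleAC -EFinM natrX -exprMn.
by rewrite divff// expr1n mul1e.
Qed.

End thinning_expectation.

(** * The branching identity for signed functionals *)

Section real_integrals.
Context d (T : measurableType d) (R : realType) (mu : {measure set T -> \bar R}).
Implicit Types f g : T -> R.

Lemma integrable_real f : measurable_fun setT f ->
  (\int[mu]_x `|f x|%:E < +oo)%E -> mu.-integrable setT (EFin \o f).
Proof. by move=> mf foo; apply/integrableP; split => //; exact/measurable_EFinP. Qed.

Lemma Rintegral_ae f g : {ae mu, forall x, f x = g x} ->
  \int[mu]_x f x = \int[mu]_x g x.
Proof.
by move=> fg; congr fine; apply: integral_ae; apply: filterS fg => x -> _.
Qed.

Lemma integrable_ae_eq f g : measurable_fun setT g -> {ae mu, forall x, f x = g x} ->
  mu.-integrable setT (EFin \o f) -> mu.-integrable setT (EFin \o g).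
Proof.
move=> mg fg /integrableP[_ foo]; apply: integrable_real => //.
rewrite (_ : (\int[mu]_x _)%E = (\int[mu]_x `|(EFin \o f) x|)%E)//.
by apply: integral_ae; apply: filterS fg => x /= -> _.
Qed.

Lemma integrable_lincomb (I : Type) (s : seq I) (c : I -> R) (F : I -> T -> R) :
  (forall i, mu.-integrable setT (EFin \o F i)) ->
  mu.-integrable setT (EFin \o (fun x => \sum_(i <- s) c i * F i x)) /\
  \int[mu]_x (\sum_(i <- s) c i * F i x) = \sum_(i <- s) c i * \int[mu]_x F i x.
Proof.
move=> iF; elim: s => [|i s [IH1 IH2]].
  rewrite big_nil; under [X in EFin \o X]eq_fun do rewrite big_nil.
  split; first exact: integrable0.
  by under eq_Rintegral do rewrite big_nil; rewrite /Rintegral integral0.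
have ci : mu.-integrable setT (EFin \o (fun x => c i * F i x)).
  exact: (integrableZl measurableT (c i) (iF i)).
rewrite big_cons; under [X in EFin \o X]eq_fun do rewrite big_cons.
split; first exact: (integrableD measurableT ci IH1).
under eq_Rintegral do rewrite big_cons.
by rewrite RintegralD// RintegralZl// IH2.
Qed.

End real_integrals.

Section fine_products.
Context (R : realType).
Local Open Scope ereal_scope.

(** If a term of one difference is infinite, finiteness of the products forces
    both terms of the other difference to be 0, and both sides vanish. *)
Lemma fine_mulB (x y z u : \bar R) :
  0 <= x -> 0 <= y -> 0 <= z -> 0 <= u ->
  x * z < +oo -> x * u < +oo -> y * z < +oo -> y * u < +oo ->
  (fine (x - y) * fine (z - u) =
   fine (x * z) - fine (x * u) - fine (y * z) + fine (y * u))%R.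
Proof.
have yz (w : R) : +oo * w%:E < +oo -> (0 <= w)%R -> w = 0%R :> R.
  move=> + w0; have [->//|w1] := eqVneq w 0%R.
  by rewrite gt0_mulye// lte_fin lt_def w1.
have zy (w : R) : w%:E * +oo < +oo -> (0 <= w)%R -> w = 0%R :> R.
  by rewrite muleC; exact: yz.
case: x => [x| |]//; case: y => [y| |]//; case: z => [z| |]//; case: u => [u| |]//;
  rewrite ?lee_fin => x0 y0 z0 u0 H1 H2 H3 H4 //; rewrite /= ?mule_pinfty_pinfty //;
  try by [ring].
all: try (have E1 := yz _ H1 z0); try (have E2 := yz _ H2 u0);
 try (have E3 := yz _ H3 z0); try (have E4 := yz _ H4 u0);
 try (have E5 := zy _ H1 x0); try (have E6 := zy _ H2 x0);
 try (have E7 := zy _ H3 y0); try (have E8 := zy _ H4 y0); subst;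
 rewrite ?mul0e ?mule0 ?sube0 /= ?subr0 ?mul0r ?mulr0 ?subrr ?addr0 //.
Qed.
End fine_products.

Section real_branch.
Context (R : realType) (n : nat).
Local Notation rV := ('rV[R]_n).
Local Notation Fam := (family_of vertex (rV * R)%type).
Local Open Scope ereal_scope.
Context (h : rV -> R) (C : rV -> tree_space R n).
Context (hC : forall xi, xi != 0%R -> is_cascade h C xi).
Context (n_gt0 : (0 < n)%N).

Definition rmean (a : Fam * R -> R) (x : rV) (s : R) : R :=
  (\int[fam_law (C x)]_f a (f, s))%R.

Lemma measurable_rmean a : measurable_fun setT a ->
  measurable_fun setT (fun z : rV * R => rmean a z.1 z.2).
Proof.
move=> ma.
apply: (@measurable_param_Rintegral _ _ (rV * R)%type Fam R
  (fun z => fam_law (C z.1)) (fun z => a (z.2, z.1.2))).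
  by move=> g mg g0; exact: (measurable_integral_fam_law hC n_gt0).
apply: (measurableT_comp ma); apply: measurable_fun_pair => //.
exact: measurableT_comp measurable_snd measurable_fst.
Qed.

Let pp (a : Fam * R -> R) p : R := Num.max (a p) 0%R.
Let np (a : Fam * R -> R) p : R := Num.max (- a p)%R 0%R.

Let ppE a p : a p = (pp a p - np a p)%R.
Proof.
rewrite /pp /np; case: (lerP (a p) 0%R) => a0.
  by rewrite max_l ?oppr_ge0// sub0r opprK.
by rewrite max_r ?subr0// oppr_le0 ltW.
Qed.

Let pp_ge0 a p : (0 <= pp a p)%R. Proof. by rewrite le_max lexx orbT. Qed.
Let np_ge0 a p : (0 <= np a p)%R. Proof. by rewrite le_max lexx orbT. Qed.
Let pp_le a p : (pp a p <= `|a p|)%R. Proof. by rewrite ge_max ler_norm normr_ge0. Qed.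
Let np_le a p : (np a p <= `|a p|)%R.
Proof. by rewrite ge_max -normrN ler_norm normr_ge0. Qed.

Let mpp a : measurable_fun setT a -> measurable_fun setT (EFin \o pp a).
Proof. by move=> ma; apply/measurable_EFinP; apply: measurable_maxr. Qed.
Let mnp a : measurable_fun setT a -> measurable_fun setT (EFin \o np a).
Proof.
move=> ma; apply/measurable_EFinP; apply: measurable_maxr => //.
exact: measurableT_comp.
Qed.

Let rmeanE a x s :
  rmean a x s = fine (mean C (EFin \o pp a) x s - mean C (EFin \o np a) x s).
Proof.
rewrite /rmean /Rintegral integralE; congr (fine (_ - _)); apply: eq_integral => f _.
  by rewrite funeposE /= /pp EFin_max.
by rewrite funenegE /= /np EFin_max.
Qed.

Context (xi : rV) (xi0 : xi != 0%R).
Local Notation P := (ts_P (C xi)).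
Local Notation T0 := (ts_T (C xi) [::]).
Local Notation W1 := (ts_W (C xi) [:: false]).
Local Notation F1 := (sub_cascade (C xi) [:: false]).
Local Notation F2 := (sub_cascade (C xi) [:: true]).

Lemma measurable_clock_if d (S : measurableType d) (a : ts_sort (C xi) -> S) (z : S) t :
  measurable_fun setT a ->
  measurable_fun setT (fun w => if (T0 w < t)%R then a w else z).
Proof.
move=> ma; apply: measurable_fun_ifT => //.
by apply: measurable_fun_ltr => //; exact: ts_measurable_T.
Qed.

Lemma measurable_subtree_at b t : measurable_fun setT (fun w =>
  (sub_cascade (C xi) [:: b] w, t - T0 w)%R).
Proof.
apply: measurable_fun_pair; first exact: measurable_sub_cascade.
by apply: measurable_funB => //; exact: ts_measurable_T.
Qed.

Lemma measurable_label1_at t : measurable_fun setT (fun w => (W1 w, t - T0 w)%R).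
Proof.
apply: measurable_fun_pair; first exact: ts_measurable_W.
by apply: measurable_funB => //; exact: ts_measurable_T.
Qed.

Lemma measurable_label2_at t : measurable_fun setT (fun w => (xi - W1 w, t - T0 w)%R).
Proof.
apply: measurable_fun_pair.
  apply: measurableT_comp (measurable_subr xi) _; exact: ts_measurable_W.
by apply: measurable_funB => //; exact: ts_measurable_T.
Qed.

(** Writing [a] and [b] as differences of their positive and negative parts
    gives four instances of the nonnegative formula, all with finite integrals.
    The means of the parts may be infinite, but their products are almost
    surely finite, which is enough by [fine_mulB]. *)
Lemma integral_branch (a b : Fam * R -> R) t :
  measurable_fun setT a -> measurable_fun setT b ->
  \int[P]_w (if (T0 w < t)%R then `|a (F1 w, t - T0 w)%R|%:E * `|b (F2 w, t - T0 w)%R|%:E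
             else 0) < +oo ->
  let L w := (if T0 w < t then a (F1 w, t - T0 w) * b (F2 w, t - T0 w) else 0)%R in
  let M w := (if T0 w < t then rmean a (W1 w) (t - T0 w) * rmean b (xi - W1 w) (t - T0 w)
              else 0)%R in
  [/\ P.-integrable setT (EFin \o L), P.-integrable setT (EFin \o M) &
      (\int[P]_w L w = \int[P]_w M w)%R].
Proof.
move=> ma mb aboo L M.
pose LL (f g : Fam * R -> R) w :=
  (if T0 w < t then f (F1 w, t - T0 w) * g (F2 w, t - T0 w) else 0)%R.
pose N (f g : Fam * R -> R) w := if (T0 w < t)%R then
  mean C (EFin \o f) (W1 w) (t - T0 w)%R * mean C (EFin \o g) (xi - W1 w)%R (t - T0 w)%R else 0.
have mLL f g : measurable_fun setT (EFin \o f) -> measurable_fun setT (EFin \o g) ->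
    measurable_fun setT (LL f g).
  move=> /measurable_EFinP mf /measurable_EFinP mg; apply: measurable_clock_if.
  apply: measurable_funM.
    exact: measurableT_comp mf (measurable_subtree_at false t).
  exact: measurableT_comp mg (measurable_subtree_at true t).
have mN f g : measurable_fun setT (EFin \o f) -> measurable_fun setT (EFin \o g) ->
    (forall p, 0 <= f p)%R -> (forall p, 0 <= g p)%R -> measurable_fun setT (N f g).
  move=> mf mg f0 g0; apply: measurable_clock_if; apply: emeasurable_funM.
    apply: (measurableT_comp (measurable_mean hC n_gt0 mf _) (measurable_label1_at t)).
    by move=> p; rewrite lee_fin.
  apply: (measurableT_comp (measurable_mean hC n_gt0 mg _) (measurable_label2_at t)).
  by move=> p; rewrite lee_fin.
have key f g : measurable_fun setT (EFin \o f) -> measurable_fun setT (EFin \o g) ->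
    (forall p, 0 <= f p)%R -> (forall p, 0 <= g p)%R ->
    (forall p, f p <= `|a p|)%R -> (forall p, g p <= `|b p|)%R ->
    [/\ P.-integrable setT (EFin \o LL f g), P.-integrable setT (N f g) &
      \int[P]_w (LL f g w)%:E = \int[P]_w N f g w].
  move=> mf mg f0 g0 fa gb.
  have LL0 w : (0 <= LL f g w)%R by rewrite /LL; case: ifP => // _; rewrite mulr_ge0.
  have N0 w : 0 <= N f g w.
    rewrite /N; case: ifP => // _; rewrite mule_ge0//; apply: mean_ge0 => p;
      by rewrite lee_fin.
  have LN : \int[P]_w (LL f g w)%:E = \int[P]_w N f g w.
    rewrite -(ge0_integral_branch hC n_gt0 xi0 t mf mg).
    - by apply: eq_integral => w _; rewrite /LL; case: ifP.
    - by move=> p; rewrite lee_fin.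
    - by move=> p; rewrite lee_fin.
  have Loo : \int[P]_w (LL f g w)%:E < +oo.
    apply: le_lt_trans aboo; apply: ge0_le_integral => //.
    - by move=> w _; rewrite lee_fin.
    - by apply/measurable_EFinP; exact: mLL.
    - apply: measurable_clock_if; apply: emeasurable_funM; apply/measurable_EFinP;
        apply: measurableT_comp => //.
        exact: measurableT_comp ma (measurable_subtree_at false t).
      exact: measurableT_comp mb (measurable_subtree_at true t).
    - move=> w _; rewrite /LL; case: ifP => // _; rewrite -EFinM lee_fin.
      by rewrite ler_pM.
  split => //.
    apply: integrable_real; first exact: mLL.
    rewrite (_ : \int[P]_w _ = \int[P]_w (LL f g w)%:E)//.
    by apply: eq_integral => w _; rewrite ger0_norm.
  apply/integrableP; split; first exact: mN.
  rewrite (_ : \int[P]_w _ = \int[P]_w N f g w); first by rewrite -LN.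
  by apply: eq_integral => w _; rewrite gee0_abs.
have [L1 N1 E1] := key _ _ (mpp ma) (mpp mb) (@pp_ge0 a) (@pp_ge0 b) (@pp_le a) (@pp_le b).
have [L2 N2 E2] := key _ _ (mpp ma) (mnp mb) (@pp_ge0 a) (@np_ge0 b) (@pp_le a) (@np_le b).
have [L3 N3 E3] := key _ _ (mnp ma) (mpp mb) (@np_ge0 a) (@pp_ge0 b) (@np_le a) (@pp_le b).
have [L4 N4 E4] := key _ _ (mnp ma) (mnp mb) (@np_ge0 a) (@np_ge0 b) (@np_le a) (@np_le b).
have fineN f : P.-integrable setT f -> P.-integrable setT (EFin \o (fine \o f)) /\
    (\int[P]_w (fine \o f) w)%R = fine (\int[P]_w f w).
  move=> fi; have ff := integrable_ae measurableT fi.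
  have fE : {ae P, forall x, setT x -> f x = (fine (f x))%:E}.
    by apply: filterS ff => x /(_ I) fx _; rewrite fineK.
  split; last by congr fine; apply/esym; exact: integral_ae.
  have mf := measurable_int _ fi.
  apply/integrableP; split.
    by apply/measurable_EFinP; exact: (measurableT_comp (f := fine)).
  move/integrableP: fi => [_]; rewrite (_ : \int[P]_x `|f x| = \int[P]_x `|(EFin \o (fine \o f)) x|)//.
  by apply: integral_ae; apply: filterS fE => x -> // _; rewrite /= fineK.
have lin (l1 l2 l3 l4 : ts_sort (C xi) -> R) :
    P.-integrable setT (EFin \o l1) -> P.-integrable setT (EFin \o l2) ->
    P.-integrable setT (EFin \o l3) -> P.-integrable setT (EFin \o l4) ->
    P.-integrable setT (EFin \o (fun w => l1 w - l2 w - l3 w + l4 w)%R) /\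
    (\int[P]_w (l1 w - l2 w - l3 w + l4 w) = \int[P]_w l1 w - \int[P]_w l2 w
      - \int[P]_w l3 w + \int[P]_w l4 w)%R.
  move=> i1 i2 i3 i4.
  have i12 : P.-integrable setT (EFin \o (fun w => l1 w - l2 w)%R).
    exact: (integrableB measurableT i1 i2).
  have i123 : P.-integrable setT (EFin \o (fun w => l1 w - l2 w - l3 w)%R).
    exact: (integrableB measurableT i12 i3).
  split; first exact: (integrableD measurableT i123 i4).
  by rewrite RintegralD// RintegralB// RintegralB.
have [f1 e1] := fineN _ N1; have [f2 e2] := fineN _ N2.
have [f3 e3] := fineN _ N3; have [f4 e4] := fineN _ N4.
have [iL EL] := lin _ _ _ _ L1 L2 L3 L4.
have [iM EM] := lin _ _ _ _ f1 f2 f3 f4.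
have LE w : (LL (pp a) (pp b) w - LL (pp a) (np b) w - LL (np a) (pp b) w +
    LL (np a) (np b) w)%R = L w.
  rewrite /LL /L; case: ifP => _; last by ring.
  by rewrite (ppE a) (ppE b); ring.
have mM : measurable_fun setT M.
  apply: measurable_clock_if; apply: measurable_funM.
    exact: measurableT_comp (measurable_rmean ma) (measurable_label1_at t).
  exact: measurableT_comp (measurable_rmean mb) (measurable_label2_at t).
have ME : {ae P, forall w, ((fine \o N (pp a) (pp b)) w - (fine \o N (pp a) (np b)) w -
    (fine \o N (np a) (pp b)) w + (fine \o N (np a) (np b)) w)%R = M w}.
  have n12 : {ae P, forall w, N (pp a) (pp b) w \is a fin_num /\
      N (pp a) (np b) w \is a fin_num}.
    by apply: filterS2 (integrable_ae measurableT N1) (integrable_ae measurableT N2)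
      => w /(_ I) n1 /(_ I) n2.
  apply: filterS3 n12 (integrable_ae measurableT N3) (integrable_ae measurableT N4).
  move=> w [n1 n2] /(_ I) n3 /(_ I) n4.
  move: n1 n2 n3 n4; rewrite /N /M /=; case: ifP => _; last by move=> *; ring.
  move=> n1 n2 n3 n4; rewrite !rmeanE fine_mulB//; first (by apply: mean_ge0 => p; rewrite lee_fin);
    try (by apply: mean_ge0 => p; rewrite lee_fin); by rewrite ltey_eq ?n1 ?n2 ?n3 ?n4.
have LM : (\int[P]_w L w = \int[P]_w M w)%R.
  rewrite -(Rintegral_ae ME) EM; under eq_Rintegral do rewrite -LE.
  by rewrite EL e1 e2 e3 e4 /Rintegral E1 E2 E3 E4.
split => //.
  by apply: eq_integrable iL => // w _; rewrite /= LE.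
exact: integrable_ae_eq ME iM.
Qed.

End real_branch.

(** * Vector integrals and the joint density of clock and label *)

Section cv_integrals.
Context (R : realType) (n : nat) d (S : measurableType d) (mu : {measure set S -> \bar R}).
Implicit Types (D : set S) (f : S -> 'rV[R[i]]_n).

Lemma coord_cv_integral q D f :
  coord q (cv_integral mu D f) = \int[mu]_(x in D) coord q (f x).
Proof. by case: q => j []; rewrite /coord mxE. Qed.

Lemma cv_integrableP D f : cv_integrable mu D f <->
  forall q, mu.-integrable D (fun x => (coord q (f x))%:E).
Proof.
split=> [mf [j []]|mf j]; rewrite /coord /=; [exact: (mf j).1|exact: (mf j).2|].
by split; [exact: (mf (j, true))|exact: (mf (j, false))].
Qed.

Lemma cv_integrable_cnorm f : cv_measurable f ->
  (\int[mu]_x (cnorm (f x))%:E < +oo)%E -> cv_integrable mu setT f.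
Proof.
move=> mf foo; apply/cv_integrableP => q.
apply: (@integrable_real _ _ _ mu (fun x => coord q (f x))); first exact: (cv_measurableP f).1.
apply: le_lt_trans foo; apply: ge0_le_integral => //.
- apply/measurable_EFinP; apply: measurableT_comp => //; exact: (cv_measurableP f).1.
- by apply/measurable_EFinP; exact: measurable_cnorm.
- by move=> x _; rewrite lee_fin le_coord_cnorm.
Qed.

(** Jensen: pair the integral with its own value, then Cauchy-Schwarz. *)
Lemma cnorm_cv_integral f : cv_measurable f ->
  (\int[mu]_x (cnorm (f x))%:E < +oo)%E ->
  ((cnorm (cv_integral mu setT f))%:E <= \int[mu]_x (cnorm (f x))%:E)%E.
Proof.
move=> mf foo; set v := cv_integral mu setT f.
have /cv_integrableP fi := cv_integrable_cnorm mf foo.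
have [v0|v0] := eqVneq (cnorm v) 0.
  by rewrite v0 integral_ge0// => x _; rewrite lee_fin cnorm_ge0.
have [I1 I2] := integrable_lincomb (index_enum ('I_n * bool)%type)
  (fun q => coord q v) fi.
have vp : 0 < cnorm v by rewrite lt_def v0 cnorm_ge0.
have ic : mu.-integrable setT (EFin \o (fun x => cnorm (f x))).
  apply: integrable_real; first exact: measurable_cnorm.
  by under eq_integral do rewrite ger0_norm ?cnorm_ge0//.
have icv := integrableZl measurableT (cnorm v) ic.
rewrite -(@lee_pmul2l _ (cnorm v)%:E)// -EFinM -expr2 sqr_cnorm.
have -> : \sum_p coord p v ^+ 2 = \sum_p coord p v * \int[mu]_x coord p (f x).
  by apply: eq_bigr => p _; rewrite {2}/v coord_cv_integral.
rewrite -I2 /Rintegral fineK; last exact: integrable_fin_num.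
rewrite -(integralZl measurableT ic); apply: le_integral => //.
by move=> x _; rewrite /= -EFinM lee_fin; exact: le_cdot.
Qed.

End cv_integrals.

Section box.
Context (R : realType) (n : nat).
Local Notation rV := ('rV[R]_n).
Local Open Scope ereal_scope.
Context (h : rV -> R) (C : rV -> tree_space R n).
Context (hC : forall xi, xi != 0%R -> is_cascade h C xi).
Context (n_gt0 : (0 < n)%N).
Context (h_gt0 : forall x, (0 < h x)%R) (mh : measurable_fun setT h).
Context (xi : rV) (xi0 : xi != 0%R) (t : R).
Local Notation P := (ts_P (C xi)).
Local Notation T0 := (ts_T (C xi) [::]).
Local Notation W1 := (ts_W (C xi) [:: false]).
Local Notation rate := (enorm xi ^+ 2)%R.
Local Notation leb2 := (@lebesgue_measure R \x lebesgue_rV R n).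
Local Notation box := (`[0%R, t]%classic `*` [set: rV]).

Definition time_density (s : R) : R := (expR (- s * rate) * rate)%R.
(** The joint density of the root clock and of the first label. *)
Definition branch_density (z : R * rV) : R := (time_density z.1 * Hker h z.2 xi)%R.

Lemma time_density_gt0 s : (0 < time_density s)%R.
Proof. by rewrite mulr_gt0 ?expR_gt0// exprn_gt0// enorm_gt0. Qed.

Lemma branch_density_ge0 z : (0 <= branch_density z)%R.
Proof. by rewrite mulr_ge0 ?(ltW (time_density_gt0 _))// Hker_ge0. Qed.

Lemma measurable_branch_density : measurable_fun setT branch_density.
Proof.
apply: measurable_funM.
  apply: measurable_funM => //; apply: measurableT_comp => //.
  by apply: measurable_funM => //; exact: measurableT_comp.
exact: measurableT_comp (measurable_Hker xi mh) measurable_snd.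
Qed.

Lemma measurable_box : measurable (box : set (measurableTypeR R * rV)).
Proof. by apply: measurableX => //; exact: measurable_itv. Qed.

Lemma ge0_integral_box (phi : R * rV -> \bar R) :
  measurable_fun setT phi -> (forall z, 0 <= phi z) ->
  \int[P]_w (if (T0 w < t)%R then phi (T0 w, W1 w) else 0) =
  \int[leb2]_(z in box) ((branch_density z)%:E * phi z).
Proof.
move=> mphi phi0.
pose f (z : R * rV) := if (z.1 < t)%R then phi z else 0.
have mf : measurable_fun setT f.
  by apply: measurable_fun_ifT => //; exact: measurable_fun_ltr.
have f0 z : 0 <= f z by rewrite /f; case: ifP.
transitivity (\int[P]_w f (T0 w, W1 w)) => //.
rewrite (ge0_integral_clock_label hC xi0 h_gt0 mh mf f0).
pose F (z : measurableTypeR R * rV) := (branch_density z)%:E * phi z.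
have mF : measurable_fun setT F.
  have : measurable_fun setT (fun z : R * rV => (branch_density z)%:E * phi z).
    by apply: emeasurable_funM => //; apply/measurable_EFinP; exact: measurable_branch_density.
  exact.
have F0 z : 0 <= F z by rewrite mule_ge0// lee_fin branch_density_ge0.
have mFb : measurable_fun setT (F \_ box).
  by apply/(measurable_restrictT _ measurable_box); exact: measurable_funTS.
have Fb0 z : 0 <= (F \_ box) z by rewrite patchE; case: ifP.
transitivity (\int[@lebesgue_measure R]_s fubini_F (lebesgue_rV R n) (F \_ box) s); last first.
  rewrite [RHS]integral_mkcond; have := @fubini_tonelli1 _ _ _ _ R (@lebesgue_measure R) (lebesgue_rV R n) (F \_ box) mFb Fb0.
  by move=> <-.
apply: (@integral_off_null _ _ R (@lebesgue_measure R) [set t] setT).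
- exact: measurable_set1.
- exact: lebesgue_measure_set1.
move=> s _ /eqP st; rewrite /fubini_F.
have [s0|s0] := ltP s 0%R.
  rewrite lt0_exponential_pdf// mul0e integral0_eq// => eta _.
  by rewrite patchE memNset//= in_itv/= leNgt s0 => -[].
have [ts|ts] := ltP t s.
  have -> : \int[lebesgue_rV R n]_eta ((Hker h eta xi)%:E * f (s, eta)) = 0.
    by apply: integral0_eq => eta _; rewrite /f /= ltNge (ltW ts) mule0.
  rewrite mule0 integral0_eq// => eta _.
  by rewrite patchE memNset//= in_itv/= s0/= leNgt ts => -[].
rewrite exponential_pdfE// -ge0_integralZl//; last 3 first.
- apply: emeasurable_funM; first by apply/measurable_EFinP; exact: measurable_Hker.
  exact: measurableT_comp mf (measurable_pair1 _).
- by move=> eta _; rewrite mule_ge0// lee_fin Hker_ge0.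
- by rewrite lee_fin mulr_ge0 ?sqr_ge0 ?expR_ge0.
apply: eq_integral => eta _; rewrite patchE mem_set/=; last by split => //=; rewrite in_itv/= s0.
rewrite /f /F /= lt_def eq_sym st ts/= muleA -EFinM; congr (_%:E * _).
by rewrite /branch_density /time_density /=; congr (_ * _)%R; rewrite mulrC; congr (expR _ * _)%R; ring.
Qed.

Lemma integral_box (phi : R * rV -> R) : measurable_fun setT phi ->
  P.-integrable setT (fun w => (if (T0 w < t)%R then phi (T0 w, W1 w) else 0%R)%:E) ->
  leb2.-integrable box (fun z => (branch_density z * phi z)%:E) /\
  (\int[leb2]_(z in box) (branch_density z * phi z) =
   \int[P]_w (if (T0 w < t) then phi (T0 w, W1 w) else 0))%R.
Proof.
move=> mphi iphi.
have mF : measurable_fun [set: measurableTypeR R * rV]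
    (fun z => (branch_density z * phi z)%R).
  have : measurable_fun setT (fun z : R * rV => (branch_density z * phi z)%R).
    by apply: measurable_funM => //; exact: measurable_branch_density.
  exact.
have mphiN : measurable_fun setT (fun z => - phi z)%R by exact: measurableT_comp.
split.
  apply/integrableP; split.
    by apply: measurable_funTS; exact/measurable_EFinP.
  move/integrableP : iphi => [_]; apply: le_lt_trans.
  rewrite le_eqVlt; apply/orP; left; apply/eqP.
  rewrite [LHS](_ : _ = \int[leb2]_(z in box) ((branch_density z)%:E * `|phi z|%:E)).
    rewrite -ge0_integral_box.
    - by apply: eq_integral => w _; case: ifP => //=; rewrite normr0.
    - by apply/measurable_EFinP; exact: measurableT_comp.
    - by move=> z; rewrite lee_fin.
  by apply: eq_integral => z _; rewrite /= normrM ger0_norm// branch_density_ge0.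
have E (chi : R * rV -> R) : measurable_fun setT chi ->
    \int[leb2]_(z in box) ((branch_density z)%:E * (Num.max (chi z) 0%R)%:E) =
    \int[P]_w (Num.max (if (T0 w < t)%R then chi (T0 w, W1 w) else 0%R) 0%R)%:E.
  move=> mchi; rewrite -ge0_integral_box.
  - by apply: eq_integral => w _; case: ifP => // _; rewrite maxxx.
  - by apply/measurable_EFinP; exact: measurable_maxr.
  - by move=> z; rewrite lee_fin le_max lexx orbT.
rewrite /Rintegral integralE [in RHS]integralE; congr (fine (_ - _)).
  transitivity (\int[leb2]_(z in box) ((branch_density z)%:E * (Num.max (phi z) 0%R)%:E)).
    apply: eq_integral => z _; rewrite funeposE -EFin_max -EFinM; congr EFin.
    by rewrite maxr_pMr ?mulr0// branch_density_ge0.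
  by rewrite E//; apply: eq_integral => w _; rewrite funeposE -EFin_max.
transitivity (\int[leb2]_(z in box) ((branch_density z)%:E * (Num.max (- phi z) 0%R)%:E)).
  apply: eq_integral => z _; rewrite funenegE -EFinN -EFin_max -EFinM; congr EFin.
  by rewrite maxr_pMr ?mulr0 ?mulrN// branch_density_ge0.
rewrite (E _ mphiN); apply: eq_integral => w _; rewrite funenegE -EFinN -EFin_max.
by case: ifP => //; rewrite oppr0.
Qed.

(** Fubini, the inner integral being finite only for almost every time. *)
Lemma iterated_integral_box (phi : R * rV -> R) : measurable_fun setT phi ->
  leb2.-integrable box (fun z => (branch_density z * phi z)%:E) ->
  (\int[@lebesgue_measure R]_(s in `[0%R, t]) (time_density s *
     \int[lebesgue_rV R n]_eta (Hker h eta xi * phi (s, eta))) =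
   \int[leb2]_(z in box) (branch_density z * phi z))%R.
Proof.
move=> mphi iphi.
pose F (z : measurableTypeR R * rV) := (branch_density z * phi z)%:E.
have iF : leb2.-integrable setT (F \_ box).
  exact: (iffLR (integrable_mkcond _ measurable_box) iphi).
rewrite /Rintegral; congr fine.
transitivity (\int[@lebesgue_measure R]_s fubini_F (lebesgue_rV R n) (F \_ box) s); last first.
  by rewrite [RHS]integral_mkcond; exact: (integral12_prod_meas1 iF).
rewrite integral_mkcond.
apply: integral_ae; apply: filterS (ae_integrable1 iF) => s iFs _.
rewrite /fubini_F patchE; case: ifPn => s0t; last first.
  rewrite integral0_eq// => eta _; rewrite patchE memNset//= => -[/= st _].
  by move/negP: s0t; apply; exact: mem_set.
have FE eta : (F \_ box) (s, eta) = (time_density s)%:E * (Hker h eta xi * phi (s, eta))%:E.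
  rewrite patchE mem_set//=; last by split => //; exact: set_mem s0t.
  by rewrite /F /branch_density /= -EFinM; congr EFin; rewrite -mulrA.
have iH : (lebesgue_rV R n).-integrable setT (fun eta => (Hker h eta xi * phi (s, eta))%:E).
  have := integrableZl measurableT ((time_density s)^-1)%R iFs.
  apply: eq_integrable => // eta _; rewrite FE muleA -EFinM mulVf ?mul1r//.
  exact: lt0r_neq0 (time_density_gt0 s).
under [RHS]eq_integral do rewrite FE.
rewrite (integralZl measurableT iH) EFinM fineK//.
exact: integrable_fin_num iH.
Qed.

End box.

(** * Vector means *)

Section vector.
Context (R : realType) (n : nat).
Local Notation rV := ('rV[R]_n).
Local Notation CV := ('rV[R[i]]_n).
Local Notation J := ('I_n * bool)%type.
Local Notation Fam := (family_of vertex (rV * R)%type).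
Context (h : rV -> R) (C : rV -> tree_space R n).
Context (hC : forall xi, xi != 0 -> is_cascade h C xi).
Context (n_gt0 : (0 < n)%N).
Context (h_gt0 : forall x, 0 < h x) (mh : measurable_fun setT h).
Context (chi0 : rV -> CV) (mchi0 : cv_measurable chi0).
Let psi0 (x : rV) : \bar R := (cnorm (chi0 x) / 2)%:E.
Local Notation Psi := (mean C (valY psi0)).

Lemma measurable_psi0 : measurable_fun setT psi0.
Proof.
apply/measurable_EFinP; apply: measurable_funM => //; exact: measurable_cnorm.
Qed.

Lemma psi0_ge0 x : (0 <= psi0 x)%E.
Proof. by rewrite lee_fin divr_ge0// cnorm_ge0. Qed.

Definition vmean (G : Fam * R -> CV) (x : rV) (s : R) : CV :=
  cv_integral (fam_law (C x)) setT (fun f => G (f, s)).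

Lemma coord_vmean q G x s : coord q (vmean G x s) = rmean C (fun p => coord q (G p)) x s.
Proof. exact: coord_cv_integral. Qed.

Lemma cv_measurable_vmean G : cv_measurable G ->
  cv_measurable (fun z : rV * R => vmean G z.1 z.2).
Proof.
move=> /cv_measurableP mG; apply/cv_measurableP => q.
under eq_fun do rewrite coord_vmean.
exact: (measurable_rmean hC n_gt0 (mG q)).
Qed.

(** The functionals whose vector means exist wherever the scalar solution is
    finite. *)
Definition dominated (G : Fam * R -> CV) :=
  cv_measurable G /\ forall p, ((cnorm (G p))%:E <= 2%:E * valY psi0 p)%E.

Lemma mean_cnorm_le G x s : dominated G ->
  (\int[fam_law (C x)]_f (cnorm (G (f, s)))%:E <= 2%:E * Psi x s)%E.
Proof.
move=> [mG dG]; have mpsi := measurable_psi0.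
have mv : measurable_fun setT (fun f => valY psi0 (f, s)).
  exact: measurableT_comp (measurable_valY mpsi) (measurable_pair2 _).
have v0 f : (0 <= valY psi0 (f, s))%E by apply: valY_ge0; exact: psi0_ge0.
rewrite /mean -ge0_integralZl//.
apply: ge0_le_integral => //.
- by move=> f _; rewrite lee_fin cnorm_ge0.
- apply/measurable_EFinP; apply: measurable_cnorm.
  exact: (cv_measurable_comp mG (measurable_pair2 _)).
- exact: measurable_funeM.
Qed.

Lemma cnorm_vmean_le G x s : dominated G -> (Psi x s < +oo)%E ->
  ((cnorm (vmean G x s))%:E <= 2%:E * Psi x s)%E.
Proof.
move=> dG Poo; have mle := mean_cnorm_le x s dG.
apply: le_trans mle; apply: cnorm_cv_integral.
  exact: (cv_measurable_comp dG.1 (measurable_pair2 _)).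
apply: le_lt_trans (mean_cnorm_le x s dG) _.
by rewrite lte_mul_pinfty// lee_fin.
Qed.

Section root.
Context (xi : rV) (xi0 : xi != 0) (t : R).
Local Notation P := (ts_P (C xi)).
Local Notation T0 := (ts_T (C xi) [::]).
Local Notation W1 := (ts_W (C xi) [:: false]).
Local Notation F1 := (sub_cascade (C xi) [:: false]).
Local Notation F2 := (sub_cascade (C xi) [:: true]).
Local Notation rate := (enorm xi ^+ 2).
Local Notation leb2 := (@lebesgue_measure R \x lebesgue_rV R n)%E.
Let H : is_cascade h C xi := hC xi0.

(** The bilinear term of the equation before integration: [f] and [g] are
    evaluated at the random labels of the children. *)
Definition split_odot (f g : rV -> R -> CV) (w : ts_sort (C xi)) : CV :=
  if T0 w < t then odot xi (f (W1 w) (t - T0 w)) (g (xi - W1 w) (t - T0 w)) else 0.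

(** The weight in the double integral is the joint density of the clock and of
    the first label, so the double integral is an expectation. *)
Lemma B_nFNS_split (f g : rV -> R -> CV) :
  cv_measurable (fun z : rV * R => f z.1 z.2) ->
  cv_measurable (fun z : rV * R => g z.1 z.2) ->
  cv_integrable P setT (split_odot f g) ->
  B_nFNS_defined h f g xi t /\ B_nFNS h f g xi t = cv_integral P setT (split_odot f g).
Proof.
move=> mf mg /cv_integrableP iM.
pose phi q (z : R * rV) := coord q (odot xi (f z.2 (t - z.1)) (g (xi - z.2) (t - z.1))).
have mphi q : measurable_fun setT (phi q).
  have mt : measurable_fun setT (fun z : R * rV => t - z.1) by exact: measurable_funB.
  have m1 : cv_measurable (fun z : R * rV => f z.2 (t - z.1)).
    apply: (cv_measurable_comp mf (f := fun z : R * rV => (z.2, t - z.1))).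
    exact: measurable_fun_pair.
  have m2 : cv_measurable (fun z : R * rV => g (xi - z.2) (t - z.1)).
    apply: (cv_measurable_comp mg (f := fun z : R * rV => (xi - z.2, t - z.1))).
    apply: measurable_fun_pair => //.
    exact: measurableT_comp (measurable_subr xi) measurable_snd.
  have := cv_measurable_odot (measurable_cst xi) m1 m2.
  by move=> /cv_measurableP; exact.
have iphi q : P.-integrable setT (fun w => (if T0 w < t then phi q (T0 w, W1 w) else 0)%:E).
  move: (iM q); rewrite (_ : (fun x => _) = fun w => (if T0 w < t then phi q (T0 w, W1 w) else 0)%:E)//.
  by apply/funext => w; rewrite /split_odot; case: ifP; rewrite ?coord0.
have box q := integral_box hC h_gt0 mh xi0 (mphi q) (iphi q).
split.
  apply/cv_integrableP => q; have [ib _] := box q.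
  apply: eq_integrable ib; first exact: measurable_box.
  by move=> z _; rewrite coordZ.
apply/coordP => q; rewrite !coord_cv_integral; have [ib Eb] := box q.
transitivity (\int[P]_w (if T0 w < t then phi q (T0 w, W1 w) else 0)).
  rewrite -Eb -(iterated_integral_box xi0 (mphi q) ib)//.
  apply: eq_Rintegral => s _; rewrite coordZ coord_cv_integral; congr (_ * _).
  by apply: eq_Rintegral => eta _; rewrite coordZ.
by apply: eq_Rintegral => w _; rewrite /split_odot; case: ifP; rewrite ?coord0.
Qed.

(** The product of the contributions of the two subtrees when the root
    branches before [t]. *)
Definition branch_odot (G : Fam * R -> CV) (w : ts_sort (C xi)) : CV :=
  if T0 w < t then odot xi (G (F1 w, t - T0 w)) (G (F2 w, t - T0 w)) else 0.

Context (t_ge0 : 0 <= t).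
Context (Psi_fin : (Psi xi t < +oo)%E).

(** The integrand is the part of [valY] in which the root branches, so its
    expectation is at most [Psi xi t]. *)
Lemma branch_valY_fin : (\int[P]_w (if (T0 w < t)%R then
  valY psi0 (F1 w, (t - T0 w)%R) * valY psi0 (F2 w, (t - T0 w)%R) else 0) < +oo)%E.
Proof.
have mv := measurable_valY measurable_psi0; have v0 := valY_ge0 psi0_ge0.
apply: le_lt_trans Psi_fin; rewrite /mean ge0_integral_fam_law//; last first.
  exact: measurableT_comp mv (measurable_pair2 _).
apply: ge0_le_integral => //.
- by move=> w _; case: ifP => // _; rewrite mule_ge0.
- apply: measurable_clock_if; apply: emeasurable_funM.
    exact: measurableT_comp mv (@measurable_subtree_at R n C xi false t).
  exact: measurableT_comp mv (@measurable_subtree_at R n C xi true t).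
- apply: (measurableT_comp mv); apply: measurable_fun_pair => //.
  exact: measurable_sub_cascade.
- move=> w _; rewrite [leRHS](_ : _ = fam_step psi0 (fun _ a b => a * b)%E (valY psi0)
    (sub_cascade (C xi) [::] w, t)); last by rewrite -valY_step.
  rewrite /fam_step /fam_clock /=; have [tT|tT] := ltP (T0 w) t; last exact: psi0_ge0.
  exact: lexx.
Qed.

(** In real coordinates the product is a linear combination of products of one
    coordinate per subtree; each of them is dominated by four times the product of
    the values of Y, and [integral_branch] applies. *)
Lemma branch_odot_mean G : dominated G ->
  [/\ cv_integrable P setT (branch_odot G),
      cv_integrable P setT (split_odot (vmean G) (vmean G)) &
      cv_integral P setT (branch_odot G) =
      cv_integral P setT (split_odot (vmean G) (vmean G))].
Proof.
move=> [mG dG]; have mGq q : measurable_fun setT (fun p => coord q (G p)).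
  by move: q; exact/cv_measurableP.
pose L (i : J * J) w := if T0 w < t then
  coord i.1 (G (F1 w, t - T0 w)) * coord i.2 (G (F2 w, t - T0 w)) else 0.
pose M (i : J * J) w := if T0 w < t then
  rmean C (fun p => coord i.1 (G p)) (W1 w) (t - T0 w) *
  rmean C (fun p => coord i.2 (G p)) (xi - W1 w) (t - T0 w) else 0.
have v0 := valY_ge0 psi0_ge0; have mv := measurable_valY measurable_psi0.
have LM i : [/\ P.-integrable setT (EFin \o L i), P.-integrable setT (EFin \o M i) &
    \int[P]_w L i w = \int[P]_w M i w].
  apply: (integral_branch hC n_gt0 xi0 (mGq i.1) (mGq i.2)).
  have G2 q p : (`|coord q (G p)|%:E <= 2%:E * valY psi0 p)%E.
    by apply: le_trans (dG p); rewrite lee_fin le_coord_cnorm.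
  have m1 : measurable_fun setT (fun w => if T0 w < t then
      (valY psi0 (F1 w, (t - T0 w)%R) * valY psi0 (F2 w, (t - T0 w)%R))%E else 0%E).
    apply: measurable_clock_if; apply: emeasurable_funM.
      exact: measurableT_comp mv (@measurable_subtree_at R n C xi false t).
    exact: measurableT_comp mv (@measurable_subtree_at R n C xi true t).
  apply: (@le_lt_trans _ _ (\int[P]_w (4%:E * (if (T0 w < t)%R then
    valY psi0 (F1 w, (t - T0 w)%R) * valY psi0 (F2 w, (t - T0 w)%R) else 0)))%E); last first.
    rewrite ge0_integralZl//; last by move=> w _; case: ifP => // _; rewrite mule_ge0.
    by rewrite lte_mul_pinfty//; exact: branch_valY_fin.
  apply: ge0_le_integral => //.
  - by move=> w _; case: ifP => // _; rewrite mule_ge0.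
  - apply: measurable_clock_if; apply: emeasurable_funM; apply/measurable_EFinP;
      apply: measurableT_comp => //.
      exact: measurableT_comp (mGq _) (@measurable_subtree_at R n C xi false t).
    exact: measurableT_comp (mGq _) (@measurable_subtree_at R n C xi true t).
  - exact: measurable_funeM.
  - move=> w _; case: ifP => _; last by rewrite mule0.
    apply: (@le_trans _ _ ((2%:E * valY psi0 (F1 w, (t - T0 w)%R)) *
      (2%:E * valY psi0 (F2 w, (t - T0 w)%R)))%E); first exact: lee_pmul.
    by rewrite muleACA -EFinM -natrM.
have lin q (F : J * J -> ts_sort (C xi) -> R) (V : ts_sort (C xi) -> CV) :
    (forall i, P.-integrable setT (EFin \o F i)) ->
    (forall w, coord q (V w) = \sum_i odot_coef q xi i.1 i.2 * F i w) ->
    P.-integrable setT (fun w => (coord q (V w))%:E) /\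
    \int[P]_w coord q (V w) = \sum_i odot_coef q xi i.1 i.2 * \int[P]_w F i w.
  move=> iF VE.
  have [I1 I2] := integrable_lincomb (index_enum (J * J)%type)
    (fun i => odot_coef q xi i.1 i.2) iF.
  split; first by apply: eq_integrable I1 => // w _; rewrite /= VE.
  by rewrite -I2; apply: eq_Rintegral => w _; rewrite VE.
have coordE q (T : Type) (c : bool) (a b : CV) (aa bb : J -> R) :
    (forall p, coord p a = aa p) -> (forall p, coord p b = bb p) ->
    coord q (if c then odot xi a b else 0) =
    \sum_(i : J * J) odot_coef q xi i.1 i.2 * (if c then aa i.1 * bb i.2 else 0).
  move=> aE bE; case: c; last by rewrite coord0 big1// => i _; rewrite mulr0.
  rewrite coord_odot pair_big /=; apply: eq_bigr => i _; by rewrite aE bE.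
have linL q := lin q L (branch_odot G) (fun i => let: And3 a _ _ := LM i in a)
  (fun w => coordE q unit _ _ _ _ _ (fun p => erefl) (fun p => erefl)).
have linM q := lin q M (split_odot (vmean G) (vmean G)) (fun i => let: And3 _ a _ := LM i in a)
  (fun w => coordE q unit _ _ _ _ _ (fun p => coord_vmean p _ _ _) (fun p => coord_vmean p _ _ _)).
split.
- by apply/cv_integrableP => q; exact: (linL q).1.
- by apply/cv_integrableP => q; exact: (linM q).1.
apply/coordP => q.
apply: (etrans (coord_cv_integral P q setT (branch_odot G))).
apply: (etrans (linL q).2); apply/esym.
apply: (etrans (coord_cv_integral P q setT (split_odot (vmean G) (vmean G)))).
apply: (etrans (linM q).2); apply/esym.
by apply: eq_bigr => i _; congr (_ * _); have [_ _] := LM i.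
Qed.

Lemma Rintegral_fam_law c (a : Fam -> R) : measurable_fun setT a ->
  \int[fam_law c]_f a f = \int[ts_P c]_w a (sub_cascade c [::] w).
Proof.
move=> ma; have ma' : measurable_fun setT (EFin \o a) by exact/measurable_EFinP.
rewrite /Rintegral integralE [in RHS]integralE; congr (fine (_ - _)).
  rewrite ge0_integral_fam_law//; last exact: measurable_funepos.
  by apply: eq_integral => w _; rewrite !funeposE.
rewrite ge0_integral_fam_law//; last exact: measurable_funeneg.
by apply: eq_integral => w _; rewrite !funenegE.
Qed.

(** The vector counterpart of [nFMS_step], at the points where the scalar
    solution is finite. *)
Lemma vmean_step G : dominated G ->
  B_nFNS_defined h (vmean G) (vmean G) xi t /\
  vmean (fam_step chi0 (@odot R n) G) xi t =
  U_nFNS chi0 xi t + B_nFNS h (vmean G) (vmean G) xi t.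
Proof.
move=> dG; have [iV iM VM] := branch_odot_mean dG.
have mvm := cv_measurable_vmean dG.1.
have [Bdef BE] := B_nFNS_split mvm mvm iM; split; first exact: Bdef.
rewrite BE.
have mge : measurable [set s : R | t <= s].
  rewrite (_ : [set s | _] = [set` Interval (BLeft t) +oo%O]); first exact: measurable_itv.
  by apply/seteqP; split => x /=; rewrite in_itv/= andbT.
have mtail : measurable (T0 @^-1` [set s : R | t <= s]).
  by rewrite -[X in measurable X]setTI; exact: ts_measurable_T.
apply/coordP => q; rewrite coordD -VM coordZ !coord_cv_integral.
have mstep : measurable_fun setT (fun f => coord q (fam_step chi0 (@odot R n) G (f, t))).
  have : cv_measurable (fam_step chi0 (@odot R n) G).
    apply: cv_measurable_if; first exact: measurable_clock_test.
      apply: (cv_measurable_comp mchi0).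
      exact: measurableT_comp (measurable_fam_label [::]) measurable_fst.
    have ms b : measurable_fun setT (fun p : Fam * R =>
        (shift b p.1, p.2 - fam_clock [::] p.1)).
      apply: measurable_fun_pair.
        exact: measurableT_comp (measurable_shift b) measurable_fst.
      exact: measurableT_comp measurable_snd (measurable_clock_sub [::]).
    apply: cv_measurable_odot.
    - exact: measurableT_comp (measurable_fam_label [::]) measurable_fst.
    - exact: cv_measurable_comp dG.1 (ms false).
    - exact: cv_measurable_comp dG.1 (ms true).
  move=> /cv_measurableP /(_ q) mq; exact: measurableT_comp mq (measurable_pair2 _).
rewrite (Rintegral_fam_law (C xi) mstep).
pose e (w : ts_sort (C xi)) : R := \1_[set s | t <= s] (T0 w).
have i0 : P.-integrable setT (EFin \o e).
  have : P.-integrable setT (EFin \o \1_(T0 @^-1` [set s | t <= s])).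
    by apply: integrable_indic => //; rewrite (le_lt_trans (probability_le1 _ _))// ltry.
  by [].
have i1 : P.-integrable setT (EFin \o (fun w => coord q (chi0 xi) * e w)).
  exact: (integrableZl measurableT (coord q (chi0 xi)) i0).
have i2 : P.-integrable setT (EFin \o (fun w => coord q (branch_odot G w))).
  exact: (iffLR (cv_integrableP P setT (branch_odot G)) iV q).
transitivity (\int[P]_w (coord q (chi0 xi) * e w + coord q (branch_odot G w))); last first.
  apply: (etrans (RintegralD measurableT i1 i2)); congr (_ + _).
  apply: (etrans (RintegralZl _ measurableT i0)); rewrite mulrC; congr (_ * _).
  have E : (\int[P]_w (e w)%:E = (expR (- t * rate))%:E)%E.
    rewrite -(clock_tail hC xi0 t_ge0) -[X in P X]setIT -integral_indic//.
  by rewrite /Rintegral E.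
apply: Rintegral_ae; apply: filterS (cascade_root H) => w W0.
rewrite /fam_step /branch_odot /fam_clock /fam_label /e /= W0 indicE.
have [tT|tT] := leP t (T0 w).
  by rewrite (mem_set (tT : [set s | t <= s] _)) mulr1 (coord0 _ q) addr0.
have tN : ~ [set s | t <= s] (T0 w) by rewrite /= leNgt tT.
by rewrite (memNset tN) mulr0 add0r.
Qed.

End root.
End vector.

(** * Picard iterates of the vector equation *)

Section majorized.
Context (R : realType) (n : nat).
Local Notation rV := ('rV[R]_n).
Local Notation CV := ('rV[R[i]]_n).
Local Notation J := ('I_n * bool)%type.
Local Notation Fam := (family_of vertex (rV * R)%type).
Context (h : rV -> R) (C : rV -> tree_space R n).
Context (hC : forall xi, xi != 0 -> is_cascade h C xi).
Context (n_gt0 : (0 < n)%N).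
Context (h_gt0 : forall x, 0 < h x) (mh : measurable_fun setT h).
Context (chi0 : rV -> CV) (mchi0 : cv_measurable chi0).
Let psi0 (x : rV) : \bar R := (cnorm (chi0 x) / 2)%:E.
Local Notation Psi := (mean C (valY psi0)).
Let mpsi0 : measurable_fun setT psi0 := measurable_psi0 mchi0.
Let psi00 : forall x, (0 <= psi0 x)%E := psi0_ge0 chi0.

Lemma eq_if_then (A : Type) (b : bool) (x y z : A) : (b -> x = y) ->
  (if b then x else z) = (if b then y else z).
Proof. by case: b => // ->. Qed.

Lemma dominated_approxX k : dominated chi0 (approxX chi0 k).
Proof.
split; first exact: cv_measurable_approxX.
move=> p; apply: (le_trans (cnorm_approxX chi0 k p)).
by rewrite lee_wpmul2l//; exact: approxY_le_valY.
Qed.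

Lemma dominated_valX : dominated chi0 (valX chi0).
Proof. split; [exact: cv_measurable_valX|exact: cnorm_valX]. Qed.

Lemma measurable_Hker_joint :
  measurable_fun setT (fun z : rV * rV => Hker h z.1 z.2).
Proof.
have ms : measurable_fun setT (fun z : rV * rV => z.2 - z.1).
  apply: measurable_fun_row => i; under eq_fun do rewrite !mxE.
  apply: measurable_funB.
    exact: measurableT_comp (measurable_coord i) measurable_snd.
  exact: measurableT_comp (measurable_coord i) measurable_fst.
apply: measurable_funM.
  apply: measurable_funM; first exact: measurableT_comp mh measurable_fst.
  exact: measurableT_comp mh ms.
rewrite (_ : (fun _ => _) = fun z : rV * rV => (enorm z.2 * h z.2) `^ (-1)).
  apply: (measurableT_comp (measurable_powR _)); apply: measurable_funM.
    exact: measurable_enorm.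
  exact: measurableT_comp mh measurable_snd.
by apply/funext => z; rewrite powR_inv1// mulr_ge0 ?enorm_ge0// ltW.
Qed.

Lemma measurable_Rintegral_sigma_finite d1 d2 (T1 : measurableType d1)
    (T2 : measurableType d2) (mu : {sigma_finite_measure set T2 -> \bar R})
    (f : T1 * T2 -> R) : measurable_fun setT f ->
  measurable_fun setT (fun x => \int[mu]_y f (x, y)).
Proof.
move=> mf; apply: (@measurable_param_Rintegral _ _ T1 T2 R (fun=> mu) f) => //.
by move=> g mg g0; exact: measurable_fun_fubini_tonelli_F.
Qed.

(** Picard iterates are defined by integrals at every point, also where the
    integrals do not converge; they stay jointly measurable there, which
    [B_nFNS_vmean] needs. *)
Lemma cv_measurable_B_nFNS (f : rV -> R -> CV) :
  cv_measurable (fun z : rV * R => f z.1 z.2) ->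
  cv_measurable (fun z : rV * R => B_nFNS h f f z.1 z.2).
Proof.
move=> mf; apply/cv_measurableP => q.
pose phi (z : ((rV * R) * R) * rV) : R :=
  Hker h z.2 z.1.1.1 * coord q (odot z.1.1.1 (f z.2 (z.1.1.2 - z.1.2))
     (f (z.1.1.1 - z.2) (z.1.1.2 - z.1.2))).
have m11 : measurable_fun setT (fun z : ((rV * R) * R) * rV => z.1.1).
  exact: measurableT_comp measurable_fst measurable_fst.
have m111 : measurable_fun setT (fun z : ((rV * R) * R) * rV => z.1.1.1).
  exact: measurableT_comp measurable_fst m11.
have ms : measurable_fun setT (fun z : ((rV * R) * R) * rV => z.1.1.2 - z.1.2).
  apply: measurable_funB; first exact: measurableT_comp measurable_snd m11.
  exact: measurableT_comp measurable_snd measurable_fst.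
have mphi : measurable_fun setT phi.
  apply: measurable_funM.
    apply: (measurableT_comp measurable_Hker_joint (g := fun z : ((rV * R) * R) * rV => (z.2, z.1.1.1))).
    exact: measurable_fun_pair.
  have mo : cv_measurable (fun z : ((rV * R) * R) * rV =>
      odot z.1.1.1 (f z.2 (z.1.1.2 - z.1.2)) (f (z.1.1.1 - z.2) (z.1.1.2 - z.1.2))).
    apply: cv_measurable_odot => //.
      apply: (cv_measurable_comp mf (f := fun z : ((rV * R) * R) * rV => (z.2, z.1.1.2 - z.1.2))).
      exact: measurable_fun_pair.
    apply: (cv_measurable_comp mf (f := fun z : ((rV * R) * R) * rV =>
       (z.1.1.1 - z.2, z.1.1.2 - z.1.2))).
    apply: measurable_fun_pair => //.
    apply: measurable_fun_row => i; under eq_fun do rewrite !mxE.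
    apply: measurable_funB; first exact: measurableT_comp (measurable_coord i) m111.
    exact: measurableT_comp (measurable_coord i) measurable_snd.
  by move/cv_measurableP: mo; exact.
pose I (z : (rV * R) * R) : R := \int[lebesgue_rV R n]_eta phi (z, eta).
have mI : measurable_fun setT I by exact: measurable_Rintegral_sigma_finite.
pose K (z : (rV * R) * R) : R :=
  if (0 <= z.2) && (z.2 <= z.1.2) then time_density z.1.1 z.2 * I z else 0.
have m1 : measurable_fun setT (fun z : (rV * R) * R => z.1.1).
  exact: measurableT_comp measurable_fst measurable_fst.
have mK : measurable_fun setT K.
  apply: measurable_fun_ifT => //.
    apply: measurable_and; first exact: measurable_fun_ler.
    by apply: measurable_fun_ler => //; exact: measurableT_comp measurable_snd measurable_fst.
  apply: measurable_funM => //; apply: measurable_funM; last first.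
    exact: measurable_funX (measurable_enorm m1).
  apply: measurableT_comp => //; apply: measurable_funM; first exact: measurableT_comp.
  exact: measurable_funX (measurable_enorm m1).
rewrite (_ : (fun _ => _) = fun z : rV * R => \int[@lebesgue_measure R]_s K (z, s)).
  have mK' : measurable_fun [set: (rV * R) * measurableTypeR R] K by exact: mK.
  exact: (measurable_Rintegral_sigma_finite (@lebesgue_measure R) mK').
apply/funext => z; apply: (etrans (coord_cv_integral _ q _ _)).
rewrite Rintegral_mkcond; apply: eq_Rintegral => s _.
rewrite patchE /K /=; case: ifPn => /= [/set_mem|sN]; rewrite ?in_itv /=.
  rewrite /= in_itv/= => ->; rewrite coordZ; congr (_ * _).
  apply: (etrans (coord_cv_integral _ q _ _)).
  by apply: eq_Rintegral => eta _; rewrite coordZ.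
by case: ifP => // s0t; move/negP: sN => -[]; apply/mem_set; rewrite /= in_itv.
Qed.

Lemma cv_measurable_picard k :
  cv_measurable (fun z : rV * R => picard_nFNS h chi0 k z.1 z.2).
Proof.
elim: k => [|k IH]; first by move=> j; split; exact: measurable_cst.
apply/cv_measurableP => q; have mB := cv_measurable_B_nFNS IH.
rewrite (_ : (fun _ => _) = fun z : rV * R =>
  expR (- z.2 * enorm z.1 ^+ 2) * coord q (chi0 z.1) +
  coord q (B_nFNS h (picard_nFNS h chi0 k) (picard_nFNS h chi0 k) z.1 z.2)).
  apply: measurable_funD; last by move/cv_measurableP: mB; exact.
  apply: measurable_funM; last first.
    have mq := iffLR (cv_measurableP chi0) mchi0 q; exact: measurableT_comp mq measurable_fst.
  apply: measurableT_comp => //; apply: measurable_funM; first exact: measurableT_comp.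
  apply: measurable_funX; exact: measurable_enorm.
by apply/funext => z; rewrite /= coordD coordZ.
Qed.

Section root.
Context (xi : rV) (xi0 : xi != 0).
Local Notation P := (ts_P (C xi)).
Local Notation T0 := (ts_T (C xi) [::]).
Local Notation W1 := (ts_W (C xi) [:: false]).
Local Notation F1 := (sub_cascade (C xi) [:: false]).
Local Notation F2 := (sub_cascade (C xi) [:: true]).
Let H : is_cascade h C xi := hC xi0.

(** The first label has a density, hence no atoms. *)
Lemma label1_neq x : {ae P, forall w, W1 w != x}.
Proof.
exists (W1 @^-1` [set x]); split.
- by rewrite -[X in measurable X]setTI; apply: ts_measurable_W => //; exact: measurable_row1.
- apply: (etrans (label1_law hC xi0 (measurable_row1 x))).
  rewrite (@integral_off_null _ _ R (lebesgue_rV R n) [set x] [set x] _ (cst 0%E)).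
  + by rewrite integral0.
  + exact: measurable_row1.
  + exact: lebesgue_rV1.
  + by move=> y -> /(_ erefl).
- by move=> w /= /negP; rewrite negbK => /eqP.
Qed.

Context (t : R) (t_ge0 : 0 <= t) (Psi_fin : (Psi xi t < +oo)%E).

(** The expectation of these products is part of [Psi xi t], hence finite. A
    single factor may still be infinite. *)
Lemma Psi_products_fin : {ae P, forall w, T0 w < t ->
  (Psi (W1 w) (t - T0 w)%R * Psi (xi - W1 w)%R (t - T0 w)%R < +oo)%E}.
Proof.
have mv := measurable_valY mpsi0; have v0 := valY_ge0 psi00.
pose f w := if T0 w < t then (Psi (W1 w) (t - T0 w)%R * Psi (xi - W1 w)%R (t - T0 w)%R)%E else 0%E.
have f0 w : (0 <= f w)%E.
  by rewrite /f; case: ifP => // _; rewrite mule_ge0//; exact: mean_ge0.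
have mP : measurable_fun setT (fun z : rV * R => Psi z.1 z.2).
  exact: (measurable_mean hC n_gt0 mv v0).
have mf : measurable_fun setT f.
  apply: measurable_clock_if; apply: emeasurable_funM.
    exact: measurableT_comp mP (@measurable_label1_at R n C xi t).
  exact: measurableT_comp mP (@measurable_label2_at R n C xi t).
have fi : P.-integrable setT f.
  apply/integrableP; split => //.
  rewrite (_ : (\int[P]_w _)%E = (\int[P]_w f w)%E); last first.
    by apply: eq_integral => w _; rewrite gee0_abs.
  rewrite -(ge0_integral_branch hC n_gt0 xi0 t mv mv v0 v0).
  exact: branch_valY_fin.
apply: filterS (integrable_ae measurableT fi) => w /(_ I) + tT; rewrite /f tT.
by move=> fw; rewrite ltey_eq fw.
Qed.

(** If one factor of the almost surely finite product of scalar solutions is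
    infinite, the other one is 0; then the vector mean of [G] vanishes there,
    and so do both bilinear products, whatever the value of [f] at the point
    where it is not controlled. *)
Lemma split_odot_ae (f : rV -> R -> CV) G : dominated chi0 G ->
  (forall eta s, eta != 0 -> 0 <= s -> (Psi eta s < +oo)%E -> f eta s = vmean C G eta s) ->
  {ae P, forall w, split_odot t f f w = split_odot t (vmean C G) (vmean C G) w}.
Proof.
move=> dG fG.
have z0 eta s : (Psi eta s = 0)%E -> vmean C G eta s = 0.
  move=> P0; apply: cnorm_eq0; apply/eqP; rewrite eq_le cnorm_ge0 andbT -lee_fin.
  by have := cnorm_vmean_le mchi0 (C := C) (x := eta) (s := s) dG; rewrite P0 mule0; apply.
have Pge0 eta s : (0 <= Psi eta s)%E by apply: mean_ge0; exact: valY_ge0.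
apply: filterS3 Psi_products_fin (label1_neq 0) (label1_neq xi) => w PP w0 wx.
apply: eq_if_then => tT; move: (PP tT).
have s0 : 0 <= t - T0 w by rewrite subr_ge0 ltW.
have wx' : xi - W1 w != 0 by rewrite subr_eq0 eq_sym.
have yz (y : \bar R) : (0 <= y)%E -> (+oo * y < +oo)%E -> y = 0%E.
  move=> y0; have [->//|y1] := eqVneq y 0%E.
  by rewrite gt0_mulye// lt0e y1.
have odot_eq (a a' b b' : CV) : a = a' -> b = b' -> odot xi a b = odot xi a' b'.
  by move=> -> ->.
have odot_eqr (a a' b b' : CV) : b = b' -> b' = 0 -> odot xi a b = odot xi a' b'.
  by move=> -> ->; rewrite !odot0r.
have odot_eql (a a' b b' : CV) : a = a' -> a' = 0 -> odot xi a b = odot xi a' b'.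
  by move=> -> ->; rewrite !odot0l.
have [x1|x1] := eqVneq (Psi (W1 w) (t - T0 w)) +oo%E.
  rewrite x1 => /(yz _ (Pge0 _ _)) y0; apply: odot_eqr; last exact: z0.
  by apply: fG wx' s0 _; rewrite y0 ltry.
have [y1|y1] := eqVneq (Psi (xi - W1 w) (t - T0 w)) +oo%E.
  rewrite y1 muleC => /(yz _ (Pge0 _ _)) x0; apply: odot_eql; last exact: z0.
  by apply: fG w0 s0 _; rewrite x0 ltry.
by move=> _; apply: odot_eq; [apply: fG w0 s0 _|apply: fG wx' s0 _]; rewrite ltey.
Qed.

(** A function that agrees with a vector mean where the scalar solution is
    finite may replace it in the bilinear term. Picard iterates and the cascade
    solution are both used through this lemma. *)
Lemma B_nFNS_vmean (f : rV -> R -> CV) G : dominated chi0 G ->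
  cv_measurable (fun z : rV * R => f z.1 z.2) ->
  (forall eta s, eta != 0 -> 0 <= s -> (Psi eta s < +oo)%E -> f eta s = vmean C G eta s) ->
  B_nFNS_defined h f f xi t /\
  U_nFNS chi0 xi t + B_nFNS h f f xi t = vmean C (fam_step chi0 (@odot R n) G) xi t.
Proof.
move=> dG mf fG.
have [_ /cv_integrableP iM _] := branch_odot_mean hC n_gt0 mchi0 xi0 Psi_fin dG.
have ae := split_odot_ae dG fG.
have mvm := cv_measurable_vmean hC n_gt0 dG.1.
have mS : cv_measurable (split_odot (C := C) (xi := xi) t f f).
  apply: cv_measurable_if.
  - by apply: measurable_fun_ltr => //; exact: ts_measurable_T.
  - apply: cv_measurable_odot => //.
      exact: (cv_measurable_comp mf (@measurable_label1_at R n C xi t)).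
    exact: (cv_measurable_comp mf (@measurable_label2_at R n C xi t)).
  - by move=> j; split; exact: measurable_cst.
have iS : cv_integrable P setT (split_odot (C := C) (xi := xi) t f f).
  apply/cv_integrableP => q.
  apply: (@integrable_ae_eq _ _ _ P (fun w => coord q (split_odot t (vmean C G) (vmean C G) w))).
  - by move/cv_measurableP: mS; exact.
  - by apply: filterS ae => w ->.
  - exact: iM.
have [Bf BfE] := B_nFNS_split hC h_gt0 mh xi0 mf mf iS.
have [_ BvE] := B_nFNS_split hC h_gt0 mh xi0 mvm mvm (iffRL (cv_integrableP _ _ _) iM).
have [_ ->] := vmean_step hC n_gt0 h_gt0 mh mchi0 xi0 t_ge0 Psi_fin dG.
split; first exact: Bf.
apply: (congr1 (fun z => U_nFNS chi0 xi t + z)).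
apply: (etrans BfE); apply/esym; apply: (etrans BvE); apply/esym.
apply/coordP => q.
apply: (etrans (coord_cv_integral P q setT _)); apply/esym.
apply: (etrans (coord_cv_integral P q setT _)); apply/esym.
by apply: Rintegral_ae; apply: filterS ae => w; apply: congr1.
Qed.

End root.

Lemma picard_vmean k xi t : xi != 0 -> 0 <= t -> (Psi xi t < +oo)%E ->
  picard_nFNS h chi0 k xi t = vmean C (approxX chi0 k) xi t.
Proof.
elim: k xi t => [|k IH] xi t xi0 t0 Pf.
  apply/coordP => q; apply: (etrans (coord0 _ q)); apply/esym.
  apply: (etrans (coord_vmean _ q _ _ _)); rewrite /rmean /Rintegral.
  have -> : (\int[fam_law (C xi)]_f (coord q (approxX chi0 0 (f, t)))%:E = 0)%E.
    by apply: integral0_eq => f _; exact: (congr1 EFin (coord0 _ q)).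
  exact: erefl.
rewrite approxXS.
have [_ <-] := B_nFNS_vmean xi0 t0 Pf (dominated_approxX k) (cv_measurable_picard k) IH.
by [].
Qed.

Lemma picard_defined k xi t : xi != 0 -> 0 <= t -> (Psi xi t < +oo)%E ->
  B_nFNS_defined h (picard_nFNS h chi0 k) (picard_nFNS h chi0 k) xi t.
Proof.
move=> xi0 t0 Pf.
by have [] := B_nFNS_vmean xi0 t0 Pf (dominated_approxX k) (cv_measurable_picard k)
  (fun eta s e0 s0 ef => picard_vmean k e0 s0 ef).
Qed.

End majorized.

(** * The cascade solutions as vector means *)

Section live.
Context (R : realType) (n : nat).
Local Notation rV := ('rV[R]_n).
Local Notation CV := ('rV[R[i]]_n).
Local Notation Fam := (family_of vertex (rV * R)%type).
Context (h : rV -> R) (C : rV -> tree_space R n).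
Context (hC : forall xi, xi != 0 -> is_cascade h C xi).
Context (chi0 : rV -> CV) (mchi0 : cv_measurable chi0).
Local Notation psi0 := (fun x : rV => (cnorm (chi0 x) / 2)%:E).
Local Notation Psi := (mean C (valY psi0)).

(** The explosion time as a function of the family of labels and clocks; it is
    [explosion_time] at the family of the cascade. *)
Definition fam_explosion (f : Fam) : \bar R :=
  ereal_sup [set \big[Order.min/+oo%E]_(v : k.-tuple bool)
                    \sum_(j < k.+1) (fam_clock (take j v) f)%:E | k in [set: nat]]%E.

Lemma measurable_explosion_test :
  measurable_fun setT (fun p : Fam * R => (p.2%:E < fam_explosion p.1)%E).
Proof.
apply: (measurable_fun_bool true); rewrite setTI.
rewrite (_ : _ @^-1` _ = \bigcup_k \bigcap_(v in [set: k.-tuple bool])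
   [set p : Fam * R | (p.2%:E < \sum_(j < k.+1) (fam_clock (take j v) p.1)%:E)%E]); last first.
  apply/seteqP; split => p /=.
    move=> /ereal_sup_gtP[_ [k _ <-] /bigmin_gtP[_ H]].
    by exists k => // v _; exact: H.
  move=> [k _ H]; apply/ereal_sup_gtP.
  exists (\big[Order.min/+oo]_(v : k.-tuple bool)
                    \sum_(j < k.+1) (fam_clock (take j v) p.1)%:E)%E; first by exists k.
  by apply/bigmin_gtP; split => [|v _]; [exact: ltry|exact: H].
apply: bigcupT_measurable => k; apply: fin_bigcap_measurable => // v _.
have ms : measurable_fun setT (fun p : Fam * R =>
    \sum_(j < k.+1) (fam_clock (take j v) p.1)%:E)%E.
  apply: emeasurable_sum => j; apply/measurable_EFinP.
  exact: measurableT_comp (measurable_fam_clock _) measurable_fst.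
have m2 : measurable_fun setT (fun p : Fam * R => p.2%:E) by exact/measurable_EFinP.
have := measurable_fun_lte m2 ms measurableT (Y := [set true]).
by rewrite setTI; exact.
Qed.

Definition live_val (p : Fam * R) : CV :=
  if (p.2%:E < fam_explosion p.1)%E then valX chi0 p else 0.

Lemma cv_measurable_live_val : cv_measurable live_val.
Proof.
apply: cv_measurable_if; first exact: measurable_explosion_test.
  exact: cv_measurable_valX.
by move=> j; split; exact: measurable_cst.
Qed.

Let measurable_coord_at (G : Fam * R -> CV) q t : cv_measurable G ->
  measurable_fun setT (fun f => coord q (G (f, t))).
Proof.
move=> /cv_measurableP /(_ q) mG; exact: measurableT_comp mG (measurable_pair2 _).
Qed.

(** Valid for every starting point, the origin included, this form gives the
    joint measurability of the cascade solution. *)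
Lemma cascade_solutionE x t : cascade_solution C chi0 x t = vmean C live_val x t.
Proof.
apply/coordP => q; apply: (etrans (coord_cv_integral _ q _ _)).
apply: etrans (esym (coord_cv_integral _ q _ _)).
apply: etrans (esym (Rintegral_fam_law _ (measurable_coord_at q t cv_measurable_live_val))).
by [].
Qed.

Section root.
Context (xi : rV) (xi0 : xi != 0) (t : R).
Local Notation c := (C xi).
Local Notation P := (ts_P (C xi)).
Let H : is_cascade h C xi := hC xi0.

Lemma liveX_ae : {ae P, forall w, liveX chi0 t w = valX chi0 (sub_cascade c [::] w, t)}.
Proof.
apply: filterS (explosion_ae hC xi0 t) => w wt; rewrite /liveX.
case: ifPn => [_|tz]; first exact: erefl.
apply/esym/tree_val_none => -[x tx].
by move/negP: tz; apply; exact: wt tx.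
Qed.

Lemma cascade_solution_valX : cascade_solution C chi0 xi t = vmean C (valX chi0) xi t.
Proof.
apply/coordP => q; apply: (etrans (coord_cv_integral _ q _ _)).
apply: etrans (esym (coord_cv_integral _ q _ _)).
apply: etrans (esym (Rintegral_fam_law _ (measurable_coord_at q t (cv_measurable_valX mchi0)))).
by apply: Rintegral_ae; apply: filterS liveX_ae => w; exact: congr1.
Qed.

Local Notation wgt w := ((fam_weight t (sub_cascade c [::] w) (thinning c w))%:R : R).

Lemma Rintegral_thinning (a : Fam * R -> R) : measurable_fun setT a ->
  (forall p, fam_internal p = None -> a p = 0) ->
  \int[P]_w (wgt w * a (sub_cascade c [::] w, t)) = \int[P]_w a (sub_cascade c [::] w, t).
Proof.
move=> ma aN; have mea : measurable_fun setT (EFin \o a) by exact/measurable_EFinP.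
rewrite /Rintegral integralE [in RHS]integralE; congr (fine (_ - _)).
  transitivity (\int[P]_w (EFin \o a)^\+ (sub_cascade c [::] w, t))%E; last first.
    by apply: eq_integral => w _; rewrite !funeposE.
  rewrite -(ge0_integral_thinning hC xi0 (f := (EFin \o a)^\+%E)).
  - apply: eq_integral => w _; rewrite !funeposE /= -!EFin_max -EFinM.
    by rewrite maxr_pMr// mulr0.
  - exact: measurable_funepos.
  - by move=> p; rewrite funeposE le_max lexx orbT.
  - by move=> p pN; rewrite funeposE /= aN// maxxx.
transitivity (\int[P]_w (EFin \o a)^\- (sub_cascade c [::] w, t))%E; last first.
  by apply: eq_integral => w _; rewrite !funenegE.
rewrite -(ge0_integral_thinning hC xi0 (f := (EFin \o a)^\-%E)).
- apply: eq_integral => w _; rewrite !funenegE /= -!EFin_max -EFinM.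
  by rewrite maxr_pMr// mulr0 mulrN.
- exact: measurable_funeneg.
- by move=> p; rewrite funenegE le_max lexx orbT.
- by move=> p pN; rewrite funenegE /= aN// oppr0 maxxx.
Qed.

Lemma valX_internal_none (p : Fam * R) : fam_internal p = None -> valX chi0 p = 0.
Proof. by move=> pN; apply: tree_val_none; exact: fam_internal_none. Qed.

(** Thinning multiplies the value by a weight of conditional mean 1 given the
    tree. *)
Lemma thinned_cascade_solution_valX :
  thinned_cascade_solution C chi0 xi t = vmean C (valX chi0) xi t.
Proof.
have mX := cv_measurable_valX mchi0.
apply/coordP => q; apply: (etrans (coord_cv_integral _ q _ _)).
apply: etrans (esym (coord_cv_integral _ q _ _)).
apply: etrans (esym (Rintegral_fam_law _ (measurable_coord_at q t mX))).
rewrite -(Rintegral_thinning (a := fun p => coord q (valX chi0 p))).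
- by apply: eq_Rintegral => w _; rewrite procXbarE coordZ.
- exact: (cv_measurableP (valX chi0)).1 mX q.
- move=> p pN; apply: (etrans _ (coord0 _ q)).
  by rewrite valX_internal_none.
Qed.

Lemma thinned_solutionE (phi0 : rV -> \bar R) : measurable_fun setT phi0 ->
  (forall x, 0 <= phi0 x)%E -> thinned_solution C phi0 xi t = mean C (valY phi0) xi t.
Proof.
move=> mphi0 phi00; rewrite /mean ge0_integral_fam_law.
- rewrite -(ge0_integral_thinning hC xi0)//.
  + by apply: eq_integral => w _; rewrite procYbarE.
  + exact: measurable_valY.
  + by move=> p; exact: valY_ge0.
  + by move=> p pN; apply: tree_val_none; exact: fam_internal_none.
- exact: measurableT_comp (measurable_valY mphi0) (measurable_pair2 _).
- by move=> f; exact: valY_ge0.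
Qed.

Context (Psi_fin : (Psi xi t < +oo)%E).

Lemma cnorm_valX_mean_fin :
  (\int[P]_w (cnorm (valX chi0 (sub_cascade c [::] w, t)))%:E < +oo)%E.
Proof.
have dX : dominated chi0 (valX chi0).
  by split; [exact: cv_measurable_valX|exact: cnorm_valX].
have := mean_cnorm_le C mchi0 xi t dX; rewrite ge0_integral_fam_law.
- by move=> /le_lt_trans; apply; rewrite lte_mul_pinfty.
- apply/measurable_EFinP; apply: measurable_cnorm.
  exact: (cv_measurable_comp (cv_measurable_valX mchi0) (measurable_pair2 _)).
- by move=> f; rewrite lee_fin cnorm_ge0.
Qed.

Let mXS : cv_measurable (fun w : ts_sort c => valX chi0 (sub_cascade c [::] w, t)).
Proof.
apply: (cv_measurable_comp (cv_measurable_valX mchi0)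
  (f := fun w : ts_sort c => (sub_cascade c [::] w, t))).
by apply: measurable_fun_pair => //; exact: measurable_sub_cascade.
Qed.

Lemma liveX_integrable :
  (\int[P]_w (cnorm (liveX chi0 t w))%:E < +oo)%E /\
  cv_integrable P setT (liveX (c := c) chi0 t).
Proof.
have E : (\int[P]_w (cnorm (liveX chi0 t w))%:E < +oo)%E.
  rewrite (_ : (\int[P]_w _)%E =
    (\int[P]_w (cnorm (valX chi0 (sub_cascade c [::] w, t)))%:E)%E).
    exact: cnorm_valX_mean_fin.
  by apply: integral_ae; apply: filterS liveX_ae => w e _; rewrite e.
split; first exact: E.
apply: cv_integrable_cnorm E.
apply: (cv_measurable_comp cv_measurable_live_val
  (f := fun w : ts_sort c => (sub_cascade c [::] w, t))).
by apply: measurable_fun_pair => //; exact: measurable_sub_cascade.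
Qed.

Lemma procXbar_integrable :
  (\int[P]_w (cnorm (procXbar chi0 t w))%:E < +oo)%E /\
  cv_integrable P setT (procXbar (c := c) chi0 t).
Proof.
have E : (\int[P]_w (cnorm (procXbar chi0 t w))%:E < +oo)%E.
  rewrite (_ : (\int[P]_w _)%E =
    (\int[P]_w (cnorm (valX chi0 (sub_cascade c [::] w, t)))%:E)%E).
    exact: cnorm_valX_mean_fin.
  rewrite -(ge0_integral_thinning hC xi0 (f := fun p => (cnorm (valX chi0 p))%:E)).
  - by apply: eq_integral => w _; rewrite procXbarE cnormZ -EFinM /cmod /= expr0n addr0 sqrtr_sqr ger0_norm.
  - by apply/measurable_EFinP; apply: measurable_cnorm; exact: cv_measurable_valX.
  - by move=> p; rewrite lee_fin cnorm_ge0.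
  - by move=> p pN; rewrite valX_internal_none// cnorm0.
split; first exact: E.
apply: cv_integrable_cnorm E; apply/cv_measurableP => q.
rewrite (_ : (fun _ => _) = fun w =>
    wgt w * coord q (valX chi0 (sub_cascade c [::] w, t))).
  apply: measurable_funM; last by move/cv_measurableP: mXS; exact.
  apply: (measurableT_comp (@measurable_fam_weight R n t)
    (g := fun w => (sub_cascade c [::] w, thinning c w))).
  apply: measurable_fun_pair; first exact: measurable_sub_cascade.
  exact: measurable_thinning.
by apply/funext => w; rewrite procXbarE coordZ.
Qed.

(** Dominated convergence with dominating function 2 Y, coordinate by
    coordinate. *)
Lemma vmean_approxX_cvg :
  cnorm (vmean C (approxX chi0 k) xi t - vmean C (valX chi0) xi t) @[k --> \oo] --> (0 : R).
Proof.
have mpsi := measurable_psi0 mchi0; have psi00 := psi0_ge0 chi0.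
have mv : measurable_fun setT (fun f => valY psi0 (f, t)).
  exact: measurableT_comp (measurable_valY mpsi) (measurable_pair2 _).
have v0 f : (0 <= valY psi0 (f, t))%E by exact: valY_ge0.
have cc q : coord q (vmean C (approxX chi0 k) xi t) @[k --> \oo] -->
    coord q (vmean C (valX chi0) xi t).
  have iG : (fam_law c).-integrable setT (fun f => 2%:E * valY psi0 (f, t))%E.
    apply/integrableP; split; first exact: measurable_funeM.
    rewrite (_ : (\int[fam_law c]_f _)%E = (2%:E * Psi xi t)%E).
      by rewrite lte_mul_pinfty.
    rewrite /mean -ge0_integralZl//; apply: eq_integral => f _.
    by rewrite gee0_abs// mule_ge0.
  have [||||iv _ cv] := @dominated_convergence _ _ R (fam_law c) setT measurableT
    (fun k f => (coord q (approxX chi0 k (f, t)))%:E)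
    (fun f => (coord q (valX chi0 (f, t)))%:E)
    (fun f => 2%:E * valY psi0 (f, t))%E _ _ _ iG.
  - move=> k; apply/measurable_EFinP; apply: measurable_coord_at.
    exact: cv_measurable_approxX.
  - by apply/measurable_EFinP; apply: measurable_coord_at; exact: cv_measurable_valX.
  - apply: aeW => f _; apply: cvg_near_cst.
    by apply: filterS (approxX_near chi0 (f, t)) => k ->.
  - apply: aeW => f k _; apply: (@le_trans _ _ (cnorm (approxX chi0 k (f, t)))%:E).
      by rewrite lee_fin le_coord_cnorm.
    apply: (le_trans (cnorm_approxX chi0 k (f, t))).
    by rewrite lee_wpmul2l//; exact: approxY_le_valY.
  rewrite coord_vmean /rmean /Rintegral.
  rewrite (_ : (fun k => _) = fun k =>
    fine (\int[fam_law c]_f (coord q (approxX chi0 k (f, t)))%:E)); last first.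
    by apply/funext => k; rewrite coord_vmean.
  apply: fine_cvg; rewrite fineK//; exact: integrable_fin_num iv.
apply: (@squeeze_cvgr _ _ _ _ (cst 0) (fun k => \sum_q
  `|coord q (vmean C (approxX chi0 k) xi t) - coord q (vmean C (valX chi0) xi t)|)).
- apply: nearW => k; rewrite cnorm_ge0/=; apply: le_trans (cnorm_le_sum _) _.
  by apply: ler_sum => q _; rewrite coordD coordN.
- exact: cvg_cst.
- rewrite [X in _ --> X](_ : 0 = \sum_(q : 'I_n * bool) 0); last by rewrite big1.
  apply: cvg_big => [|q _]; first exact: add_continuous.
  rewrite -(normr0 R); apply: cvg_norm.
  rewrite -(subrr (coord q (vmean C (valX chi0) xi t))); apply: cvgB; first exact: cc.
  exact: cvg_cst.
Qed.

End root.
End live.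

(** * The value of the kernel at the origin, and sections of null sets *)

Section kernel_at_zero.
Context (R : realType) (n : nat) (n_gt0 : (0 < n)%N).
Local Notation rV := ('rV[R]_n).
Local Notation CV := ('rV[R[i]]_n).
Context (h : rV -> R) (hh : standard_majorizing h).

(** The value of a majorizing kernel at the origin is arbitrary. Replacing it by
    1 makes the kernel positive and measurable everywhere and affects only
    integrals over null sets. *)
Definition positive_kernel (x : rV) : R := if x == 0 then 1 else h x.
Local Notation h' := positive_kernel.

Lemma positive_kernel_gt0 x : 0 < h' x.
Proof. by rewrite /h'; case: eqVneq => // x0; have [+ _ _] := hh; apply. Qed.

Lemma measurable_kernel : measurable_fun setT h.
Proof.
have [_ mh _] := hh.
have m0 : measurable [set (0 : rV)] by exact: measurable_row1.
have E : [set: rV] = [set x | x != 0] `|` [set 0].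
  apply/seteqP; split => // x _; have [->|x0] := eqVneq x 0; [by right|by left].
rewrite E; apply/measurable_funU => //.
  rewrite (_ : [set x : rV | x != 0] = ~` [set 0]); first exact: measurableC.
  by apply/seteqP; split => x /= /eqP.
by split => //; exact: measurable_fun_set1.
Qed.

Lemma measurable_positive_kernel : measurable_fun setT h'.
Proof.
apply: measurable_fun_ifT => //; last exact: measurable_kernel.
apply: (measurable_fun_bool true); rewrite setTI.
rewrite (_ : _ @^-1` _ = [set (0 : rV)]); first exact: measurable_row1.
by apply/seteqP; split => x /= /eqP.
Qed.

(** When [xi] is 0, both kernels vanish because of the division by
    [enorm 0]. *)
Lemma Hker_positive_kernel (eta xi : rV) : ~ [set 0; xi] eta ->
  Hker h eta xi = Hker h' eta xi.
Proof.
move=> eN; have e0 : eta != 0 by apply/eqP => e; apply: eN; left.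
have ex : xi - eta != 0 by rewrite subr_eq0; apply/eqP => e; apply: eN; right.
rewrite /Hker /h' (negbTE e0) (negbTE ex); have [->|//] := eqVneq xi 0.
by rewrite enorm0 !mul0r.
Qed.

Let mN (xi : rV) : measurable [set 0; xi].
Proof. by apply: measurableU; exact: measurable_row1. Qed.

Let null (xi : rV) : lebesgue_rV R n [set 0; xi] = 0%E.
Proof.
apply: etrans (measureU0 _ _ (lebesgue_rV1 xi n_gt0)) (lebesgue_rV1 0 n_gt0);
  exact: measurable_row1.
Qed.

Lemma is_cascade_positive_kernel (C : rV -> tree_space R n) xi :
  is_cascade h C xi -> is_cascade h' C xi.
Proof.
have E : (fun (x : rV) A => \int[lebesgue_rV R n]_(eta in A) (Hker h eta x)%:E)%E =
         (fun (x : rV) A => \int[lebesgue_rV R n]_(eta in A) (Hker h' eta x)%:E)%E.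
  apply/funext => x; apply/funext => A; apply: (integral_off_null (mN x) (null x)).
  by move=> eta _ eN; rewrite Hker_positive_kernel.
move=> H; constructor; first exact: cascade_root H.
- exact: cascade_clock H.
- by move=> v; have := cascade_density H v; rewrite E.
- exact: cascade_clock_indep H.
- exact: cascade_split H.
- exact: cascade_restart1 H.
- exact: cascade_restart2 H.
- exact: cascade_branching H.
- exact: cascade_clock_subtrees H.
- exact: cascade_bernoulli H.
- exact: cascade_K_indep H.
- exact: cascade_thinning_indep H.
Qed.

Lemma B_nFMS_positive_kernel : B_nFMS h = B_nFMS h'.
Proof.
apply/funext => f; apply/funext => g; apply/funext => xi; apply/funext => t.
apply: eq_integral => s _; congr (_ * _)%E.
apply: (integral_off_null (mN xi) (null xi)) => eta _ eN.
by rewrite Hker_positive_kernel.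
Qed.

Lemma picard_nFMS_positive_kernel psi0 k : picard_nFMS h psi0 k = picard_nFMS h' psi0 k.
Proof.
elim: k => [|k IH]; first exact: erefl.
apply/funext => xi; apply/funext => t.
apply: (congr1 (fun z => U_nFMS psi0 xi t + z)%E).
apply: etrans (congr1 (fun f => B_nFMS h f f xi t) IH) _.
exact: (congr1 (fun B => B (picard_nFMS h' psi0 k) _ xi t) B_nFMS_positive_kernel).
Qed.

Lemma B_nFNS_positive_kernel : B_nFNS h = B_nFNS h'.
Proof.
apply/funext => f; apply/funext => g; apply/funext => xi; apply/funext => t.
apply: (congr1 (cv_integral (@lebesgue_measure R) `[0, t])); apply/funext => s.
apply: (congr1 (fun z : CV => _ *: z)).
apply/coordP => q; apply: (etrans (coord_cv_integral _ q _ _)).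
apply: etrans (esym (coord_cv_integral _ q _ _)).
apply: (congr1 fine); apply: (integral_off_null (mN xi) (null xi)) => eta _ eN.
by apply: (congr1 (fun z => (coord q (real_complex R z *: _))%:E)); exact: Hker_positive_kernel.
Qed.

Lemma picard_nFNS_positive_kernel chi0 k : picard_nFNS h chi0 k = picard_nFNS h' chi0 k.
Proof.
elim: k => [|k IH]; first exact: erefl.
apply/funext => xi; apply/funext => t.
apply: (congr1 (fun z => U_nFNS chi0 xi t + z)).
apply: etrans (congr1 (fun f => B_nFNS h f f xi t) IH) _.
exact: (congr1 (fun B => B (picard_nFNS h' chi0 k) _ xi t) B_nFNS_positive_kernel).
Qed.

(** Integrability includes measurability, so a modification on a null set is not
    enough; but the quotient of the two kernels is a measurable function of
    [eta]. *)
Lemma B_nFNS_defined_positive_kernel f g xi t : xi != 0 ->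
  B_nFNS_defined h' f g xi t -> B_nFNS_defined h f g xi t.
Proof.
move=> xi0 /cv_integrableP I; apply/cv_integrableP => q.
have /integrableP[m1 fin1] := I q.
pose r (eta : rV) := Hker h eta xi / Hker h' eta xi.
have H'0 eta : Hker h' eta xi != 0.
  rewrite /Hker !mulf_neq0 ?invr_neq0 ?mulf_neq0//;
    do ?[by rewrite gt_eqF// positive_kernel_gt0].
  by rewrite gt_eqF// enorm_gt0.
have mr : measurable_fun setT r.
  have mi : measurable_fun setT (fun eta : rV => (Hker h' eta xi)^-1).
    rewrite (_ : (fun _ => _) = fun eta => Hker h' eta xi `^ (-1)).
      apply: (measurableT_comp (measurable_powR _)).
      exact: measurable_Hker measurable_positive_kernel.
    apply/funext => eta; rewrite powR_inv1// Hker_ge0//.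
    exact: positive_kernel_gt0.
  apply: measurable_funM mi; exact: measurable_Hker measurable_kernel.
have alg (a u v w : R) : v != 0 -> a * u * w = u / v * (a * v * w).
  by move=> v0; field.
have E (p : R * rV) :
    coord q ((expR (- p.1 * enorm xi ^+ 2) * enorm xi ^+ 2 * Hker h p.2 xi)%:C%C *:
      odot xi (f p.2 (t - p.1)) (g (xi - p.2) (t - p.1))) =
    r p.2 * coord q ((expR (- p.1 * enorm xi ^+ 2) * enorm xi ^+ 2 * Hker h' p.2 xi)%:C%C *:
      odot xi (f p.2 (t - p.1)) (g (xi - p.2) (t - p.1))).
  rewrite !coordZ; exact: alg.
apply/integrableP; split.
  rewrite (_ : (fun _ => _) = fun p : R * rV => (r p.2)%:E *
    (coord q ((expR (- p.1 * enorm xi ^+ 2) * enorm xi ^+ 2 * Hker h' p.2 xi)%:C%C *: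
      odot xi (f p.2 (t - p.1)) (g (xi - p.2) (t - p.1))))%:E)%E; last first.
    by apply/funext => p; rewrite E EFinM.
  apply: emeasurable_funM; last exact: m1.
  apply: measurable_funTS; apply/measurable_EFinP; exact: measurableT_comp mr measurable_snd.
apply: le_lt_trans fin1; rewrite le_eqVlt; apply/orP; left; apply/eqP.
apply: (@integral_off_null _ _ R (@lebesgue_measure R \x lebesgue_rV R n)%E
  ([set: R] `*` [set 0; xi])).
- exact: measurableX.
- apply: (etrans (product_measure1E (@lebesgue_measure R) (lebesgue_rV R n) measurableT (mN xi))).
  by rewrite (null xi) mule0.
- move=> p _ pN; rewrite Hker_positive_kernel// => e; by apply: pN.
Qed.

End kernel_at_zero.

Section full_measure.
Context (R : realType) d (T : measurableType d)
  (mu : {sigma_finite_measure set T -> \bar R}).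

(** Almost every section of a null set is null, and a null subset of the line
    contains no open interval. *)
Lemma ae_product_sections (Q : T -> R -> Prop) :
  {ae (mu \x @lebesgue_measure R)%E, forall p, Q p.1 p.2} ->
  exists2 D : set T, mu.-negligible (~` D) &
    forall x a b, D x -> a < b -> exists2 s, a < s < b & Q x s.
Proof.
move=> [A [mA A0 QA]].
exists [set x | lebesgue_measure (xsection A x) = 0%E].
  have mS := measurable_fun_xsection (@lebesgue_measure R) mA.
  have := @ae_eq_integral_abs _ _ _ mu setT measurableT (lebesgue_measure \o xsection A) mS.
  rewrite (_ : (\int[mu]_x `|(lebesgue_measure \o xsection A) x|)%E = 0%E); last first.
    rewrite -A0; apply: eq_integral => x _; by rewrite gee0_abs.
  move=> [/(_ erefl) + _] => [[N [mN N0 SN]]]; exists N; split => //.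
  by move=> x /= xN; apply: SN => /= /(_ I).
move=> x a b /= x0 ab; apply: contrapT => noQ.
have sub : `]a, b[%classic `<=` xsection A x.
  move=> s /= sab; rewrite /xsection /=; apply/mem_set; apply: QA => /= Qs.
  by apply: noQ; exists s => //; move: sab; rewrite in_itv.
have : ((@lebesgue_measure R) `]a, b[%classic <= lebesgue_measure (xsection A x))%E.
  by apply: le_measure => //; rewrite inE//; exact: measurable_xsection.
by rewrite x0 lebesgue_measure_itv/= lte_fin ab -EFinB lee_fin subr_le0 leNgt ab.
Qed.

End full_measure.

(** * The vector solution and the theorem *)

Section chi.
Context (R : realType) (n : nat).
Local Notation rV := ('rV[R]_n).
Local Notation CV := ('rV[R[i]]_n).
Context (h : rV -> R) (C : rV -> tree_space R n).
Context (hC : forall xi, xi != 0 -> is_cascade h C xi).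
Context (n_gt0 : (0 < n)%N).
Context (h_gt0 : forall x, 0 < h x) (mh : measurable_fun setT h).
Context (chi0 : rV -> CV) (mchi0 : cv_measurable chi0).
Local Notation psi0 := (fun x : rV => (cnorm (chi0 x) / 2)%:E).
Local Notation Psi := (mean C (valY psi0)).
Local Notation chi := (cascade_solution C chi0).
Context (xi : rV) (xi0 : xi != 0) (t : R) (t_ge0 : 0 <= t) (Psi_fin : (Psi xi t < +oo)%E).

(** The value X satisfies the recursion exactly, so its mean is the mean of one
    step of the recursion. *)
Lemma cascade_solution_nFNS : B_nFNS_defined h chi chi xi t /\
  chi xi t = U_nFNS chi0 xi t + B_nFNS h chi chi xi t.
Proof.
have mchi : cv_measurable (fun z : rV * R => chi z.1 z.2).
  rewrite (_ : (fun _ => _) = fun z : rV * R => vmean C (live_val chi0) z.1 z.2).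
    by apply: (cv_measurable_vmean hC n_gt0); exact: cv_measurable_live_val.
  by apply/funext => z; exact: cascade_solutionE.
have chiE eta s : eta != 0 -> 0 <= s -> (Psi eta s < +oo)%E ->
    chi eta s = vmean C (valX chi0) eta s.
  by move=> eta0 _ _; exact: (cascade_solution_valX hC mchi0 eta0 s).
have [Bdef BE] := B_nFNS_vmean hC n_gt0 h_gt0 mh mchi0 xi0 t_ge0 Psi_fin
  (dominated_valX mchi0) mchi chiE.
split; first exact: Bdef.
apply: etrans (chiE _ _ xi0 t_ge0 Psi_fin) _; apply: etrans (esym BE).
exact: (congr1 (fun G => vmean C G xi t) (valX_step chi0)).
Qed.

Lemma picard_nFNS_cvg :
  cnorm (picard_nFNS h chi0 k xi t - chi xi t) @[k --> \oo] --> (0 : R).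
Proof.
have E : (fun k => cnorm (picard_nFNS h chi0 k xi t - chi xi t)) =
    fun k => cnorm (vmean C (approxX chi0 k) xi t - vmean C (valX chi0) xi t).
  apply/funext => k; apply: (congr1 (@cnorm R n)).
  apply: etrans (congr1 (fun z => z - chi xi t)
    (picard_vmean hC n_gt0 h_gt0 mh mchi0 k xi0 t_ge0 Psi_fin)) _.
  exact: (congr1 (fun z => vmean C (approxX chi0 k) xi t - z)
    (cascade_solution_valX hC mchi0 xi0 t)).
rewrite E; exact: vmean_approxX_cvg.
Qed.

Lemma cnorm_cascade_solution : ((cnorm (chi xi t))%:E <= 2%:E * Psi xi t)%E.
Proof.
have := cnorm_vmean_le mchi0 (dominated_valX mchi0) Psi_fin.
by rewrite -(cascade_solution_valX hC mchi0 xi0 t).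
Qed.

End chi.

Theorem proposition3p2 (R : realType) (d : nat) (hd : (3 <= d)%N)
    (h : 'rV[R]_d -> R) (hh : standard_majorizing h)
    (C : 'rV[R]_d -> tree_space R d)
    (hC : forall xi, xi != 0 -> is_cascade h C xi)
    (chi0 : 'rV[R]_d -> 'rV[R[i]]_d) (mchi0 : cv_measurable chi0) :
  let psi0 := fun xi => (cnorm (chi0 xi) / 2)%:E in
  let psi := minimal_solution C psi0 in
  let psibar := thinned_solution C psi0 in
  let chi := cascade_solution C chi0 in
  let chibar := thinned_cascade_solution C chi0 in
  [/\ (* (a) *)
      [/\ nFMS h psi0 psi,
          forall xi t, xi != 0 -> 0 <= t -> psi xi t = psibar xi t &
          forall xi t, xi != 0 -> 0 <= t ->
            picard_nFMS h psi0 k xi t @[k --> \oo] --> psi xi t],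
      (* (b) *)
      forall xi s t, xi != 0 -> 0 <= s -> s <= t ->
        ((expR (s * enorm xi ^+ 2))%:E * psi xi s <=
         (expR (t * enorm xi ^+ 2))%:E * psi xi t)%E,
      (* (c) *)
      forall T : \bar R, (0 < T)%E ->
        {ae (lebesgue_rV R d \x @lebesgue_measure R)%E, forall p,
          0 < p.2 -> (p.2%:E < T)%E -> (psi p.1 p.2 < +oo)%E} ->
        exists2 D : set 'rV[R]_d, (lebesgue_rV R d).-negligible (~` D) &
          forall xi t, D xi -> xi != 0 -> 0 <= t -> (t%:E < T)%E ->
            [/\ (\int[ts_P (C xi)]_w (cnorm (procXbar chi0 t w))%:E < +oo)%E /\
                (\int[ts_P (C xi)]_w (cnorm (liveX chi0 t w))%:E < +oo)%E,
                cv_integrable (ts_P (C xi)) setT (liveX (c := C xi) chi0 t) /\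
                cv_integrable (ts_P (C xi)) setT (procXbar (c := C xi) chi0 t),
                chi xi t = chibar xi t,
                [/\ B_nFNS_defined h chi chi xi t,
                    chi xi t = U_nFNS chi0 xi t + B_nFNS h chi chi xi t,
                    forall k, B_nFNS_defined h (picard_nFNS h chi0 k)
                                (picard_nFNS h chi0 k) xi t &
                    cnorm (picard_nFNS h chi0 k xi t - chi xi t)
                      @[k --> \oo] --> (0 : R)] &
                ((cnorm (chi xi t))%:E <= 2%:E * psi xi t)%E] &
      (* (d) *)
      forall phi0 gamma0 : 'rV[R]_d -> \bar R,
        measurable_fun setT phi0 -> measurable_fun setT gamma0 ->
        (forall x, 0 <= phi0 x)%E -> (forall x, 0 <= gamma0 x)%E ->
        (forall x, phi0 x <= gamma0 x)%E ->
        forall xi t, xi != 0 -> 0 < t ->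
          (minimal_solution C phi0 xi t <= minimal_solution C gamma0 xi t)%E].
Proof.
move=> psi0 psi psibar chi chibar.
have d_gt0 : (0 < d)%N by exact: leq_trans hd.
have h'0 := positive_kernel_gt0 hh.
have mh' := measurable_positive_kernel hh.
have hC' xi : xi != 0 -> is_cascade (positive_kernel h) C xi.
  by move=> /hC; exact: (is_cascade_positive_kernel d_gt0).
have mpsi0 : measurable_fun setT psi0 := measurable_psi0 mchi0.
have psi00 : forall x, (0 <= psi0 x)%E := psi0_ge0 chi0.
have psiE xi t : xi != 0 -> psi xi t = mean C (valY psi0) xi t.
  by move=> xi0; exact: (minimal_solutionE hC' xi0 t mpsi0 psi00).
have mono xi s t : xi != 0 -> 0 <= s -> s <= t ->
    ((expR (s * enorm xi ^+ 2))%:E * psi xi s <=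
     (expR (t * enorm xi ^+ 2))%:E * psi xi t)%E.
  move=> xi0 s0 st; rewrite !psiE//.
  exact: (Psi_mono hC' d_gt0 h'0 mh' mpsi0 psi00).
split.
- split.
  + move=> xi t xi0 t0; rewrite psiE//.
    apply: etrans (Psi_nFMS hC' d_gt0 h'0 mh' mpsi0 psi00 xi0 t0) _.
    apply: (congr1 (fun z => U_nFMS psi0 xi t + z)%E).
    apply: etrans (congr1 (fun B => B _ _ xi t) (esym (B_nFMS_positive_kernel d_gt0 h))) _.
    have e eta s : eta != 0 -> 0 <= s -> mean C (valY psi0) eta s = psi eta s.
      by move=> eta0 _; apply/esym; exact: psiE.
    exact: B_nFMS_ext.
  + move=> xi t xi0 t0; rewrite psiE//; apply/esym.
    exact: (thinned_solutionE hC' xi0 t mpsi0 psi00).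
  + move=> xi t xi0 t0; rewrite psiE//.
    have E : (fun k => picard_nFMS h psi0 k xi t) =
        fun k => picard_nFMS (positive_kernel h) psi0 k xi t.
      apply/funext => k.
      exact: (congr1 (fun f => f xi t) (picard_nFMS_positive_kernel d_gt0 h psi0 k)).
    rewrite E; exact: (picard_cvg hC' d_gt0 h'0 mh' mpsi0 psi00 xi0 t0).
- exact: mono.
- move=> T _ psi_ae.
  have [D DN DT] := ae_product_sections
    (Q := fun x s => 0 < s -> (s%:E < T)%E -> (psi x s < +oo)%E) psi_ae.
  exists D => // xi t Dxi xi0 t0 tT.
  (* finiteness at some time between t and T, then monotonicity *)
  have psi_fin : (mean C (valY psi0) xi t < +oo)%E.
    have [b tb bT] : exists2 b, t < b & (b%:E <= T)%E.
      case: T tT {psi_ae DT} => [T| |]// tT; first by exists T.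
      by exists (t + 1); rewrite ?ltrDl ?leey.
    have [s /andP[ts sb] Qs] := DT xi t b Dxi tb.
    have s0 : 0 < s by exact: le_lt_trans ts.
    have sT : (s%:E < T)%E by apply: lt_le_trans bT; rewrite lte_fin.
    have := mono xi t s xi0 t0 (ltW ts); rewrite -psiE//.
    have [->|] := eqVneq (psi xi t) +oo%E; last by rewrite ltey.
    rewrite mulry gtr0_sg ?expR_gt0// mul1e leye_eq => /eqP e.
    have := Qs s0 sT; have : ((expR (s * enorm xi ^+ 2))%:E * psi xi s < +oo)%E.
      by rewrite lte_mul_pinfty ?lee_fin ?expR_ge0//; exact: Qs.
    by rewrite e.
  have [l1 l2] := liveX_integrable hC' mchi0 xi0 psi_fin.
  have [x1 x2] := procXbar_integrable hC' mchi0 xi0 psi_fin.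
  have [n1 n2] := cascade_solution_nFNS hC' d_gt0 h'0 mh' mchi0 xi0 t0 psi_fin.
  split; [exact: (conj x1 l1)|exact: (conj l2 x2)| | |].
  + by apply: etrans (cascade_solution_valX hC' mchi0 xi0 t) _; apply/esym;
      exact: (thinned_cascade_solution_valX hC' mchi0 xi0 t).
  + split.
    * exact: (B_nFNS_defined_positive_kernel d_gt0 hh xi0 n1).
    * apply: etrans n2 _; apply: (congr1 (fun z => U_nFNS chi0 xi t + z)).
      exact: (congr1 (fun B => B chi _ xi t) (esym (B_nFNS_positive_kernel d_gt0 h))).
    * move=> k; apply: (B_nFNS_defined_positive_kernel d_gt0 hh xi0).
      apply: (@eq_ind_r _ _ (fun f => B_nFNS_defined (positive_kernel h) f f xi t) _ _
        (picard_nFNS_positive_kernel d_gt0 h chi0 k)).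
      exact: (picard_defined hC' d_gt0 h'0 mh' mchi0 k xi0 t0 psi_fin).
    * have E : (fun k => cnorm (picard_nFNS h chi0 k xi t - chi xi t)) =
          fun k => cnorm (picard_nFNS (positive_kernel h) chi0 k xi t - chi xi t).
        apply/funext => k.
        exact: (congr1 (fun f => cnorm (f xi t - chi xi t))
          (picard_nFNS_positive_kernel d_gt0 h chi0 k)).
      rewrite E; exact: (picard_nFNS_cvg hC' d_gt0 h'0 mh' mchi0 xi0 t0 psi_fin).
  + rewrite psiE//; exact: (cnorm_cascade_solution hC' mchi0 xi0 psi_fin).
- move=> phi0 gamma0 mphi mgamma p0 g0 pg xi t xi0 _.
  exact: (minimal_solution_le hC').
Qed.
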